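(* For each $n$ let $A=A_n=(a_1,\dots,a_n)$ be an initial planting of $k=k(n)$ balls in $n$ labeled bins (non-negative integers with $\sum_{i=1}^n a_i = k$), with $k/\sqrt n\to\infty$ as $n\to\infty$. Let $$V=V(A)=\frac{\sum_{i=1}^n a_i^2}{n}-\frac{k^2}{n^2},$$ let $c>0$ be a constant, and let $TV(m,n)=\|ST-PL_A\|_{TV}$ be the total variation distance between the standard and planted distributions on configurations of $m=m(n)$ balls in $n$ labeled bins. Let $\Phi$ be the standard normal distribution function. Then, as $n\to\infty$: 1. (Flat regime) If $V(A)=o\left(\frac{k}{n^{3/2}}\right)$ and $m\sim c\,k\,n^{1/2}$, then $$TV(m,n)=2\Phi\left(\frac{1}{2\sqrt2\,c}\right)-1+o(1).$$ 2. (Hilly regime) If $V(A)=\omega\left(\frac{k}{n^{3/2}}\right)$ and $m\sim c\,V n^2$, then $$TV(m,n)=2\Phi\left(\frac{1}{2\sqrt c}\right)-1+o(1).$$ 3. (Intermediate regime) If $V(A)\sim\lambda\frac{k}{n^{3/2}}$ with $\lambda>0$ a constant and $m\sim c\,k\,n^{1/2}$, then $$TV(m,n)=2\Phi\left(\frac12\sqrt{\frac{\lambda}{c}+\frac{1}{2c^2}}\right)-1+o(1).$$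
   Context: A configuration of $m$ balls in $n$ labeled bins is an ordered list $Z=(z_1,\dots,z_n)$ of non-negative integers with $\sum_i z_i=m$, where $z_i$ is the number of balls in bin $i$. The distribution $ST$ is the law of the configuration obtained by throwing $m$ balls independently and uniformly at random into the $n$ bins: $ST(Z)=n^{-m}\binom{m}{z_1,\dots,z_n}$. Given a planting $A=(a_1,\dots,a_n)$ with $\sum_i a_i=k\le m$, the distribution $PL=PL_A$ is the law of the configuration obtained by starting with $a_i$ balls in bin $i$ for each $i$ and throwing the remaining $m-k$ balls independently and uniformly at random: $PL(Z)=n^{-(m-k)}\binom{m-k}{z_1-a_1,\dots,z_n-a_n}$, interpreted as $0$ if some $z_i<a_i$. The total variation distance is $\|ST-PL\|_{TV}=\frac12\sum_Z|ST(Z)-PL(Z)|$, the sum being over all configurations of $m$ balls in $n$ bins. All asymptotic notation ($o$, $\omega$, $\sim$) is as $n\to\infty$, with $A$, $k$, $V$, $m$ depending on $n$; $f=\omega(g)$ means $f/g\to\infty$. *)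

(* Defs.v *)
From mathcomp Require Import all_boot all_order all_algebra.
From mathcomp Require Import all_classical all_reals all_analysis.

Set Implicit Arguments.
Unset Strict Implicit.
Unset Printing Implicit Defensive.

Import Order.TTheory GRing.Theory Num.Theory.
Import numFieldNormedType.Exports.
Local Open Scope ring_scope.

Definition balls (n : nat) (z : 'I_n -> nat) : nat := (\sum_(i < n) z i)%N.

(* In a configuration of m balls each z i is at most m, so ranging over functions
   to 'I_m.+1 loses no configuration. *)
Definition configuration (n m : nat) (Z : {ffun 'I_n -> 'I_m.+1}) : bool :=
  balls (fun i => Z i : nat) == m.

(* Meaningful only when balls z = m. *)
Definition multinomial (R : realType) (n m : nat) (z : 'I_n -> nat) : R :=
  m`!%:R / \prod_(i < n) (z i)`!%:R.

(* Probability of z when m balls are thrown independently and uniformly. *)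
Definition ST (R : realType) (n m : nat) (z : 'I_n -> nat) : R :=
  multinomial R m z / n%:R ^+ m.

(* Probability of z when a i balls are first placed in each bin i and the
   remaining m - balls a are thrown independently and uniformly; since
   balls z = m, it vanishes identically when m < balls a. *)
Definition PL (R : realType) (n : nat) (a : 'I_n -> nat) (m : nat)
    (z : 'I_n -> nat) : R :=
  if [forall i, a i <= z i]%N then
    multinomial R (m - balls a) (fun i => z i - a i)%N / n%:R ^+ (m - balls a)
  else 0.

Definition TV (R : realType) (n : nat) (a : 'I_n -> nat) (m : nat) : R :=
  2^-1 * \sum_(Z : {ffun 'I_n -> 'I_m.+1} | configuration Z)
    `|ST R m (fun i => Z i : nat) - PL R a m (fun i => Z i : nat)|.

Definition V (R : realType) (n : nat) (a : 'I_n -> nat) : R :=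
  (\sum_(i < n) (a i)%:R ^+ 2) / n%:R - (balls a)%:R ^+ 2 / n%:R ^+ 2.

Definition Phi (R : realType) (x : R) : R :=
  fine (normal_prob (0 : R) (1 : R) [set` `]-oo, x]]).

(* Main.v *)
(* Let y be the configuration of the N = m - k balls that are not planted, so that
   under PL the outcome is y + a, and let M = ln (PL / ST) at y + a.  Then
   TV = E (1 - e^(-M))^+, the expectation being over y alone, and E e^(-M) <= 1.

   With nu = N / n, d_i = a_i - k / n and x_i = y_i - nu, the variable M is
   L^1-close to its mean plus
     S = sum_i d_i x_i / nu - (k / n) / (2 nu^2) * sum_i (x_i^2 - nu (1 - 1/n));
   this is the Efron-Stein inequality, where a single ball changes M by
   ln ((z + 1 + a_i) / (z + 1)).  Built up ball by ball, S is a martingale with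
   increments d_i / nu - (k / n) x_i / nu^2 whose conditional variances are nearly
   deterministic, with sum tending to sigma^2.  Lindeberg's telescoping argument
   along the explicit solution of the heat equation with initial condition
   (1 - e^(-s))^+ (the Black-Scholes formula) gives the limit of
   E (1 - e^(-(s + S)))^+ for every s.

   It remains to find the mean of M.  The bound E M <= sigma^2 / 2 + o(1) follows
   from one-sided Taylor bounds of the logarithm and exact binomial moments.  No
   lower bound is needed: e^(-M) is at least about e^(-sigma^2 / 2 - S), whose
   limit law is lognormal of mean one, while E e^(-M) <= 1. *)
From HB Require Import structures.
Require Import Defs.
From mathcomp Require Import all_boot all_order all_algebra.
From mathcomp Require Import all_classical all_reals all_analysis.
From mathcomp Require Import ring lra.

Import Order.TTheory GRing.Theory Num.Theory.
Import numFieldNormedType.Exports.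
Local Open Scope classical_set_scope.
Local Open Scope ring_scope.

(** * Throwing balls one at a time *)

Section Throwing.
Context {R : realType} {n : nat}.
Implicit Types (f g : ('I_n -> nat) -> R) (F G : 'I_n -> R) (t : nat).

(** The three regimes are one limit theorem. If n^2 V / m tends to [sL] and k sqrt(n) / m tends to
    [r], then sigma^2 = sL + r^2 / 2 and the limit is 2 Phi(sigma / 2) - 1; the pairs (0, 1/c),
    (1/c, 0) and (lambda/c, 1/c) give the flat, hilly and intermediate regimes. The part r^2 / 2
    comes from the quadratic term of S, which alone remains for a flat planting. Expectations are
    taken under PL because ST is positive everywhere, so M is finite there, whereas PL / ST may
    vanish under ST. The delicate point is the mean of M. It involves k logarithms, where k may be
    of order nu^2, so each expected logarithm must be known up to o(nu^-2). This forces the Taylor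
    bound of degree five, exact moments up to the fourth and the corrections in [logsum]. The
    derivatives of the heat solution blow up at time 0, so the telescoping stops at a small time
    t0^2, and t0 tends to 0 only after n has tended to infinity. *)

Definition place (i : 'I_n) (z : 'I_n -> nat) : 'I_n -> nat :=
  fun l => (z l + (l == i))%N.

Definition avg F : R := n%:R^-1 * \sum_i F i.

(** The law of t thrown balls is encoded by integrating out the last ball, without a probability
    space: facts about expectations become inductions on t, and a martingale step is one [avg].
    [expect_config] identifies the result with the law [ST]. *)
Fixpoint expect t g : R :=
  if t is t'.+1 then expect t' (fun z => avg (fun i => g (place i z)))
  else g (fun=> 0%N).

Lemma placeC i j z : place i (place j z) = place j (place i z).
Proof. by apply/funext => l; rewrite /place addnAC. Qed.

Lemma balls_place i z : balls (place i z) = (balls z).+1.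
Proof.
rewrite /balls /place big_split /= [X in (_ + X)%N](bigD1 i) //= eqxx.
rewrite [X in (_ + (_ + X))%N]big1 ?addn0 ?addn1 //.
by move=> j /negbTE ->.
Qed.

Lemma eq_avg F G : F =1 G -> avg F = avg G.
Proof. by move=> FG; rewrite /avg (eq_bigr _ (fun i _ => FG i)). Qed.

Lemma avgD F G : avg (fun i => F i + G i) = avg F + avg G.
Proof. by rewrite /avg big_split mulrDr. Qed.

Lemma avgZ a F : avg (fun i => a * F i) = a * avg F.
Proof. by rewrite /avg -mulr_sumr mulrCA. Qed.

Lemma avgB F G : avg (fun i => F i - G i) = avg F - avg G.
Proof. by rewrite /avg sumrB mulrBr. Qed.

Lemma avg_le F G : (forall i, F i <= G i) -> avg F <= avg G.
Proof. by move=> FG; rewrite /avg ler_wpM2l ?invr_ge0 // ler_sum. Qed.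

Lemma avg_cst (n0 : (0 < n)%N) a : avg (fun=> a) = a.
Proof.
rewrite /avg sumr_const card_ord -[X in _ * X]mulr_natl mulrA mulVf ?mul1r //.
by rewrite pnatr_eq0 -lt0n.
Qed.

Lemma avgC (H : 'I_n -> 'I_n -> R) :
  avg (fun i => avg (H i)) = avg (fun j => avg (fun i => H i j)).
Proof. by rewrite /avg -!mulr_sumr exchange_big. Qed.

Lemma eq_expect t f g :
  (forall z, balls z = t -> f z = g z) -> expect t f = expect t g.
Proof.
elim: t f g => [|t IH] f g fg /=; first by rewrite fg // /balls big1.
by apply: IH => z zt; apply: eq_avg => i; rewrite fg // balls_place zt.
Qed.

Lemma expect_le t f g :
  (forall z, balls z = t -> f z <= g z) -> expect t f <= expect t g.
Proof.
elim: t f g => [|t IH] f g fg /=; first by rewrite fg // /balls big1.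
by apply: IH => z zt; apply: avg_le => i; rewrite fg // balls_place zt.
Qed.

Lemma expectD t f g : expect t (fun z => f z + g z) = expect t f + expect t g.
Proof.
elim: t f g => //= t IH f g; rewrite -IH; apply: eq_expect => z _.
exact: avgD.
Qed.

Lemma expectZ t a f : expect t (fun z => a * f z) = a * expect t f.
Proof.
elim: t f => //= t IH f; rewrite -IH; apply: eq_expect => z _.
exact: avgZ.
Qed.

Lemma expectB t f g : expect t (fun z => f z - g z) = expect t f - expect t g.
Proof.
rewrite -[X in _ = _ + X]mulN1r -expectZ -expectD.
by apply: eq_expect => z _; rewrite mulN1r.
Qed.

Hypothesis n0 : (0 < n)%N.

Lemma expect_cst t a : expect t (fun=> a) = a.
Proof.
elim: t => //= t IH; rewrite -[RHS]IH; apply: eq_expect => z _.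
exact: avg_cst.
Qed.

Lemma expect_sum t (I : Type) (s : seq I) (P : pred I) (f : I -> _ -> R) :
  expect t (fun z => \sum_(i <- s | P i) f i z) =
  \sum_(i <- s | P i) expect t (f i).
Proof.
elim: s => [|a s IH].
  by under eq_expect do rewrite big_nil; rewrite expect_cst big_nil.
under eq_expect do rewrite big_cons.
rewrite big_cons -IH; case: ifP => // _; exact: expectD.
Qed.

Lemma expect_avg t (f : 'I_n -> _ -> R) :
  expect t (fun z => avg (f ^~ z)) = avg (fun i => expect t (f i)).
Proof. by rewrite /avg expectZ expect_sum. Qed.

Lemma expect_ge0 t f : (forall z, balls z = t -> 0 <= f z) -> 0 <= expect t f.
Proof. by move=> f0; rewrite -(expect_cst t 0); exact: expect_le. Qed.

Lemma ler_norm_expect t f : `|expect t f| <= expect t (fun z => `|f z|).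
Proof.
rewrite ler_norml; apply/andP; split; last first.
  by apply: expect_le => z _; exact: ler_norm.
rewrite -subr_ge0 opprK -expectD; apply: expect_ge0 => z _.
by have := ler_norm (- f z); rewrite normrN; lra.
Qed.

Lemma avg_var F : avg (fun i => F i ^+ 2) - avg F ^+ 2 =
  avg (fun i => (F i - avg F) ^+ 2).
Proof.
set a := avg F.
transitivity (avg (fun i => F i ^+ 2 - (2 * a) * F i + a ^+ 2)).
  by rewrite avgD avgB avgZ avg_cst // -/a; ring.
by apply: eq_avg => i; ring.
Qed.

Lemma avg_sqr_le F : avg F ^+ 2 <= avg (fun i => F i ^+ 2).
Proof.
rewrite -subr_ge0 avg_var -(avg_cst n0 0); apply: avg_le => i.
exact: sqr_ge0.
Qed.

Lemma avg_var_le F a : avg (fun i => F i ^+ 2) - avg F ^+ 2 <=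
  avg (fun i => (F i - a) ^+ 2).
Proof.
have -> : avg (fun i => (F i - a) ^+ 2) =
    avg (fun i => F i ^+ 2) - avg F ^+ 2 + (avg F - a) ^+ 2.
  transitivity (avg (fun i => F i ^+ 2 - (2 * a) * F i + a ^+ 2)).
    by apply: eq_avg => i; ring.
  by rewrite avgD avgB avgZ avg_cst //; ring.
by rewrite lerDl sqr_ge0.
Qed.

Let varT g z :=
  avg (fun i => g (place i z) ^+ 2) - avg (fun i => g (place i z)) ^+ 2.

Let step g z := avg (fun i => g (place i z)).

(* Averaging over one more ball is a contraction for the one-ball variance. *)
Let varT_step g z : varT (step g) z <= avg (fun l => varT g (place l z)).
Proof.
rewrite /varT avg_var /step.
pose A l := avg (fun i => g (place l (place i z))).
have -> : avg (fun i => avg (fun l => g (place l (place i z)))) = avg A.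
  by rewrite avgC.
apply: (@le_trans _ _ (avg (fun i =>
    avg (fun l => (g (place l (place i z)) - A l) ^+ 2)))).
  by apply: avg_le => i; rewrite -avgB; exact: avg_sqr_le.
rewrite avgC; apply: avg_le => l; rewrite -avg_var /A.
under eq_avg do rewrite placeC.
by under [X in _ - X ^+ 2 <= _]eq_avg do rewrite placeC.
Qed.

(** The total variance splits into the part due to the last ball and the variance of [step g], a
    function of one ball fewer. The contraction [varT_step] bounds each earlier contribution by that
    of the last ball, whence the factor t. *)
Let efron_stein_varT t g :
  expect t (fun z => g z ^+ 2) - expect t g ^+ 2 <= t%:R * expect t.-1 (varT g).
Proof.
elim: t g => [|t IH] g; first by rewrite /= subrr mul0r.
have -> : expect t.+1 (fun z => g z ^+ 2) - expect t.+1 g ^+ 2 =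
    expect t (varT g) +
    (expect t (fun z => step g z ^+ 2) - expect t (step g) ^+ 2).
  by rewrite /= expectB; ring.
rewrite -natr1 mulrDl mul1r [leRHS]addrC lerD2l.
apply: (le_trans (IH _)); case: t {IH} => [|t]; first by rewrite !mul0r.
by rewrite ler_wpM2l //=; apply: expect_le => z _; exact: varT_step.
Qed.

(** The centre [c z] may be any function of the earlier balls: only the variation of the increment
    over the bins counts. This freedom absorbs recentrings and constants in the applications. *)
Lemma efron_stein t g (c : ('I_n -> nat) -> R) :
  expect t (fun z => g z ^+ 2) - expect t g ^+ 2 <=
  t%:R * expect t.-1 (fun z => avg (fun i => (g (place i z) - g z - c z) ^+ 2)).
Proof.
apply: (le_trans (efron_stein_varT t g)); rewrite ler_wpM2l //.
apply: expect_le => z _; apply: (le_trans (avg_var_le _ (g z + c z))).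
by apply: avg_le => i; rewrite opprD addrA.
Qed.

Lemma expect_var t g : expect t (fun z => (g z - expect t g) ^+ 2) =
  expect t (fun z => g z ^+ 2) - expect t g ^+ 2.
Proof.
set a := expect t g.
transitivity (expect t (fun z => g z ^+ 2 - (2 * a) * g z + a ^+ 2)).
  by apply: eq_expect => z _; ring.
by rewrite expectD expectB expectZ expect_cst -/a; ring.
Qed.

Lemma expect_sqr_le t g : expect t g ^+ 2 <= expect t (fun z => g z ^+ 2).
Proof.
by rewrite -subr_ge0 -expect_var expect_ge0 // => z _; exact: sqr_ge0.
Qed.

Lemma expect_norm_le t g :
  expect t (fun z => `|g z|) <= Num.sqrt (expect t (fun z => g z ^+ 2)).
Proof.
rewrite -[leLHS]ger0_norm ?expect_ge0 // -sqrtr_sqr ler_wsqrtr //.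
under [leRHS]eq_expect do rewrite -real_normK ?num_real //.
exact: expect_sqr_le.
Qed.

(** The count of one bin follows a binomial recursion, since the new ball enters bin i with
    probability 1/n. All one-bin moments rest on it. *)
Lemma expect_coordS t i (f : nat -> R) :
  expect t.+1 (fun z => f (z i)) = expect t (fun z =>
    n%:R^-1 * f (z i).+1 + (1 - n%:R^-1) * f (z i)).
Proof.
have nz : n%:R != 0 :> R by rewrite pnatr_eq0 -lt0n.
rewrite [LHS]/=; apply: eq_expect => z _; rewrite /avg (bigD1 i) //= /place eqxx addn1.
rewrite (eq_bigr (fun=> f (z i))); last first.
  by move=> j ji; rewrite eq_sym (negbTE ji) addn0.
rewrite sumr_const (@eq_card _ _ (predC1 i)) // cardC1 card_ord.
rewrite -[X in _ + X]mulr_natl.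
by rewrite -subn1 natrB //; field.
Qed.

End Throwing.

(** * Moments of the count of a single bin *)

Section Moments.
Context {R : realType} {n : nat}.
Hypothesis n0 : (0 < n)%N.
Let p : R := n%:R^-1.

Definition dev (t : nat) (z : 'I_n -> nat) (i : 'I_n) : R :=
  (z i)%:R - t%:R / n%:R.

Let nz : n%:R != 0 :> R. Proof. by rewrite pnatr_eq0 -lt0n. Qed.

Lemma sum_dev t z : balls z = t -> \sum_i dev t z i = 0.
Proof.
move=> zt; rewrite sumrB sumr_const card_ord -[X in _ - X]mulr_natl.
by rewrite mulrCA mulfV // mulr1 -natr_sum -zt subrr.
Qed.

Lemma dev_place t z i j :
  dev t.+1 (place i z) j = dev t z j + (j == i)%:R - n%:R^-1.
Proof. by rewrite /dev /place natrD -natr1; ring. Qed.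

Lemma expect_devS t i (f : R -> R) : expect t.+1 (fun z => f (dev t.+1 z i)) =
  expect t (fun z => p * f (dev t z i + 1 - p) + (1 - p) * f (dev t z i - p)).
Proof.
rewrite (expect_coordS n0 t i (fun k => f (k%:R - t.+1%:R / n%:R))).
apply: eq_expect => z _; rewrite /dev -!natr1 -/p.
by congr (_ * f _ + _ * f _); rewrite /p; ring.
Qed.

Let dev0 i : dev 0 (fun=> 0%N) i = 0.
Proof. by rewrite /dev mul0r subrr. Qed.

Lemma expect_dev t i : expect t (fun z => dev t z i) = 0.
Proof.
elim: t => [|t IH]; first by rewrite /= dev0.
rewrite (expect_devS t i id).
rewrite (@eq_expect _ _ _ _ (fun z => dev t z i)) // => z _; ring.
Qed.

Lemma expect_dev2 t i : expect t (fun z => dev t z i ^+ 2) =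
  t%:R * (p * (1 - p)).
Proof.
elim: t => [|t IH]; first by rewrite /= dev0; ring.
rewrite (expect_devS t i (fun x => x ^+ 2)).
transitivity (expect t (fun z => dev t z i ^+ 2 + p * (1 - p))).
  by apply: eq_expect => z _; ring.
by rewrite expectD (expect_cst n0) IH -natr1; ring.
Qed.

Lemma expect_dev3 t i : expect t (fun z => dev t z i ^+ 3) =
  t%:R * (p * (1 - p) * (1 - 2 * p)).
Proof.
elim: t => [|t IH]; first by rewrite /= dev0; ring.
rewrite (expect_devS t i (fun x => x ^+ 3)).
transitivity (expect t (fun z => dev t z i ^+ 3 +
    (3 * (p * (1 - p)) * dev t z i + p * (1 - p) * (1 - 2 * p)))).
  by apply: eq_expect => z _; ring.
rewrite expectD expectD expectZ (expect_cst n0) IH expect_dev -natr1; ring.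
Qed.

Lemma expect_dev4 t i : expect t (fun z => dev t z i ^+ 4) =
  3 * (t%:R * (t%:R - 1)) * (p * (1 - p)) ^+ 2 +
  t%:R * (p * (1 - p) * (1 - 3 * p + 3 * p ^+ 2)).
Proof.
elim: t => [|t IH]; first by rewrite /= dev0; ring.
rewrite (expect_devS t i (fun x => x ^+ 4)).
transitivity (expect t (fun z => dev t z i ^+ 4 +
    (6 * (p * (1 - p)) * dev t z i ^+ 2 +
    (4 * (p * (1 - p) * (1 - 2 * p)) * dev t z i +
     p * (1 - p) * (1 - 3 * p + 3 * p ^+ 2))))).
  by apply: eq_expect => z _; ring.
rewrite !expectD !expectZ (expect_cst n0) IH expect_dev expect_dev2 -natr1; ring.
Qed.

(** From exp(-x) >= 1 - x, it suffices that (1 - x)(1 + x + 2 x^2) = 1 + x^2 - 2 x^3 be at least 1,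
    which is where x <= 1/2 enters. *)
Lemma expR_le_quad (x : R) : x <= 2^-1 -> expR x <= 1 + x + 2 * x ^+ 2.
Proof.
move=> xh; have := expR_ge1Dx (- x) => h.
have h1 : expR x <= (1 - x)^-1.
  rewrite -[leLHS]invrK -expRN lef_pV2 ?posrE ?expR_gt0 //; lra.
apply: (le_trans h1); rewrite -div1r ler_pdivrMr; nra.
Qed.

(** Each ball multiplies the moment generating function by exp(-hp) (1 + p (exp h - 1)), at most
    exp(2 h^2 p) by the quadratic bound on the exponential. *)
Lemma expect_expR_dev t i (h : R) : `|h| <= 2^-1 ->
  expect t (fun z => expR (h * dev t z i)) <= expR (2 * h ^+ 2 * (t%:R * p)).
Proof.
move=> hh; elim: t => [|t IH].
  by rewrite /= dev0 !(mulr0, mul0r).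
rewrite (expect_devS t i (fun x => expR (h * x))).
have -> : expect t (fun z => p * expR (h * (dev t z i + 1 - p)) +
    (1 - p) * expR (h * (dev t z i - p))) =
    (expR (- (h * p)) * (1 + p * (expR h - 1))) *
     expect t (fun z => expR (h * dev t z i)).
  rewrite -expectZ; apply: eq_expect => z _.
  have -> : h * (dev t z i + 1 - p) = h * dev t z i + h + - (h * p) by ring.
  have -> : h * (dev t z i - p) = h * dev t z i + - (h * p) by ring.
  by rewrite !expRD; ring.
have -> : 2 * h ^+ 2 * (t.+1%:R * p) =
    (- (h * p) + p * (h + 2 * h ^+ 2)) + 2 * h ^+ 2 * (t%:R * p).
  by rewrite -natr1; ring.
rewrite expRD; apply: ler_pM => //.
- rewrite mulr_ge0 ?expR_ge0 //.
  have p1 : p <= 1 by rewrite invf_le1 ?ltr0n // ler1n.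
  have p0 : 0 <= p by rewrite invr_ge0.
  have := expR_ge0 h; nra.
- by apply: (expect_ge0 n0) => z _; exact: expR_ge0.
rewrite expRD ler_wpM2l ?expR_ge0 //.
apply: (le_trans (expR_ge1Dx _)); rewrite ler_expR ler_wpM2l ?invr_ge0 //.
have := @expR_le_quad h; have := ler_norm h; lra.
Qed.

Lemma exprn_le_expR (y : R) k : 0 <= y -> y ^+ k <= k`!%:R * expR y.
Proof.
case: k => [|k] y0; first by rewrite expr0 fact0 mul1r -[leLHS]expR0 ler_expR.
rewrite -ler_pdivrMl ?ltr0n ?fact_gt0 //.
have := expR_ge1Dxn k y0; rewrite mulrC; lra.
Qed.

Definition moment_bound (k : nat) : R := 2 ^+ k * k`!%:R * (4 * expR 1).

Lemma moment_bound_ge0 k : 0 <= moment_bound k.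
Proof. by rewrite !mulr_ge0 ?expR_ge0 ?exprn_ge0. Qed.

(** Deviations have scale at most sqrt v, and one [v] serves for all smaller t. An exponential
    moment at [h] = 1 / (2 sqrt v), for which 2 h^2 v = 1/2, controls all powers through y^k <= k!
    exp y. The summand 1 lets one power absorb the lower ones. *)
Lemma expect_dev_bound (v : R) t i k : 1 <= v -> t%:R / n%:R <= v ->
  expect t (fun z => (1 + `|dev t z i| / Num.sqrt v) ^+ k) <= moment_bound k.
Proof.
move=> v1 tv; set r := Num.sqrt v.
have v0 : 0 < v by lra.
have r1 : 1 <= r by rewrite /r -sqrtr1 ler_wsqrtr.
have r0 : 0 < r by lra.
pose h := (2 * r)^-1.
have h0 : 0 < h by rewrite invr_gt0 mulr_gt0.
have hh : h <= 2^-1 by rewrite lef_pV2 ?posrE; lra.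
have h2 : h ^+ 2 * v = 4^-1.
  rewrite -[X in _ * X](sqr_sqrtr (ltW v0)) -/r /h; field; lra.
apply: (@le_trans _ _ (expect t (fun z => (2 ^+ k * k`!%:R * expR 2^-1) *
    (expR (h * dev t z i) + expR ((- h) * dev t z i))))).
  apply: expect_le => z _.
  have -> : 1 + `|dev t z i| / r = 2 * (2^-1 + h * `|dev t z i|).
    by rewrite /h; field; lra.
  rewrite exprMn -!mulrA ler_wpM2l ?exprn_ge0 //.
  apply: (le_trans (exprn_le_expR _ _ _)).
    by rewrite addr_ge0 ?mulr_ge0 // ltW.
  rewrite ler_wpM2l // expRD ler_wpM2l ?expR_ge0 //.
  have [d0|d0] := leP 0 (dev t z i).
    by rewrite (ger0_norm d0) lerDl expR_ge0.
  by rewrite (ltr0_norm d0) mulrN mulNr lerDr expR_ge0.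
rewrite expectZ expectD /moment_bound -mulrA.
rewrite -!mulrA; do 2 (rewrite ler_wpM2l ?exprn_ge0 //).
have e1 : forall g : R, g ^+ 2 = h ^+ 2 -> `|g| <= 2^-1 ->
    expect t (fun z => expR (g * dev t z i)) <= expR 2^-1.
  move=> g gh gle; apply: (le_trans (expect_expR_dev t i _ gle)).
  rewrite ler_expR gh; have : h ^+ 2 * (t%:R / n%:R) <= h ^+ 2 * v.
    by rewrite ler_wpM2l ?sqr_ge0.
  by rewrite -/p h2; lra.
have e2 := e1 h erefl; have e3 := e1 (- h) (sqrrN _).
rewrite normrN (gtr0_norm h0) in e2 e3.
have e22 := e2 hh; have e33 := e3 hh.
have -> : 4 * expR 1 = expR 2^-1 * (4 * expR 2^-1) :> R.
  rewrite mulrCA -expRD; congr (_ * expR _); lra.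
rewrite ler_wpM2l ?expR_ge0 //.
by have := expR_ge0 (2^-1 : R); lra.
Qed.

End Moments.

(** * The likelihood ratio *)

Section Likelihood.
Context {R : realType} {n : nat}.
Hypothesis n0 : (0 < n)%N.

Let nz : n%:R != 0 :> R. Proof. by rewrite pnatr_eq0 -lt0n. Qed.

Let factnz k : k`!%:R != 0 :> R. Proof. by rewrite pnatr_eq0 -lt0n fact_gt0. Qed.

Lemma balls_ge (z : 'I_n -> nat) i : (z i <= balls z)%N.
Proof. by rewrite /balls (bigD1 i) //= leq_addr. Qed.

Lemma balls_add (z a : 'I_n -> nat) :
  balls (fun i => z i + a i)%N = (balls z + balls a)%N.
Proof. by rewrite /balls big_split. Qed.

Lemma fact_addn y a : (y + a)`!%:R = y`!%:R * \prod_(j < a) (y + j.+1)%:R :> R.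
Proof.
elim: a => [|a IH]; first by rewrite addn0 big_ord0 mulr1.
by rewrite big_ord_recr /= mulrA -IH addnS factS natrM mulrC.
Qed.

Lemma prod_fact_neq0 (z : 'I_n -> nat) : \prod_i (z i)`!%:R != 0 :> R.
Proof. by apply/prodf_neq0 => i _; exact: factnz. Qed.

Lemma prod_fact_place i (z : 'I_n -> nat) :
  \prod_l (place i z l)`!%:R = (z i).+1%:R * \prod_l (z l)`!%:R :> R.
Proof.
rewrite (bigD1 i) //= [in RHS](bigD1 i) //= /place eqxx addn1 factS natrM.
rewrite -!mulrA; congr (_ * (_ * _)); apply: eq_bigr => j ji.
by rewrite (negbTE ji) addn0.
Qed.

(** Time reversal of one throw: in a configuration of t + 1 balls the last one lies in a given bin
    with probability its count over t + 1. This turns the recursion of [expect] into a sum against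
    [ST]. *)
Lemma ST_place t i (z : 'I_n -> nat) :
  (z i).+1%:R / t.+1%:R * ST R t.+1 (place i z) = n%:R^-1 * ST R t z.
Proof.
rewrite /ST /multinomial prod_fact_place factS natrM exprS.
have := prod_fact_neq0 z; set P := \prod_l _ => Pnz.
have en := expf_neq0 t nz; set q := n%:R ^+ t in en *.
have sn k : k.+1%:R != 0 :> R by rewrite pnatr_eq0.
move: (sn t) (sn (z i)) nz; set b := t.+1%:R; set c := (z i).+1%:R.
by set N := n%:R => *; field; do ![apply/andP; split].
Qed.

Lemma ST_ge0 t (z : 'I_n -> nat) : 0 <= ST R t z.
Proof.
by rewrite !mulr_ge0 ?invr_ge0 ?exprn_ge0 ?prodr_ge0 // => i _; rewrite ler0n.
Qed.

Let up {B} (i : 'I_n) (Z : {ffun 'I_n -> 'I_B.+1}) : {ffun 'I_n -> 'I_B.+1} :=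
  [ffun l => inord (place i (fun j => Z j : nat) l)].

Let down {B} (i : 'I_n) (Z : {ffun 'I_n -> 'I_B.+1}) : {ffun 'I_n -> 'I_B.+1} :=
  [ffun l => inord (Z l - (l == i))%N].

Let upE {B} {i} {Z : {ffun 'I_n -> 'I_B.+1}} : (Z i < B)%N ->
  (fun l => up i Z l : nat) = place i (fun j => Z j : nat).
Proof.
move=> ZB; apply/funext => l; rewrite ffunE inordK // /place ltnS.
by case: eqP => [->|_]; rewrite ?addn1 // addn0 -ltnS.
Qed.

Let updown {B} {i} {Z : {ffun 'I_n -> 'I_B.+1}} : (0 < Z i)%N -> up i (down i Z) = Z.
Proof.
move=> Z0; apply/ffunP => l; apply: val_inj; rewrite !ffunE /= /place !ffunE.
rewrite [inord (Z l - _)%N]/= [X in inord (X + _)%N]inordK; last first.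
  by rewrite ltnS; apply: (leq_trans (leq_subr _ _)); rewrite -ltnS.
rewrite inordK; case: eqP => [->|_]; rewrite ?subn0 ?addn0 ?subnK //.
Qed.

Let downup {B} {i} {Z : {ffun 'I_n -> 'I_B.+1}} : (Z i < B)%N -> down i (up i Z) = Z.
Proof.
move=> ZB; apply/ffunP => l; apply: val_inj; rewrite !ffunE /=.
have := congr1 (@^~ l) (upE ZB); rewrite /= ffunE => ->.
by rewrite /place addnK inordK.
Qed.

(** The bound B on the counts is left free because the N unplanted balls must later be summed in the
    type with counts up to [N + balls a]. *)
Lemma expect_config B t (g : ('I_n -> nat) -> R) : (t <= B)%N ->
  expect t g = \sum_(Z : {ffun 'I_n -> 'I_B.+1} | balls (fun i => Z i : nat) == t)
    ST R t (fun i => Z i : nat) * g (fun i => Z i : nat).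
Proof.
elim: t g => [|t IH] g tB.
  rewrite (big_pred1 [ffun=> ord0]) => [|Z /=]; last first.
    apply/idP/eqP => [|->]; last by apply/eqP; rewrite /balls big1 // => i _; rewrite ffunE.
    rewrite /balls sum_nat_eq0 => /forallP h; apply/ffunP => i.
    by apply: val_inj; rewrite ffunE /=; apply/eqP; exact: (h i).
  rewrite (_ : (fun i => _) = (fun=> 0%N)); last first.
    by apply/funext => i; rewrite ffunE.
  rewrite /ST /multinomial big1 => [|i _]; last by rewrite fact0.
  by rewrite fact0 expr0 !divr1 mul1r.
rewrite /= (IH _ (ltnW tB)).
transitivity (\sum_i \sum_(Z : {ffun 'I_n -> 'I_B.+1} |
    balls (fun i => Z i : nat) == t)
  n%:R^-1 * ST R t (fun j => Z j : nat) * g (place i (fun j => Z j : nat))).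
  rewrite exchange_big /=; apply: eq_bigr => Z _.
  rewrite /avg mulrA [_ * n%:R^-1]mulrC mulr_sumr; by [].
transitivity (\sum_i \sum_(Z : {ffun 'I_n -> 'I_B.+1} |
    balls (fun i => Z i : nat) == t.+1) (Z i)%:R / t.+1%:R *
  (ST R t.+1 (fun j => Z j : nat) * g (fun j => Z j : nat))); last first.
  rewrite exchange_big /=; apply: eq_bigr => Z /eqP Zt.
  rewrite -mulr_suml -mulr_suml -natr_sum.
  by rewrite [(\sum_i _)%N]Zt divff ?mul1r // pnatr_eq0.
apply: eq_bigr => i _; apply/esym.
rewrite (bigID (fun Z : {ffun 'I_n -> 'I_B.+1} => (0 < Z i)%N)) /= [X in _ + X]big1 => [|Z]; last first.
  by rewrite lt0n negbK => /andP[_ /eqP ->]; rewrite !mul0r.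
rewrite addr0 (reindex_onto (@up B i) (@down B i)) => [|Z /andP[_]]; last exact: updown.
apply: eq_big => [Z|Z /andP[/andP[_ h1] /eqP h2]].
- have [ZB|BZ] := ltnP (Z i) B.
    rewrite downup // eqxx andbT (upE ZB) balls_place eqSS.
    have := congr1 (@^~ i) (upE ZB) => /= ->.
    by rewrite /place eqxx addn1 andbT.
  (* A count that overflows is sent to 0 by [inord], so this Z is discarded on one side; on the
     other its total is at least B, hence differs from t. *)
  have -> : (0 < up i Z i)%N = false.
    have ZB : Z i = B :> nat by apply/eqP; rewrite eqn_leq BZ -ltnS ltn_ord.
    rewrite ffunE /place eqxx addn1 ZB /inord /insubd insubF //=.
    by rewrite ltnn.
  rewrite andbF; apply/esym/negbTE; rewrite neq_ltn; apply/orP; right.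
  by apply: (leq_trans tB); apply: (leq_trans BZ); exact: balls_ge.
have ZB : (Z i < B)%N.
  move: h1; rewrite ffunE /place eqxx addn1 /inord /insubd.
  by case: insubP => [u + _ _|//]; rewrite ltnS.
have := congr1 (@^~ i) (upE ZB) => /= ->.
by rewrite (upE ZB) {1}/place eqxx addn1 mulrA ST_place.
Qed.

Variable a : 'I_n -> nat.

(* The likelihood ratio ST / PL at y + a, where y collects the unplanted balls. *)
Definition inv_ratio (N : nat) (y : 'I_n -> nat) : R :=
  \prod_(t < balls a) ((N + t.+1)%:R / n%:R) /
  \prod_i \prod_(j < a i) (y i + j.+1)%:R.

Lemma inv_ratio_gt0 N y : 0 < inv_ratio N y.
Proof.
rewrite divr_gt0 //; apply: prodr_gt0 => i _.
  by rewrite divr_gt0 ?ltr0n ?addnS.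
by apply: prodr_gt0 => j _; rewrite ltr0n addnS.
Qed.

Lemma ST_addE N (y : 'I_n -> nat) :
  ST R (N + balls a) (fun i => y i + a i)%N = ST R N y * inv_ratio N y.
Proof.
rewrite /ST /multinomial /inv_ratio fact_addn exprD.
rewrite (eq_bigr _ (fun i _ => fact_addn (y i) (a i))) big_split /=.
rewrite prodf_div prodr_const card_ord.
have := prod_fact_neq0 y; set P := \prod_l _ => Pnz.
have en := expf_neq0 N nz; set q := n%:R ^+ N in en *.
have en2 := expf_neq0 (balls a) nz; set q2 := n%:R ^+ balls a in en2 *.
set D := \prod_(i < n) \prod_(j < a i) _; set T := \prod_(i < balls a) _.
have Dnz : D != 0.
  by apply/prodf_neq0 => i _; apply/prodf_neq0 => j _; rewrite pnatr_eq0 addnS.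
by field; do ![apply/andP; split].
Qed.

Let shift {m} (Y : {ffun 'I_n -> 'I_m.+1}) : {ffun 'I_n -> 'I_m.+1} :=
  [ffun i => inord (Y i + a i)].

Let unshift {m} (Z : {ffun 'I_n -> 'I_m.+1}) : {ffun 'I_n -> 'I_m.+1} :=
  [ffun i => inord (Z i - a i)].

Let shiftE {N} {Y : {ffun 'I_n -> 'I_(N + balls a).+1}} :
  balls (fun i => Y i : nat) = N ->
  (fun i => shift Y i : nat) = (fun i => Y i + a i)%N.
Proof.
move=> YN; apply/funext => i; rewrite ffunE inordK // ltnS leq_add //.
  by rewrite -[X in (_ <= X)%N]YN; exact: (balls_ge (fun i => Y i : nat)).
exact: balls_ge.
Qed.

(** Substitution Z = y + a: adding the planting maps the configurations of N balls bijectively onto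
    the configurations of [N + balls a] balls that dominate a. *)
Lemma expect_planted N (h : ('I_n -> nat) -> R) :
  expect N (fun y => h (fun i => y i + a i)%N) =
  \sum_(Z : {ffun 'I_n -> 'I_(N + balls a).+1} |
      configuration Z && [forall i, (a i <= Z i)%N])
    ST R N (fun i => Z i - a i)%N * h (fun i => Z i : nat).
Proof.
rewrite (@expect_config (N + balls a)) ?leq_addr //; apply/esym.
rewrite (reindex_onto shift unshift) => [|Z /andP[_ /forallP aZ]]; last first.
  apply/ffunP => i; apply: val_inj; rewrite !ffunE /=.
  have Zi : (Z i - a i < (N + balls a).+1)%N.
    by rewrite (leq_ltn_trans (leq_subr _ _)).
  by rewrite (inordK Zi) subnK // inordK.
apply: eq_big => [Y|Y /andP[/andP[/eqP h1 /forallP h2] /eqP h3]]; last first.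
  have YE i : (shift Y i - a i)%N = Y i.
    have := congr1 (fun f : {ffun 'I_n -> 'I_(N + balls a).+1} => f i : nat) h3; rewrite ffunE /= inordK //.
    by rewrite (leq_ltn_trans (leq_subr _ _)).
  rewrite (_ : (fun i => (shift Y i - a i)%N) = fun i => Y i : nat); last first.
    by apply/funext => i; exact: YE.
  rewrite (_ : (fun i => shift Y i : nat) = (fun i => Y i + a i)%N) //.
  by apply/funext => i; rewrite -YE subnK.
apply/idP/eqP => [/andP[/andP[/eqP h1 /forallP h2] /eqP h3]|YN].
  have YE i : (shift Y i - a i)%N = Y i.
    have := congr1 (fun f : {ffun 'I_n -> 'I_(N + balls a).+1} => f i : nat) h3; rewrite ffunE /= inordK //.
    by rewrite (leq_ltn_trans (leq_subr _ _)).
  apply: (@addIn (balls a)); apply: etrans h1; rewrite -balls_add.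
  by apply: eq_bigr => i _; rewrite -YE subnK.
rewrite /configuration (shiftE YN) balls_add YN eqxx /=; apply/andP; split.
  by apply/forallP => i; have := congr1 (@^~ i) (shiftE YN) => /= ->; rewrite leq_addl.
apply/eqP/ffunP => i; apply: val_inj; rewrite ffunE /=.
have := congr1 (@^~ i) (shiftE YN) => /= ->.
by rewrite addnK inordK.
Qed.

Lemma sum_ST m : \sum_(Z : {ffun 'I_n -> 'I_m.+1} | configuration Z)
  ST R m (fun i => Z i : nat) = 1.
Proof.
rewrite -(expect_cst n0 m 1) (@expect_config m) //.
by apply: eq_bigr => Z _; rewrite mulr1.
Qed.

(** Under PL the mean of ST / PL is the ST-mass of the configurations that dominate a; the others
    are lost, hence only an inequality. *)
Lemma expect_inv_ratio N : expect N (inv_ratio N) <= 1.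
Proof.
rewrite -(sum_ST (N + balls a)).
pose h (z : 'I_n -> nat) := inv_ratio N (fun i => z i - a i)%N.
apply: (@le_trans _ _ (expect N (fun y => h (fun i => y i + a i)%N))).
  rewrite le_eqVlt; apply/orP; left; apply/eqP; apply: eq_expect => z _.
  by congr inv_ratio; apply/funext => i; rewrite addnK.
rewrite expect_planted [leRHS](bigID (fun Z : {ffun 'I_n -> 'I_(N + balls a).+1} =>
  [forall i, (a i <= Z i)%N])) /=.
rewrite -[leLHS]addr0 lerD ?sumr_ge0 // => [|Z _]; last exact: ST_ge0.
apply: ler_sum => Z /andP[_ /forallP aZ]; rewrite /h -ST_addE.
rewrite (_ : (fun i => (Z i - a i + a i)%N) = (fun i => Z i : nat)) //.
by apply/funext => i; rewrite subnK.
Qed.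

Lemma TV_expect N : TV R a (N + balls a) =
  expect N (fun y => Num.max 0 (1 - inv_ratio N y)).
Proof.
pose h (z : 'I_n -> nat) := Num.max 0 (1 - inv_ratio N (fun i => z i - a i)%N).
transitivity (expect N (fun y => h (fun i => y i + a i)%N)); last first.
  apply: eq_expect => z _; congr (Num.max _ (1 - inv_ratio _ _)).
  by apply/funext => i; rewrite addnK.
have PLE (Z : {ffun 'I_n -> 'I_(N + balls a).+1}) :
    PL R a (N + balls a) (fun i => Z i : nat) =
    if [forall i, (a i <= Z i)%N] then ST R N (fun i => Z i - a i)%N else 0.
  by rewrite /PL; case: ifP => // _; rewrite addnK.
have PL1 : \sum_(Z : {ffun 'I_n -> 'I_(N + balls a).+1} | configuration Z)
    PL R a (N + balls a) (fun i => Z i : nat) = 1.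
  under eq_bigr do rewrite PLE.
  rewrite -big_mkcondr /= -[RHS](expect_cst n0 N 1).
  rewrite (expect_planted N (fun=> 1)).
  by apply: eq_bigr => Z _; rewrite mulr1.
transitivity (\sum_(Z : {ffun 'I_n -> 'I_(N + balls a).+1} | configuration Z)
  Num.max 0 (PL R a (N + balls a) (fun i => Z i : nat) - ST R (N + balls a) (fun i => Z i : nat))).
  rewrite /TV mulr_sumr.
  (* Pointwise |x - y| / 2 = max(0, y - x) + (x - y) / 2, and the last terms cancel in the sum
     because both laws have mass one. *)
  transitivity (\sum_(Z : {ffun 'I_n -> 'I_(N + balls a).+1} | configuration Z)
    (Num.max 0 (PL R a (N + balls a) (fun i => Z i : nat) - ST R (N + balls a) (fun i => Z i : nat))
     + (2^-1 * ST R (N + balls a) (fun i => Z i : nat) -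
       2^-1 * PL R a (N + balls a) (fun i => Z i : nat)))).
    apply: eq_bigr => Z _; set x := ST _ _ _; set y := PL _ _ _ _.
    by have [xy|xy] := leP x y; [rewrite ler0_norm|rewrite gtr0_norm]; rewrite ?maxEle ?subr_ge0 ?subr_le0 ?subr_gt0; case: leP => ?; lra.
  by rewrite big_split /= sumrB -!mulr_sumr PL1 sum_ST subrr addr0.
rewrite expect_planted (bigID (fun Z : {ffun 'I_n -> 'I_(N + balls a).+1} =>
  [forall i, (a i <= Z i)%N])) /= [X in _ + X]big1 ?addr0.
  apply: eq_bigr => Z /andP[_ aZ]; rewrite PLE aZ /h.
  rewrite maxr_pMr ?ST_ge0 // mulr0 mulrBr mulr1 -ST_addE.
  rewrite (_ : (fun i => (Z i - a i + a i)%N) = (fun i => Z i : nat)) //.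
  by apply/funext => i; rewrite subnK // (forallP aZ).
move=> Z /andP[_ /negbTE aZ]; rewrite PLE aZ sub0r.
by apply/max_idPl; rewrite oppr_le0 ST_ge0.
Qed.

End Likelihood.

(** * Differentiation and the normal distribution function *)

Section Derivatives.
Context {R : realType}.
Implicit Types (f g : R -> R) (x y : R).

(** Pointwise forms of the differentiation rules: a derivative is assembled as a term that follows
    the shape of the expression, and [deriv_eq] leaves an algebraic identity. *)
Lemma deriv_cst (a x : R) : is_derive x 1 (fun=> a) (0 : R).
Proof. exact: is_derive_cst. Qed.

Lemma deriv_id x : is_derive x 1 (fun y : R => y) (1 : R).
Proof. exact: is_derive_id. Qed.

Lemma deriv_add f g x (a b : R) : is_derive x 1 f a -> is_derive x 1 g b ->
  is_derive x 1 (fun y => f y + g y) (a + b).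
Proof. by move=> fa gb; exact: is_deriveD. Qed.

Lemma deriv_sub f g x (a b : R) : is_derive x 1 f a -> is_derive x 1 g b ->
  is_derive x 1 (fun y => f y - g y) (a - b).
Proof. by move=> fa gb; exact: is_deriveB. Qed.

Lemma deriv_opp f x (a : R) : is_derive x 1 f a ->
  is_derive x 1 (fun y => - f y) (- a).
Proof. by move=> fa; exact: is_deriveN. Qed.

Lemma deriv_mul f g x (a b : R) : is_derive x 1 f a -> is_derive x 1 g b ->
  is_derive x 1 (fun y => f y * g y) (f x * b + g x * a).
Proof. by move=> fa gb; exact: is_deriveM. Qed.

Lemma deriv_comp f g x (a b : R) : is_derive (g x) 1 f a -> is_derive x 1 g b ->
  is_derive x 1 (fun y => f (g y)) (a * b).
Proof. by move=> fa gb; exact: is_derive1_comp. Qed.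

Lemma deriv_inv f x (a : R) : f x != 0 -> is_derive x 1 f a ->
  is_derive x 1 (fun y => (f y)^-1) (- (f x) ^- 2 * a).
Proof. by move=> f0 fa; exact: is_deriveV. Qed.

Lemma deriv_exp x : is_derive x 1 (@expR R) (expR x).
Proof. exact: is_derive_expR. Qed.

Lemma deriv_ln x : 0 < x -> is_derive x 1 (@ln R) x^-1.
Proof. exact: is_derive1_ln. Qed.

Lemma deriv_eq f x (a b : R) : is_derive x 1 f a -> a = b -> is_derive x 1 f b.
Proof. by move=> fa <-. Qed.

Lemma deriv_cont f x (a : R) : is_derive x 1 f a -> {for x, continuous f}.
Proof.
by move=> [fa _]; exact/differentiable_continuous/derivable1_diffP.
Qed.

Lemma mean_value f (df : R -> R) x y : x <= y ->
  (forall z, x <= z <= y -> is_derive z 1 f (df z)) ->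
  exists2 z, x <= z <= y & f y - f x = df z * (y - x).
Proof.
move=> xy fd; have [||z zxy e] := @MVT_segment R f df x y xy.
- by move=> z; rewrite in_itv /= => /andP[/ltW xz /ltW zy]; apply: fd; rewrite xz.
- apply: continuous_in_subspaceT => z; rewrite inE /= in_itv /= => zxy.
  exact: deriv_cont (fd _ zxy).
- by exists z => //; move: zxy; rewrite in_itv.
Qed.

Lemma derive_ge0_le f (df : R -> R) x y : x <= y ->
  (forall z, x <= z <= y -> is_derive z 1 f (df z)) ->
  (forall z, x <= z <= y -> 0 <= df z) -> f x <= f y.
Proof.
move=> xy fd df0; have [z zxy e] := mean_value f df x y xy fd.
by rewrite -subr_ge0 e mulr_ge0 ?subr_ge0 // df0.
Qed.

Lemma derive_bounded_lipschitz f (df : R -> R) (K x y : R) : x <= y ->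
  (forall z, x <= z <= y -> is_derive z 1 f (df z)) ->
  (forall z, x <= z <= y -> `|df z| <= K) -> `|f y - f x| <= K * (y - x).
Proof.
move=> xy fd dfK; have [z zxy ->] := mean_value f df x y xy fd.
by rewrite normrM [X in _ * X]ger0_norm ?subr_ge0 // ler_wpM2r ?subr_ge0 ?dfK.
Qed.

(** The Lipschitz bound on [f2] is integrated twice, each time by the mean value inequality; losing
    the factor 1/6 is harmless. *)
Lemma taylor2_lipschitz (f f1 f2 : R -> R) (L : R) : 0 <= L ->
  (forall z : R, is_derive z 1 f (f1 z)) -> (forall z : R, is_derive z 1 f1 (f2 z)) ->
  (forall x y, `|f2 y - f2 x| <= L * `|y - x|) ->
  forall s h, `|f (s + h) - f s - h * f1 s - 2^-1 * h ^+ 2 * f2 s| <= L * `|h| ^+ 3.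
Proof.
move=> L0 d1 d2 lip2 s h.
have dsh (z : R) : is_derive z 1 (fun x => s + x) (1 : R).
  by apply: deriv_eq (deriv_add _ _ _ _ _ (deriv_cst s z) (deriv_id z)) _; rewrite add0r.
have lip1 x : `|f1 (s + x) - f1 s - x * f2 s| <= L * `|x| ^+ 2.
  pose g z := f1 (s + z) - z * f2 s.
  pose dg z := f2 (s + z) - f2 s.
  have gd (z : R) : is_derive z 1 g (dg z).
    apply: deriv_eq (deriv_sub _ _ _ _ _ (deriv_comp _ _ _ _ _ (d2 (s + z)) (dsh z))
      (deriv_mul _ _ _ _ _ (deriv_id z) (deriv_cst (f2 s) z))) _.
    by rewrite /dg; ring.
  have dgb z : `|z| <= `|x| -> `|dg z| <= L * `|x|.
    move=> zx; apply: (le_trans (lip2 _ _)).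
    by rewrite (_ : s + z - s = z) ?ler_wpM2l //; ring.
  have g0 : g 0 = f1 s by rewrite /g addr0 mul0r subr0.
  rewrite (_ : _ - _ - _ = g x - g 0); last by rewrite g0 /g; ring.
  have [x0|x0] := leP 0 x.
    apply: (le_trans (derive_bounded_lipschitz g dg (L * `|x|) 0 x x0 _ _)) => //.
      by move=> z /andP[z0 zx]; apply: dgb; rewrite !ger0_norm.
    by rewrite subr0 ger0_norm // expr2 mulrA.
  rewrite distrC.
  apply: (le_trans (derive_bounded_lipschitz g dg (L * `|x|) x 0 (ltW x0) _ _)) => //.
    move=> z /andP[zx z0]; apply: dgb.
    by rewrite (ltr0_norm x0) (ler0_norm z0); lra.
  by rewrite sub0r (ltr0_norm x0) expr2 mulrA.
pose g z := f (s + z) - z * f1 s - 2^-1 * z ^+ 2 * f2 s.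
pose dg z := f1 (s + z) - f1 s - z * f2 s.
have gd (z : R) : is_derive z 1 g (dg z).
  have e : g = (fun z => f (s + z) - z * f1 s - (z * z) * (2^-1 * f2 s)).
    by apply/funext => t; rewrite /g; ring.
  rewrite e; apply: deriv_eq (deriv_sub _ _ _ _ _ (deriv_sub _ _ _ _ _
    (deriv_comp _ _ _ _ _ (d1 (s + z)) (dsh z))
    (deriv_mul _ _ _ _ _ (deriv_id z) (deriv_cst (f1 s) z)))
    (deriv_mul _ _ _ _ _ (deriv_mul _ _ _ _ _ (deriv_id z) (deriv_id z))
       (deriv_cst (2^-1 * f2 s) z))) _.
  by rewrite /dg; field.
have dgb z : `|z| <= `|h| -> `|dg z| <= L * `|h| ^+ 2.
  move=> zx; apply: (le_trans (lip1 _)).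
  by rewrite ler_wpM2l // lerXn2r ?nnegrE.
have g0 : g 0 = f s by rewrite /g addr0; ring.
rewrite (_ : _ - _ - _ - _ = g h - g 0); last by rewrite g0 /g; ring.
have [x0|x0] := leP 0 h.
  apply: (le_trans (derive_bounded_lipschitz g dg (L * `|h| ^+ 2) 0 h x0 _ _)) => //.
    by move=> z /andP[z0 zx]; apply: dgb; rewrite !ger0_norm.
  rewrite subr0 ger0_norm //. by rewrite -mulrA -exprSr.
rewrite distrC.
apply: (le_trans (derive_bounded_lipschitz g dg (L * `|h| ^+ 2) h 0 (ltW x0) _ _)) => //.
  move=> z /andP[zx z0]; apply: dgb.
  by rewrite (ltr0_norm x0) (ler0_norm z0); lra.
by rewrite sub0r (ltr0_norm x0) -mulrA -exprSr.
Qed.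

End Derivatives.

Section NormalCdf.
Context {R : realType}.

Definition npdf (x : R) : R := normal_pdf 0 1 x.

Lemma npdfE x : npdf x = normal_peak 1 * expR (- (x ^+ 2 / 2)).
Proof.
rewrite /npdf normal_pdfE ?oner_neq0 // /normal_fun subr0 expr1n.
by rewrite mulNr.
Qed.

Lemma npdf_ge0 x : 0 <= npdf x. Proof. exact: normal_pdf_ge0. Qed.

Lemma normal_peak_le1 : normal_peak 1 <= 1 :> R.
Proof.
have h : 1 <= Num.sqrt (1 ^+ 2 * pi *+ 2 : R).
  rewrite -[leLHS]sqrtr1 ler_wsqrtr // expr1n mul1r.
  by have := @pi_ge2 R; rewrite mulr2n; lra.
by rewrite /normal_peak invf_le1 // (lt_le_trans ltr01 h).
Qed.

Lemma npdf_le1 x : npdf x <= 1.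
Proof.
apply: le_trans normal_peak_le1; rewrite npdfE ler_piMr ?normal_peak_ge0 //.
by rewrite -expR0 ler_expR oppr_le0 mulr_ge0 ?sqr_ge0.
Qed.

Lemma npdf_sym x : npdf (- x) = npdf x.
Proof. by rewrite !npdfE sqrrN. Qed.

Lemma npdf_sqr_le x : x ^+ 2 * npdf x <= 2.
Proof.
have E := expR_ge1Dx (x ^+ 2 / 2); have x2 := sqr_ge0 x.
have p0 := expR_gt0 (- (x ^+ 2 / 2)); have := expRxMexpNx_1 (x ^+ 2 / 2).
have := normal_peak_le1; have := normal_peak_ge0 (1 : R); rewrite npdfE.
move: E p0; set e := expR (_ / _); set e' := expR (- _); set c := normal_peak 1.
move=> E p0 c0 c1 ee.
have h : x ^+ 2 * e' <= 2 by nra.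
have h0 : 0 <= x ^+ 2 * e' by rewrite mulr_ge0 // ltW.
by rewrite mulrCA; nra.
Qed.

Lemma npdf_norm_le x : `|x| * npdf x <= 2.
Proof.
have h := npdf_sqr_le x; have h1 := npdf_le1 x; have h0 := npdf_ge0 x.
have [x1|x1] := leP `|x| 1; first by nra.
apply: le_trans h; rewrite ler_wpM2r // -[X in _ <= X]real_normK ?num_real //.
by rewrite expr2; nra.
Qed.

Lemma Phi_derive (x : R) : is_derive x 1 (@Phi R) (npdf x).
Proof.
(* The fundamental theorem needs x strictly inside the interval of integrability, hence the endpoint
   x + 1. *)
have fi : lebesgue_measure.-integrable [set` Interval -oo%O (BRight (x + 1))]
    (EFin \o @normal_pdf R 0 1).
  apply: (@integrableS _ _ _ _ setT) => //.
  exact: integrable_normal_pdf.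
have xx1 : x < x + 1 by lra.
have cx := @continuous_normal_pdf R 0 1 (oner_neq0 _) x.
have [d] := continuous_FTC1 xx1 fi (ltNyr _) cx.
by rewrite derive1E => e; split.
Qed.

(** Seen as a random variable under the normal law, the identity has [Phi] as its distribution
    function, which gives the bounds and limits of [Phi]. *)
Let idR : measurableTypeR R -> R := idfun.

HB.instance Definition _ :=
  @isMeasurableFun.Build _ _ _ _ idR (@measurable_id _ _ setT).

Let PhiE x : (@Phi R x)%:E = cdf (idR : {RV (normal_prob (0 : R) 1) >-> R}) x.
Proof. by rewrite /Phi fineK // fin_num_measure. Qed.

Lemma Phi_ge0 (x : R) : 0 <= Phi x.
Proof. by rewrite -lee_fin PhiE cdf_ge0. Qed.

Lemma Phi_le1 (x : R) : Phi x <= 1.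
Proof. by rewrite -lee_fin PhiE cdf_le1. Qed.

Lemma Phi_cvgNy : @Phi R x @[x --> -oo] --> (0 : R).
Proof.
have h := cvg_cdfNy0 (idR : {RV (normal_prob (0 : R) 1) >-> R}).
have -> : @Phi R = fine \o cdf (idR : {RV (normal_prob (0 : R) 1) >-> R}) by [].
exact: fine_cvg.
Qed.

Lemma Phi_cvgy : @Phi R x @[x --> +oo] --> (1 : R).
Proof.
have h := cvg_cdfy1 (idR : {RV (normal_prob (0 : R) 1) >-> R}).
have -> : @Phi R = fine \o cdf (idR : {RV (normal_prob (0 : R) 1) >-> R}) by [].
exact: fine_cvg.
Qed.

(** The sum Phi(y) + Phi(-y) has derivative zero by symmetry of the density, and it tends to 1. *)
Lemma PhiN x : @Phi R (- x) = 1 - Phi x.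
Proof.
pose F y : R := Phi y + Phi (- y).
have dF (y : R) : is_derive y 1 F 0.
  apply: deriv_eq (deriv_add _ _ _ _ _ (Phi_derive y)
    (deriv_comp _ _ _ _ _ (Phi_derive (- y)) (deriv_opp _ _ _ (deriv_id y)))) _.
  by rewrite npdf_sym; ring.
have Fy : F y @[y --> +oo] --> (1 : R).
  rewrite -[X in _ --> X]addr0; apply: cvgD; first exact: Phi_cvgy.
  by have := Phi_cvgNy; rewrite cvgNy_compNP.
have : F x = 1; last by rewrite /F; lra.
apply: (cvg_unique _ _ Fy) => //.
rewrite (_ : F = fun=> F x); first exact: cvg_cst.
by apply/funext => y; exact: is_derive_0_is_cst.
Qed.

End NormalCdf.

(** * The heat equation *)

Section HeatExtension.
Context {R : realType}.
Implicit Types s q tau : R.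

Lemma npdf_derive (x : R) : is_derive x 1 (@npdf R) (- x * npdf x).
Proof.
have -> : @npdf R = fun x => normal_peak 1 * expR (- (x * x * 2^-1)).
  by apply/funext => y; rewrite npdfE expr2.
apply: deriv_eq (deriv_mul _ _ _ _ _ (deriv_cst (normal_peak 1) x)
  (deriv_comp _ _ _ _ _ (deriv_exp _) (deriv_opp _ _ _ (deriv_mul _ _ _ _ _
    (deriv_mul _ _ _ _ _ (deriv_id x) (deriv_id x)) (deriv_cst 2^-1 x))))) _.
by field.
Qed.

(** The difference [J] has derivative exp(-y^2 / 2) (c - y), with c the peak of the density: it
    increases from J(0) >= 0 up to c, then decreases to its limit 0. *)
Lemma Phi_tail q : 0 <= q -> Phi (- q) <= expR (- (q ^+ 2 / 2)).
Proof.
pose J y : R := expR (- (y * y * 2^-1)) - Phi (- y).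
pose c : R := normal_peak 1.
pose dJ y : R := expR (- (y * y * 2^-1)) * (c - y).
have JE : forall y : R, is_derive y 1 J (dJ y).
  move=> y; apply: deriv_eq (deriv_sub _ _ _ _ _
    (deriv_comp _ _ _ _ _ (deriv_exp _) (deriv_opp _ _ _ (deriv_mul _ _ _ _ _
      (deriv_mul _ _ _ _ _ (deriv_id y) (deriv_id y)) (deriv_cst 2^-1 y))))
    (deriv_comp _ _ _ _ _ (Phi_derive _) (deriv_opp _ _ _ (deriv_id y)))) _.
  by rewrite npdf_sym npdfE /dJ expr2 -/c; field.
move=> q0; rewrite -subr_ge0.
have -> : expR (- (q ^+ 2 / 2)) - Phi (- q) = J q by rewrite /J expr2.
have [qc|cq] := leP q c.
  apply: (@le_trans _ _ (J 0)).
    by rewrite /J oppr0 !mul0r oppr0 expR0 subr_ge0 Phi_le1.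
  apply: (derive_ge0_le J dJ) => // z /andP[z0 zq].
  by rewrite mulr_ge0 ?expR_ge0 // subr_ge0 (le_trans zq).
have h : (fun y : R => - Phi (- y)) y @[y --> +oo] --> (0 : R).
  by rewrite -oppr0; apply: cvgN; have := @Phi_cvgNy R; rewrite cvgNy_compNP.
apply: (cvgr_to_le h); near=> y.
have qy : q <= y by near: y; apply: nbhs_pinfty_ge; exact: num_real.
apply: (@le_trans _ _ (J y)); first by rewrite lerDr expR_ge0.
rewrite -lerN2; apply: (derive_ge0_le (fun y => - J y) (fun y => - dJ y)) => //.
move=> z /andP[qz _]; rewrite /dJ -mulrN mulr_ge0 ?expR_ge0 // opprB subr_ge0.
by rewrite (le_trans (ltW cq)).
Unshelve. all: by end_near. Qed.

(* The solution of u_v = u_ss / 2, in the variable v = tau ^ 2, with initial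
   condition s |-> max 0 (1 - e^(-s)): the Black-Scholes formula. *)
Definition heat s tau : R :=
  Phi (s / tau) - expR (- s + tau ^+ 2 / 2) * Phi (s / tau - tau).

Definition heat_s s tau : R := expR (- s + tau ^+ 2 / 2) * Phi (s / tau - tau).

Definition heat_ss s tau : R := npdf (s / tau) / tau - heat_s s tau.

(** Completing the square. This identity cancels the density terms in the s-derivative of [heat],
    which is why [heat_s] is a single term. *)
Let drift s tau : tau != 0 ->
  expR (- s + tau ^+ 2 / 2) * npdf (s / tau - tau) = npdf (s / tau).
Proof.
move=> t0; rewrite !npdfE mulrCA -expRD; congr (_ * expR _).
by field.
Qed.

Let deriv_div s tau : is_derive s 1 (fun s => s / tau) tau^-1.
Proof.
apply: deriv_eq (deriv_mul _ _ _ _ _ (deriv_id s) (deriv_cst tau^-1 s)) _.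
by ring.
Qed.

Let deriv_divr s tau : tau != 0 ->
  is_derive tau 1 (fun tau => s / tau) (- (s / tau ^+ 2)).
Proof.
move=> t0; apply: deriv_eq (deriv_mul _ _ _ _ _ (deriv_cst s tau)
  (deriv_inv _ _ _ _ (deriv_id tau))) _; first by [].
by field.
Qed.

Let deriv_expo s tau :
  is_derive tau 1 (fun tau => expR (- s + tau ^+ 2 / 2))
    (tau * expR (- s + tau ^+ 2 / 2)).
Proof.
have -> : (fun tau => expR (- s + tau ^+ 2 / 2)) =
   (fun tau => expR (- s + tau * tau * 2^-1)).
  by apply/funext => y; rewrite expr2.
apply: deriv_eq (deriv_comp _ _ _ _ _ (deriv_exp _) (deriv_add _ _ _ _ _
  (deriv_cst (- s) tau) (deriv_mul _ _ _ _ _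
      (deriv_mul _ _ _ _ _ (deriv_id tau) (deriv_id tau)) (deriv_cst 2^-1 tau)))) _.
by rewrite expr2; field.
Qed.

Lemma heat_s_derive_s s tau : tau != 0 ->
  is_derive s 1 (heat_s ^~ tau) (heat_ss s tau).
Proof.
move=> t0; apply: deriv_eq (deriv_mul _ _ _ _ _
  (deriv_comp _ _ _ _ _ (deriv_exp _) (deriv_add _ _ _ _ _
    (deriv_opp _ _ _ (deriv_id s)) (deriv_cst (tau ^+ 2 / 2) s)))
  (deriv_comp _ _ _ _ _ (Phi_derive _)
    (deriv_sub _ _ _ _ _ (deriv_div s tau) (deriv_cst tau s)))) _.
by rewrite subr0 mulrA drift // /heat_ss /heat_s; ring.
Qed.

Lemma heat_derive_s s tau : tau != 0 ->
  is_derive s 1 (heat ^~ tau) (heat_s s tau).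
Proof.
move=> t0; apply: deriv_eq (deriv_sub _ _ _ _ _
  (deriv_comp _ _ _ _ _ (Phi_derive _) (deriv_div s tau))
  (heat_s_derive_s s tau t0)) _.
by rewrite /heat_ss; ring.
Qed.

Definition heat_sss s tau : R :=
  - (s / tau) * npdf (s / tau) / tau ^+ 2 - heat_ss s tau.

Lemma heat_ss_derive_s s tau : tau != 0 ->
  is_derive s 1 (heat_ss ^~ tau) (heat_sss s tau).
Proof.
move=> t0; apply: deriv_eq (deriv_sub _ _ _ _ _ (deriv_mul _ _ _ _ _
  (deriv_comp _ _ _ _ _ (npdf_derive _) (deriv_div s tau)) (deriv_cst tau^-1 s))
  (heat_s_derive_s s tau t0)) _.
by rewrite /heat_sss; field.
Qed.

Lemma heat_s_derive_tau s tau : tau != 0 ->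
  is_derive tau 1 (heat_s s)
    (tau * heat_s s tau - npdf (s / tau) * (s / tau ^+ 2 + 1)).
Proof.
move=> t0; apply: deriv_eq (deriv_mul _ _ _ _ _ (deriv_expo s tau)
  (deriv_comp _ _ _ _ _ (Phi_derive _)
    (deriv_sub _ _ _ _ _ (deriv_divr s tau t0) (deriv_id tau)))) _.
by rewrite mulrA drift // /heat_s; ring.
Qed.

(** With v = tau^2 this is the heat equation: the derivative in v is half of [heat_ss]. *)
Lemma heat_derive_tau s tau : tau != 0 ->
  is_derive tau 1 (heat s) (tau * heat_ss s tau).
Proof.
move=> t0; apply: deriv_eq (deriv_sub _ _ _ _ _
  (deriv_comp _ _ _ _ _ (Phi_derive _) (deriv_divr s tau t0))
  (heat_s_derive_tau s tau t0)) _.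
by rewrite /heat_ss; field.
Qed.

Definition heat_sst s tau : R :=
  (s / tau) ^+ 2 * npdf (s / tau) / tau ^+ 2 - npdf (s / tau) / tau ^+ 2 -
  (tau * heat_s s tau - npdf (s / tau) * (s / tau ^+ 2 + 1)).

Lemma heat_ss_derive_tau s tau : tau != 0 ->
  is_derive tau 1 (heat_ss s) (heat_sst s tau).
Proof.
move=> t0; apply: deriv_eq (deriv_sub _ _ _ _ _ (deriv_mul _ _ _ _ _
  (deriv_comp _ _ _ _ _ (npdf_derive _) (deriv_divr s tau t0))
  (deriv_inv _ _ _ t0 (deriv_id tau))) (heat_s_derive_tau s tau t0)) _.
by rewrite /heat_sst; field.
Qed.

Lemma heat_s_ge0 s tau : 0 <= heat_s s tau.
Proof. by rewrite mulr_ge0 ?expR_ge0 ?Phi_ge0. Qed.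

(** For s < 0 the exponential grows, but the Gaussian tail at tau - s / tau offsets it and even
    leaves exp(-(s / tau)^2 / 2). The derivatives are thus bounded uniformly in s, as the
    telescoping requires. *)
Lemma heat_s_le s tau : 0 < tau -> heat_s s tau <= expR (tau ^+ 2 / 2).
Proof.
move=> t0; have [s0|s0] := leP 0 s.
  rewrite -[leRHS]mulr1 ler_pM ?expR_ge0 ?Phi_ge0 ?Phi_le1 // ler_expR.
  by rewrite gerDr oppr_le0.
rewrite /heat_s; have -> : s / tau - tau = - (tau - s / tau) by ring.
apply: (@le_trans _ _ 1); last first.
  by rewrite -[leLHS]expR0 ler_expR mulr_ge0 ?sqr_ge0.
have q0 : 0 <= tau - s / tau.
  by rewrite subr_ge0 (le_trans _ (ltW t0)) // pmulr_lle0 ?invr_gt0 // ltW.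
apply: (le_trans (ler_wpM2l (expR_ge0 _) (Phi_tail _ q0))).
rewrite -expRD -[leRHS]expR0 ler_expR.
have -> : - s + tau ^+ 2 / 2 + - ((tau - s / tau) ^+ 2 / 2) = - ((s / tau) ^+ 2 / 2).
  by field; rewrite gt_eqF.
by rewrite oppr_le0 mulr_ge0 ?sqr_ge0.
Qed.

Section Bounds.
Variables t0 t1 : R.
Hypotheses (t00 : 0 < t0) (t01 : t0 <= t1).
Let B := expR (t1 ^+ 2 / 2).

Let heat_s_bound s tau : t0 <= tau <= t1 -> 0 <= heat_s s tau <= B.
Proof.
move=> /andP[tau0 tau1]; rewrite heat_s_ge0 /=.
have tp : 0 < tau by exact: lt_le_trans tau0.
apply: (le_trans (heat_s_le s tau tp)); rewrite ler_expR ler_wpM2r //.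
by rewrite lerXn2r ?nnegrE ?(ltW tp) ?(le_trans (ltW tp) tau1).
Qed.

Let inv_bound (a b tau : R) : t0 <= tau -> 0 <= a -> a <= b -> a / tau <= b / t0.
Proof.
move=> h a0 ab; have tp : 0 < tau := lt_le_trans t00 h.
by rewrite ler_pM ?invr_ge0 ?(ltW tp) // lef_pV2 ?posrE.
Qed.

Let norm_npdf s tau : `|s / tau| * npdf (s / tau) = `|s / tau * npdf (s / tau)|.
Proof. by rewrite [in RHS]normrM (ger0_norm (npdf_ge0 _)). Qed.

Lemma heat_ss_bound s tau : t0 <= tau <= t1 -> `|heat_ss s tau| <= 1 / t0 + B.
Proof.
move=> tt; have /andP[h1 h2] := heat_s_bound s tau tt.
move: tt => /andP[ta tb].
have h3 := inv_bound _ _ _ ta (npdf_ge0 _) (npdf_le1 (s / tau)).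
have h4 : 0 <= npdf (s / tau) / tau.
  by rewrite mulr_ge0 ?npdf_ge0 // invr_ge0 (le_trans (ltW t00)).
have h5 : 0 <= 1 / t0 by rewrite div1r invr_ge0 ltW.
by rewrite ler_norml /heat_ss; apply/andP; split; lra.
Qed.

Lemma heat_sss_bound s tau : t0 <= tau <= t1 ->
  `|heat_sss s tau| <= 2 / t0 ^+ 2 + (1 / t0 + B).
Proof.
move=> tt; rewrite (le_trans (ler_normB _ _)) // lerD ?heat_ss_bound //.
move: tt => /andP[ta tb]; have tp : 0 < tau by exact: lt_le_trans ta.
have -> : - (s / tau) * npdf (s / tau) / tau ^+ 2 =
    - ((s / tau * npdf (s / tau)) / tau ^+ 2) by ring.
have i0 : 0 <= (tau ^+ 2)^-1 by rewrite invr_ge0 sqr_ge0.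
rewrite normrN normrM -norm_npdf (ger0_norm i0).
rewrite ler_pM ?mulr_ge0 ?npdf_ge0 ?npdf_norm_le //.
by rewrite lef_pV2 ?posrE ?exprn_gt0 // lerXn2r ?nnegrE // ltW.
Qed.

Let lip_tau := 2 / t0 ^+ 2 + 1 / t0 ^+ 2 + (t1 * B + (2 / t0 + 1)).

Lemma heat_sst_bound s tau : t0 <= tau <= t1 -> `|heat_sst s tau| <= lip_tau.
Proof.
move=> tt; have /andP[h1 h2] := heat_s_bound s tau tt.
move: tt => /andP[ta tb]; have tp : 0 < tau by exact: lt_le_trans ta.
have n0 := npdf_ge0 (s / tau); have n1 := npdf_le1 (s / tau).
have n2 := npdf_sqr_le (s / tau); have n3 := npdf_norm_le (s / tau).
have i0 : 0 <= (tau ^+ 2)^-1 by rewrite invr_ge0 sqr_ge0.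
have i2 : (tau ^+ 2)^-1 <= (t0 ^+ 2)^-1.
  by rewrite lef_pV2 ?posrE ?exprn_gt0 // lerXn2r ?nnegrE // ltW.
rewrite /heat_sst /lip_tau.
apply: (le_trans (ler_normB _ _)); apply: lerD.
  apply: (le_trans (ler_normB _ _)); apply: lerD.
    rewrite (ger0_norm (mulr_ge0 (mulr_ge0 (sqr_ge0 _) n0) i0)).
    by rewrite ler_pM ?(mulr_ge0 (sqr_ge0 _) n0).
  by rewrite (ger0_norm (mulr_ge0 n0 i0)) ler_pM.
apply: (le_trans (ler_normB _ _)); apply: lerD.
  by rewrite (ger0_norm (mulr_ge0 (ltW tp) h1)) ler_pM // ltW.
have -> : npdf (s / tau) * (s / tau ^+ 2 + 1) =
    (s / tau * npdf (s / tau)) / tau + npdf (s / tau) by field; rewrite gt_eqF.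
apply: (le_trans (ler_normD _ _)); apply: lerD; last by rewrite ger0_norm.
rewrite normrM -norm_npdf [`|tau^-1|]ger0_norm ?invr_ge0 ?(ltW tp) //.
by apply: inv_bound; rewrite ?mulr_ge0.
Qed.

(** Taylor expansion to second order in s and first order in tau^2, coupled by the heat equation:
    when d has mean zero and variance tau^2 - tau'^2, the subtracted terms average out. The constant
    depends on t0 and t1 only. *)
Lemma heat_step : exists2 K, 0 <= K & forall s d tau' tau,
  t0 <= tau' -> tau' <= tau -> tau <= t1 ->
  `|heat (s + d) tau' - heat s tau - d * heat_s s tau' -
    2^-1 * (d ^+ 2 - (tau ^+ 2 - tau' ^+ 2)) * heat_ss s tau'| <=
  K * (`|d| ^+ 3 + (tau ^+ 2 - tau' ^+ 2) ^+ 2).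
Proof.
set L1 := 2 / t0 ^+ 2 + (1 / t0 + B).
have B0 : 0 <= B by exact: expR_ge0.
have i0 : 0 < t0^-1 by rewrite invr_gt0.
have i2 : 0 < (t0 ^+ 2)^-1 by rewrite invr_gt0 exprn_gt0.
have t1p : 0 < t1 by exact: lt_le_trans t01.
have L10 : 0 <= L1 by rewrite /L1; lra.
have L20 : 0 <= lip_tau.
  by rewrite /lip_tau; have : 0 <= t1 * B by [rewrite mulr_ge0 // ltW]; lra.
pose K2 := t1 * lip_tau / (2 * t0) ^+ 2.
have K20 : 0 <= K2 by rewrite !mulr_ge0 ?invr_ge0 ?sqr_ge0 // ltW.
exists (L1 + K2); first by rewrite addr_ge0.
move=> s d tau' tau h1 h2 h3.
have tp' : 0 < tau' by exact: lt_le_trans h1.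
have nz : tau' != 0 by rewrite gt_eqF.
have bs : t0 <= tau' <= t1 by rewrite h1 (le_trans h2).
have A1 := @taylor2_lipschitz R (heat ^~ tau') (heat_s ^~ tau')
  (heat_ss ^~ tau') L1 L10 (fun z => heat_derive_s z tau' nz)
  (fun z => heat_s_derive_s z tau' nz).
have lip x y : `|heat_ss y tau' - heat_ss x tau'| <= L1 * `|y - x|.
  wlog xy : x y / x <= y => [H|].
    by case: (leP x y) => [/H //|/ltW /H]; rewrite distrC [`|y - x|]distrC.
  rewrite [`|y - x|]ger0_norm ?subr_ge0 //.
  apply: (derive_bounded_lipschitz (heat_ss ^~ tau') (heat_sss ^~ tau')) => // z _.
    exact: heat_ss_derive_s.
  exact: heat_sss_bound.
have {A1} A1 := A1 lip s d.
have lip2 z : tau' <= z <= tau -> `|heat_ss s z - heat_ss s tau'| <= lip_tau * (tau - tau').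
  move=> /andP[z1 z2].
  apply: (@le_trans _ _ (lip_tau * (z - tau'))); last by rewrite ler_wpM2l // lerD2r.
  apply: (derive_bounded_lipschitz (heat_ss s) (heat_sst s)) => // y /andP[y1 y2].
    by apply: heat_ss_derive_tau; rewrite gt_eqF // (lt_le_trans tp').
  by apply: heat_sst_bound; rewrite (le_trans h1) //= (le_trans y2) // (le_trans z2).
(* In the variable tau^2 the first-order coefficient of [heat s] is half of [heat_ss]; subtracting
   it leaves a derivative controlled by the Lipschitz bound [lip2]. *)
pose g z := heat s z - z * z * (2^-1 * heat_ss s tau').
pose dg z := z * (heat_ss s z - heat_ss s tau').
have A2 : `|g tau - g tau'| <= t1 * (lip_tau * (tau - tau')) * (tau - tau').
  apply: (derive_bounded_lipschitz g dg) => // z /andP[z1 z2].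
    apply: deriv_eq (deriv_sub _ _ _ _ _ (heat_derive_tau s z _)
     (deriv_mul _ _ _ _ _ (deriv_mul _ _ _ _ _ (deriv_id z) (deriv_id z))
       (deriv_cst (2^-1 * heat_ss s tau') z))) _.
      by rewrite gt_eqF // (lt_le_trans tp').
    by rewrite /dg; field.
  rewrite /dg normrM ler_pM //; last by apply: lip2; rewrite z1.
  by rewrite ger0_norm ?(le_trans z2) // (le_trans (ltW tp')).
have A3 : t1 * (lip_tau * (tau - tau')) * (tau - tau') <=
    K2 * (tau ^+ 2 - tau' ^+ 2) ^+ 2.
  have -> : t1 * (lip_tau * (tau - tau')) * (tau - tau') =
     K2 * (2 * t0 * (tau - tau')) ^+ 2 by rewrite /K2; field; rewrite gt_eqF.
  have e0 : 0 <= 2 * t0 * (tau - tau').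
    by rewrite mulr_ge0 ?subr_ge0 // mulr_ge0 // ltW.
  have e1 : 2 * t0 * (tau - tau') <= tau ^+ 2 - tau' ^+ 2.
    by rewrite subr_sqr mulrC ler_wpM2l ?subr_ge0 //; lra.
  by rewrite ler_wpM2l // lerXn2r ?nnegrE ?(le_trans e0).
have -> : heat (s + d) tau' - heat s tau - d * heat_s s tau' -
    2^-1 * (d ^+ 2 - (tau ^+ 2 - tau' ^+ 2)) * heat_ss s tau' =
    (heat (s + d) tau' - heat s tau' - d * heat_s s tau' -
    2^-1 * d ^+ 2 * heat_ss s tau') - (g tau - g tau') by rewrite /g; ring.
apply: (le_trans (ler_normB _ _)).
apply: (le_trans (lerD A1 (le_trans A2 A3))).
rewrite mulrDr; apply: lerD.
  by rewrite ler_wpM2r ?exprn_ge0 // lerDl.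
by rewrite ler_wpM2r ?sqr_ge0 // lerDr.
Qed.

End Bounds.

End HeatExtension.

(** * Inequalities *)

Section Gap.
Context {R : realType}.
Implicit Types s tau : R.

Definition gap s : R := Num.max 0 (1 - expR (- s)).

Lemma Phi_lipschitz (x y : R) : x <= y -> Phi x <= Phi y <= Phi x + (y - x).
Proof.
move=> xy.
have h := derive_bounded_lipschitz (@Phi R) (@npdf R) 1 x y xy
  (fun z _ => Phi_derive z).
have h1 := derive_ge0_le (@Phi R) (@npdf R) x y xy (fun z _ => Phi_derive z)
  (fun z _ => npdf_ge0 z).
have h2 : `|Phi y - Phi x| <= 1 * (y - x) :> R.
  by apply: h => z _; rewrite (ger0_norm (npdf_ge0 z)) npdf_le1.
rewrite ger0_norm ?subr_ge0 // mul1r in h2.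
by rewrite h1 /=; lra.
Qed.

Let xexp (x : R) : 0 <= x -> x * expR (- (x ^+ 2 / 2)) <= 1.
Proof.
move=> x0; have E := expR_ge1Dx (x ^+ 2 / 2).
have p0 := expR_gt0 (- (x ^+ 2 / 2)); have := expRxMexpNx_1 (x ^+ 2 / 2).
move: E p0; set e := expR (_ / _); set e' := expR (- _) => E p0 ee.
have xe : x <= e by nra.
by rewrite -ee ler_wpM2r // ltW.
Qed.

(** The initial condition is attained uniformly in s, at rate tau. This is the price of stopping the
    telescoping at a positive time. *)
Lemma heat_gap s tau : 0 < tau -> tau <= 1 -> `|heat s tau - gap s| <= 3 * tau.
Proof.
move=> t0 t1; have tnz : tau != 0 by rewrite gt_eqF.
have /andP[l1 l2] : Phi (s / tau - tau) <= Phi (s / tau) <=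
    Phi (s / tau - tau) + (s / tau - (s / tau - tau)).
  by apply: Phi_lipschitz; lra.
have q0 := Phi_ge0 (s / tau - tau); have q1 := Phi_le1 (s / tau - tau).
rewrite /gap; have [s0|s0] := leP 0 s.
  have es : expR (- s) <= 1 by rewrite -expR0 ler_expR oppr_le0.
  have es0 := expR_ge0 (- s); have es1 := expR_ge1Dx (- s).
  have et : expR (tau ^+ 2 / 2) <= 1 + tau.
    have h : tau ^+ 2 / 2 <= 2^-1 by nra.
    by apply: (le_trans (expR_le_quad _ h)); nra.
  have et0 : 1 <= expR (tau ^+ 2 / 2).
    by rewrite -[leLHS]expR0 ler_expR mulr_ge0 ?sqr_ge0.
  rewrite maxEle subr_ge0 es /heat expRD.
  have d0 : 0 <= s / tau by rewrite mulr_ge0 ?invr_ge0 // ltW.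
  have tail := Phi_tail (s / tau) d0; rewrite PhiN in tail.
  have st : s * (1 - Phi (s / tau)) <= tau.
    have := xexp _ d0; set x := s / tau in tail d0 *.
    have -> : s = tau * x by rewrite /x; field.
    move=> h; rewrite -mulrA ler_piMr ?(ltW t0) //.
    by apply: le_trans h; rewrite ler_wpM2l.
  move: l1 l2 q0 q1 et et0 es es0 es1 st.
  set P1 := Phi (s / tau); set P2 := Phi (_ - _); set E := expR (- s).
  set F := expR (_ / _) => l1 l2 q0 q1 et et0 es es0 es1 st.
  have P11 : P1 <= 1 by exact: Phi_le1.
  have a1 : 0 <= E * (F - 1) * P2 <= tau.
    apply/andP; split; first by rewrite !mulr_ge0 // subr_ge0.
    have b1 : E * (F - 1) <= F - 1 by nra.
    have b2 : E * (F - 1) * P2 <= E * (F - 1) by rewrite ler_piMr // mulr_ge0 // subr_ge0.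
    lra.
  have a2 : 0 <= E * (P1 - P2) <= tau.
    apply/andP; split; first by rewrite mulr_ge0 // subr_ge0.
    by apply: (@le_trans _ _ (P1 - P2)); [rewrite ler_piMl // subr_ge0|lra].
  have a3 : 0 <= (1 - E) * (1 - P1) <= tau.
    apply/andP; split; first by rewrite mulr_ge0 ?subr_ge0.
    apply: le_trans st; rewrite ler_wpM2r ?subr_ge0 //; lra.
  (* Three errors, each at most tau: the shift of the argument of Phi by tau, the Gaussian tail
     beyond s / tau, and the factor exp(tau^2 / 2). *)
  have -> : P1 - E * F * P2 - (1 - E) =
     E * (P1 - P2) - (1 - E) * (1 - P1) - E * (F - 1) * P2 by ring.
  by rewrite ler_norml; apply/andP; split; lra.
have es : (0 <= 1 - expR (- s)) = false.
  by apply/negbTE; rewrite -ltNge subr_lt0 expR_gt1 oppr_gt0.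
rewrite maxEle es subr0 /heat; set A := - s + tau ^+ 2 / 2.
have A0 : 0 < A by rewrite /A; have := sqr_ge0 tau; lra.
have eA : 1 <= expR A by rewrite -[leLHS]expR0 ler_expR ltW.
have d0 : 0 <= tau - s / tau.
  by rewrite subr_ge0 (le_trans _ (ltW t0)) // pmulr_lle0 ?invr_gt0 // ltW.
have x0 : 0 <= - s / tau by rewrite mulr_ge0 ?invr_ge0 ?oppr_ge0 ?(ltW t0) ?(ltW s0).
have tail := Phi_tail _ d0; rewrite opprB in tail.
have e2 : - ((tau - s / tau) ^+ 2 / 2) = - A + - ((- s / tau) ^+ 2 / 2).
  by rewrite /A; field.
rewrite e2 expRD in tail.
have := xexp _ x0; set x := - s / tau in tail x0 *.
move: tail; set G := expR (- (x ^+ 2 / 2)) => tail xG.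
have G1 : G <= 1.
  by rewrite -[leRHS]expR0 ler_expR oppr_le0 mulr_ge0 ?sqr_ge0.
have G0 : 0 <= G := expR_ge0 _.
have Ax : A = tau * x + tau ^+ 2 / 2 by rewrite /A /x; field.
(* Here exp A times the tail is at most [G], which leaves (1 - exp(-A)) G <= A G. Since A = tau x +
   tau^2 / 2 and x G <= 1, this is of order tau. *)
have key : (expR A - 1) * Phi (s / tau - tau) <= 2 * tau.
  apply: (@le_trans _ _ ((expR A - 1) * (expR (- A) * G))).
    by rewrite ler_wpM2l // subr_ge0.
  rewrite mulrA mulrBl expRxMexpNx_1 mul1r.
  have h := expR_ge1Dx (- A).
  apply: (@le_trans _ _ (A * G)); first by rewrite ler_wpM2r //; lra.
  rewrite Ax mulrDl -mulrA.
  have h1 : tau * (x * G) <= tau by rewrite ler_piMr // ltW.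
  have h2 : tau ^+ 2 / 2 * G <= tau by nra.
  lra.
have key2 : Phi (s / tau - tau) <= expR A * Phi (s / tau - tau).
  by rewrite ler_peMl.
move: l1 l2 key key2; rewrite mulrBl mul1r => l1 l2 key key2.
by rewrite ler_norml; apply/andP; split; lra.
Qed.

(** For M Gaussian of variance tau^2, the condition E exp(-M) = 1 forces the mean tau^2 / 2; this
    value of s gives the final formula. *)
Lemma heat_half tau : 0 < tau -> heat (tau ^+ 2 / 2) tau = 2 * Phi (tau / 2) - 1.
Proof.
move=> t0; rewrite /heat addNr expR0 mul1r.
have -> : tau ^+ 2 / 2 / tau = tau / 2 by field; rewrite gt_eqF.
have -> : tau / 2 - tau = - (tau / 2) by field.
by rewrite PhiN; ring.
Qed.

(** Since 1 - gap(y) = min(1, exp(-y)), the right side is the mean of min(exp k, exp(-M)) for M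
    Gaussian of mean tau^2 / 2 and variance tau^2. The lower bound tends to 1 as k grows: no mass
    escapes. *)
Lemma heat_mass tau k : 0 < tau -> Phi (k / tau - tau / 2) <=
  expR k * (1 - heat (tau ^+ 2 / 2 + k) tau).
Proof.
move=> t0; rewrite /heat opprB addrCA mulrDr opprD.
have -> : - (tau ^+ 2 / 2) + - k + tau ^+ 2 / 2 = - k by ring.
rewrite mulrA expRxMexpNx_1 mul1r.
have -> : (tau ^+ 2 / 2 + k) / tau - tau = k / tau - tau / 2.
  by field; rewrite gt_eqF.
by rewrite lerDl mulr_ge0 ?expR_ge0 // subr_ge0 Phi_le1.
Qed.

End Gap.

(** * Taylor bounds for the logarithm *)

Section LogInequalities.
Context {R : realType}.
Implicit Types u v w e : R.

Let deriv_ln1 u : -1 < u -> is_derive u 1 (fun u => ln (1 + u)) (1 + u)^-1.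
Proof.
move=> u1; apply: deriv_eq (deriv_comp _ _ _ _ _ (deriv_ln (1 + u) _)
  (deriv_add _ _ _ _ _ (deriv_cst 1 u) (deriv_id u))) _; first by lra.
by rewrite add0r mulr1.
Qed.

(** The derivative has the sign of u, so the minimum is at 0. A Taylor polynomial of odd degree d
    fits: the derivative of its difference with ln(1 + u) is u^d / (1 + u). *)
Let min_at_0 (g h : R -> R) u : g 0 = 0 ->
  (forall u, -1 < u -> is_derive u 1 g (u * h u)) ->
  (forall u, -1 < u -> 0 <= h u) -> -1 < u -> 0 <= g u.
Proof.
move=> g0 gd h0 u1; have [u0|u0] := leP 0 u.
  rewrite -g0; apply: (derive_ge0_le g (fun z => z * h z)) => // z /andP[z0 zu].
    by apply: gd; lra.
  by rewrite mulr_ge0 // h0 //; lra.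
rewrite -oppr_le0 -[leRHS]oppr0 -[in leRHS]g0.
apply: (derive_ge0_le (fun z => - g z) (fun z => - (z * h z))) => // [|z|z].
- exact: ltW.
- by move=> /andP[uz z0]; apply: (deriv_opp _ _ _ (gd _ _)); lra.
- by move=> /andP[uz z0]; rewrite -mulNr mulr_ge0 ?oppr_ge0 // h0 //; lra.
Qed.

Lemma ln1D_le3 u : -1 < u -> ln (1 + u) <= u - u ^+ 2 / 2 + u ^+ 3 / 3.
Proof.
move=> u1; rewrite -subr_ge0.
pose g z : R := z * (1 - z * (2^-1 - z * 3^-1)) - ln (1 + z).
have -> : u - u ^+ 2 / 2 + u ^+ 3 / 3 - ln (1 + u) = g u by rewrite /g; field.
refine (min_at_0 g (fun z => z ^+ 2 / (1 + z)) u _ _ _ u1).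
- by rewrite /g addr0 ln1; ring.
- move=> z z1; apply: deriv_eq (deriv_sub _ _ _ _ _ (deriv_mul _ _ _ _ _
    (deriv_id z) (deriv_sub _ _ _ _ _ (deriv_cst 1 z) (deriv_mul _ _ _ _ _
      (deriv_id z) (deriv_sub _ _ _ _ _ (deriv_cst 2^-1 z) (deriv_mul _ _ _ _ _
        (deriv_id z) (deriv_cst 3^-1 z)))))) (deriv_ln1 z z1)) _.
  by field; lra.
- by move=> z z1; rewrite divr_ge0 ?sqr_ge0 //; lra.
Qed.

Lemma ln1D_le5 u : -1 < u ->
  ln (1 + u) <= u - u ^+ 2 / 2 + u ^+ 3 / 3 - u ^+ 4 / 4 + u ^+ 5 / 5.
Proof.
move=> u1; rewrite -subr_ge0.
pose g z : R := z * (1 - z * (2^-1 - z * (3^-1 - z * (4^-1 - z * 5^-1)))) -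
  ln (1 + z).
have -> : u - u ^+ 2 / 2 + u ^+ 3 / 3 - u ^+ 4 / 4 + u ^+ 5 / 5 - ln (1 + u) = g u.
  by rewrite /g; field.
refine (min_at_0 g (fun z => (z ^+ 2) ^+ 2 / (1 + z)) u _ _ _ u1).
- by rewrite /g addr0 ln1; ring.
- move=> z z1; apply: deriv_eq (deriv_sub _ _ _ _ _ (deriv_mul _ _ _ _ _
    (deriv_id z) (deriv_sub _ _ _ _ _ (deriv_cst 1 z) (deriv_mul _ _ _ _ _
      (deriv_id z) (deriv_sub _ _ _ _ _ (deriv_cst 2^-1 z) (deriv_mul _ _ _ _ _
        (deriv_id z) (deriv_sub _ _ _ _ _ (deriv_cst 3^-1 z) (deriv_mul _ _ _ _ _
          (deriv_id z) (deriv_sub _ _ _ _ _ (deriv_cst 4^-1 z) (deriv_mul _ _ _ _ _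
          (deriv_id z) (deriv_cst 5^-1 z)))))))))) (deriv_ln1 z z1)) _.
  by field; lra.
- by move=> z z1; rewrite divr_ge0 ?sqr_ge0 //; lra.
Qed.

(** Serves to bound the two correction terms of [logsum] together: their first-order parts cancel,
    and the rest is quadratic. *)
Lemma ln1D_sub_le e : 0 <= e -> ln (1 + e) - e / (1 + e) <= e ^+ 2 / 2.
Proof.
move=> e0; rewrite -subr_ge0.
pose g z : R := z * z * 2^-1 - (ln (1 + z) - z / (1 + z)).
pose dg z : R := z * (1 - (1 + z)^-1 ^+ 2).
have -> : e ^+ 2 / 2 - (ln (1 + e) - e / (1 + e)) = g e by rewrite /g expr2.
have <- : g 0 = 0 by rewrite /g addr0 ln1; ring.
apply: (derive_ge0_le g dg) => // z /andP[z0 ze].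
  apply: deriv_eq (deriv_sub _ _ _ _ _ (deriv_mul _ _ _ _ _
    (deriv_mul _ _ _ _ _ (deriv_id z) (deriv_id z)) (deriv_cst 2^-1 z))
    (deriv_sub _ _ _ _ _ (deriv_ln1 z _) (deriv_mul _ _ _ _ _ (deriv_id z)
      (deriv_inv _ _ _ _ (deriv_add _ _ _ _ _ (deriv_cst 1 z) (deriv_id z)))))) _.
  - lra.
  - by apply/eqP; lra.
  - by rewrite /dg; field; lra.
rewrite mulr_ge0 // subr_ge0 exprn_ile1 ?invr_ge0 ?invf_le1; lra.
Qed.

(** The tangent lines at u and at v bound the increment of the concave function ln from both sides;
    their slopes differ from 1 by u / (1 + u) and v / (1 + v). *)
Lemma ln1D_diff u v : -1 < u -> -1 < v ->
  `|ln (1 + v) - ln (1 + u) - (v - u)| <=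
  `|v - u| * (`|u| / (1 + u) + `|v| / (1 + v)).
Proof.
move=> u1 v1.
have up (x y : R) : -1 < x -> -1 < y ->
    ln (1 + y) - ln (1 + x) - (y - x) <= `|y - x| * (`|x| / (1 + x)).
  move=> x1 y1; have x0 : 0 < 1 + x by lra.
  have y0 : 0 < 1 + y by lra.
  have e : 1 + (y - x) / (1 + x) = (1 + y) / (1 + x) by field; lra.
  have h : -1 < (y - x) / (1 + x).
    by have : 0 < (1 + y) / (1 + x) by [rewrite divr_gt0]; rewrite -e; lra.
  have := le_ln1Dx h; rewrite e ln_div ?posrE // => l.
  apply: (@le_trans _ _ (- ((y - x) * (x / (1 + x))))).
    have -> : - ((y - x) * (x / (1 + x))) = (y - x) / (1 + x) - (y - x).
      by field; lra.
    lra.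
  apply: (le_trans (ler_norm _)); rewrite normrN !normrM.
  by rewrite [`|(1 + x)^-1|]ger0_norm // invr_ge0 ltW.
have h1 := up u v u1 v1; have h2 := up v u v1 u1.
rewrite [`|u - v|]distrC in h2.
have p1 : 0 <= `|v - u| * (`|u| / (1 + u)).
  by rewrite !mulr_ge0 ?invr_ge0 //; lra.
have p2 : 0 <= `|v - u| * (`|v| / (1 + v)).
  by rewrite !mulr_ge0 ?invr_ge0 //; lra.
rewrite mulrDr ler_norml; apply/andP; split; lra.
Qed.

End LogInequalities.

(** * The central limit theorem *)

Section QuadraticStatistic.
Context {R : realType} {n : nat}.
Hypothesis n0 : (0 < n)%N.
Variables (al : 'I_n -> R) (be : R).
Hypothesis al0 : \sum_i al i = 0.
Let p : R := n%:R^-1.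
Let nz : n%:R != 0 :> R. Proof. by rewrite pnatr_eq0 -lt0n. Qed.
Let np : n%:R * p = 1. Proof. by rewrite /p divff. Qed.
Let p0 : 0 <= p. Proof. by rewrite invr_ge0. Qed.
Let p1 : p <= 1. Proof. by rewrite invf_le1 ?ltr0n // ler1n. Qed.

(** The centring t (1 - 1/n) is the mean of the sum of squares, and [dev t] follows the current
    number of balls; with coefficients [al] of sum zero, this makes [qstat] a martingale in t with
    increments [qincr]. *)
Definition qstat (t : nat) (z : 'I_n -> nat) : R :=
  \sum_i al i * (z i)%:R -
  be / 2 * (\sum_i dev t z i ^+ 2 - t%:R * (1 - n%:R^-1)).

Definition qincr (t : nat) (z : 'I_n -> nat) (i : 'I_n) : R :=
  al i - be * dev t z i.

Lemma sum_delta (i : 'I_n) (F : 'I_n -> R) : \sum_j (j == i)%:R * F j = F i.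
Proof.
rewrite (bigD1 i) //= eqxx mul1r big1 ?addr0 // => j /negbTE ->.
by rewrite mul0r.
Qed.

Lemma qstatS t z i : balls z = t ->
  qstat t.+1 (place i z) = qstat t z + qincr t z i.
Proof.
move=> zt; rewrite /qstat /qincr.
have -> : \sum_j al j * (place i z j)%:R = \sum_j al j * (z j)%:R + al i.
  rewrite -[X in _ = _ + X](sum_delta i) -big_split /=; apply: eq_bigr => j _.
  by rewrite /place natrD mulrDr [al j * (_ == _)%:R]mulrC.
have -> : \sum_j dev t.+1 (place i z) j ^+ 2 =
    \sum_j dev t z j ^+ 2 + 2 * dev t z i + 1 - p.
  transitivity (\sum_j (dev t z j ^+ 2 + p ^+ 2 - 2 * p * dev t z j +
      (j == i)%:R * (2 * dev t z j + 1 - 2 * p))).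
    apply: eq_bigr => j _; rewrite dev_place -/p.
    by case: (j == i); rewrite ?mulr1n ?mulr0n; ring.
  rewrite big_split sum_delta /= sumrB big_split /=.
  rewrite [X in _ - X](_ : _ = 0); last by rewrite -mulr_sumr sum_dev // mulr0.
  rewrite sumr_const card_ord -[p ^+ 2 *+ n]mulr_natl expr2 mulrA np; ring.
by rewrite -natr1 -/p; field.
Qed.

Lemma avg_qincr t z : balls z = t -> avg (qincr t z) = 0.
Proof.
by move=> zt; rewrite /qincr avgB avgZ /avg sum_dev // al0 !(mulr0, subr0).
Qed.

(** The mean of the conditional variance of an increment. Being deterministic, it can serve as the
    time step of the heat flow. *)
Definition qvar (t : nat) : R :=
  n%:R^-1 * \sum_i al i ^+ 2 + be ^+ 2 * (t%:R / n%:R) * (1 - n%:R^-1).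

Lemma avg_qincr2 t z : avg (fun i => qincr t z i ^+ 2) - qvar t =
  - (2 * be * p) * (\sum_i al i * dev t z i) +
  be ^+ 2 * p * (\sum_i dev t z i ^+ 2 - t%:R * (1 - p)).
Proof.
transitivity (avg (fun i => al i ^+ 2 - 2 * be * (al i * dev t z i) +
    be ^+ 2 * dev t z i ^+ 2) - qvar t).
  by congr (_ - _); apply: eq_avg => i; rewrite /qincr; ring.
by rewrite avgD avgB !avgZ /avg /qvar -/p; ring.
Qed.

Lemma expect_lin_norm t :
  expect t (fun z => `|\sum_i al i * dev t z i|) <=
  Num.sqrt (t%:R / n%:R * \sum_i al i ^+ 2).
Proof.
apply: (le_trans (expect_norm_le n0 _ _)); apply: ler_wsqrtr.
pose g (z : 'I_n -> nat) : R := \sum_i al i * dev t z i.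
have Eg : expect t g = 0.
  rewrite expect_sum // big1 // => i _; rewrite expectZ.
  by rewrite (expect_dev n0) mulr0.
have := efron_stein n0 t g (fun=> 0).
rewrite Eg expr0n /= subr0 => h; apply: (le_trans h).
rewrite -mulrA ler_wpM2l //.
rewrite (_ : (fun z => _) = fun=> n%:R^-1 * \sum_i al i ^+ 2) ?expect_cst //.
apply/funext => z; rewrite /avg; congr (_ * _); apply: eq_bigr => i _.
rewrite subr0 /g -sumrB -(sum_delta i); congr (_ ^+ 2); apply: eq_bigr => j _.
by rewrite /dev /place natrD; ring.
Qed.

Lemma expect_sqdev_norm t :
  expect t (fun z : 'I_n -> nat => `|\sum_i dev t z i ^+ 2 - t%:R * (1 - p)|) <=
  Num.sqrt (4 * n%:R * (t%:R / n%:R) ^+ 2).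
Proof.
apply: (le_trans (expect_norm_le n0 _ _)); apply: ler_wsqrtr.
pose g (z : 'I_n -> nat) : R := \sum_i dev t z i ^+ 2.
have Eg : expect t g = t%:R * (1 - p).
  rewrite expect_sum // (eq_bigr _ (fun i _ => expect_dev2 n0 t i)).
  rewrite sumr_const card_ord -[X in X = _]mulr_natl -/p mulrCA.
  by rewrite [n%:R * _]mulrA np mul1r.
rewrite (@eq_expect R n t _ (fun z => (g z - expect t g) ^+ 2)); last first.
  by move=> z _; rewrite Eg.
(* At fixed centring, a ball in bin i changes the sum of squares by 2 dev + 1 - 2p, with dev the
   deviation before the throw; the centre 1 - 2p leaves 2 dev. *)
rewrite expect_var //; apply: (le_trans (efron_stein n0 t g (fun=> 1 - 2 * p))).
case: t @g Eg => [|t] g Eg.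
  by rewrite mul0r !mulr_ge0 ?sqr_ge0.
have -> : 4 * n%:R * (t.+1%:R / n%:R) ^+ 2 = t.+1%:R * (4 * (t.+1%:R / n%:R)) :> R.
  by field.
rewrite ler_wpM2l //= (@eq_expect R n t _ (fun z => avg (fun i => 4 * dev t z i ^+ 2))).
  rewrite (expect_avg n0 t (fun i z => 4 * dev t z i ^+ 2)).
  rewrite (@eq_avg _ _ _ (fun=> 4 * (t%:R * (p * (1 - p))))); last first.
    by move=> i; rewrite expectZ (expect_dev2 n0).
  rewrite avg_cst // ler_wpM2l // mulrA -/p.
  have h : t%:R * p <= t.+1%:R * p by rewrite ler_wpM2r // ler_nat.
  by apply: le_trans h; rewrite ler_piMr ?mulr_ge0 ?gerBl.
move=> z zt; apply: eq_avg => i.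
rewrite /g -sumrB (_ : \sum_j _ = 2 * dev t z i + 1 - 2 * p); first by ring.
transitivity (\sum_j (j == i)%:R * (2 * dev t z j + 1 - 2 * p)); last first.
  by rewrite (sum_delta i (fun j => 2 * dev t z j + 1 - 2 * p)).
apply: eq_bigr => j _.
rewrite dev_place (_ : dev t.+1 z j = dev t z j - p); last first.
  by rewrite /dev -natr1 /p; ring.
by rewrite -/p; case: (j == i); rewrite ?mulr1n ?mulr0n; ring.
Qed.

End QuadraticStatistic.

Section CentralLimit.
Context {R : realType} {n : nat}.
Hypothesis n0 : (0 < n)%N.
Variables (al : 'I_n -> R) (be C : R) (N : nat).
Hypothesis al0 : \sum_i al i = 0.
Let nu : R := N%:R / n%:R.
Hypotheses (C1 : 1 <= C) (nu1 : 1 <= nu).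
Hypothesis al_bound : nu * \sum_i al i ^+ 2 <= C.
Hypothesis be_bound : n%:R * nu ^+ 2 * be ^+ 2 <= C.

Let p : R := n%:R^-1.
Let rn : R := Num.sqrt n%:R.
Let rv : R := Num.sqrt nu.
Let nr1 : 1 <= n%:R :> R. Proof. by rewrite ler1n. Qed.
Let rn1 : 1 <= rn. Proof. by rewrite -sqrtr1 ler_wsqrtr. Qed.
Let rv1 : 1 <= rv. Proof. by rewrite -sqrtr1 ler_wsqrtr. Qed.
Let rn0 : 0 < rn. Proof. exact: lt_le_trans rn1. Qed.
Let rv0 : 0 < rv. Proof. exact: lt_le_trans rv1. Qed.
Let nu0 : 0 < nu. Proof. exact: lt_le_trans nu1. Qed.
Let C0 : 0 < C. Proof. exact: lt_le_trans C1. Qed.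
Let rn2 : n%:R = rn ^+ 2. Proof. by rewrite sqr_sqrtr. Qed.
Let rv2 : nu = rv ^+ 2. Proof. by rewrite sqr_sqrtr // ltW. Qed.
Let NE : N%:R = rn ^+ 2 * rv ^+ 2.
Proof. by rewrite -rn2 -rv2 /nu; field; rewrite pnatr_eq0 -lt0n. Qed.

Let tnu t : (t <= N)%N -> t%:R / n%:R <= nu.
Proof. by move=> tN; rewrite ler_wpM2r ?invr_ge0 // ler_nat. Qed.

Let sq_le_CC (x y : R) : 0 <= x -> 0 <= y -> y ^+ 2 * x ^+ 2 <= C -> y * x <= C.
Proof.
move=> x0 y0 h; rewrite -(ler_pXn2r (isT : (0 < 2)%N)) ?nnegrE ?mulr_ge0 ?(ltW C0) //.
by rewrite exprMn (le_trans h) // expr2 ler_peMl // ltW.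
Qed.

Let be_le : `|be| <= C / (rn * rv ^+ 2).
Proof.
rewrite ler_pdivlMr ?mulr_gt0 ?exprn_gt0 // mulrC sq_le_CC ?mulr_ge0 ?exprn_ge0 ?(ltW rn0) ?(ltW rv0) //.
by rewrite real_normK ?num_real // exprMn -rn2 -rv2.
Qed.

Let al_le i : `|al i| <= C / rv.
Proof.
rewrite ler_pdivlMr // mulrC sq_le_CC ?(ltW rv0) // -rv2 real_normK ?num_real //.
apply: le_trans al_bound; rewrite ler_wpM2l ?(ltW nu0) //.
by rewrite (bigD1 i) //= lerDl sumr_ge0 // => j _; rewrite sqr_ge0.
Qed.

Let A2_le : \sum_i al i ^+ 2 <= C / rv ^+ 2.
Proof. by rewrite ler_pdivlMr ?exprn_gt0 // mulrC -rv2. Qed.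

Let expect_dev_norm3 t (i : 'I_n) : (t <= N)%N ->
  expect t (fun z => `|dev t z i| ^+ 3) <= moment_bound 3 * rv ^+ 3.
Proof.
move=> tN; have := expect_dev_bound n0 nu t i 3 nu1 (tnu t tN) => h.
rewrite mulrC -ler_pdivrMl ?exprn_gt0 //.
apply: le_trans h; rewrite -expectZ; apply: expect_le => z _.
rewrite -/rv -exprVn -exprMn lerXn2r ?nnegrE ?addr_ge0 ?mulr_ge0 ?invr_ge0 ?(ltW rv0) //.
by rewrite mulrC lerDr.
Qed.

(** Over N steps the fluctuation of the conditional variance is of order n^(-1/2): Efron-Stein
    bounds the linear sum by C and the quadratic one by 2 nu sqrt(n). *)
Let expect_norm_var t : (t <= N)%N ->
  N%:R * expect t (fun z => `|avg (fun i => qincr al be t z i ^+ 2) - qvar al be t|)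
  <= 4 * C ^+ 2 / rn.
Proof.
move=> tN; have tn := tnu t tN; have tp0 : 0 <= t%:R / n%:R :> R by rewrite divr_ge0.
have p0 : 0 <= p by rewrite invr_ge0.
have h1 : expect t (fun z => `|\sum_i al i * dev t z i|) <= C.
  apply: (le_trans (expect_lin_norm n0 al t)).
  have <- : Num.sqrt (C ^+ 2) = C by rewrite sqrtr_sqr gtr0_norm.
  apply: ler_wsqrtr; apply: (@le_trans _ _ C); last by rewrite expr2 ler_peMl // ltW.
  apply: le_trans al_bound; rewrite ler_wpM2r // sumr_ge0 // => j _.
  exact: sqr_ge0.
have h2 : expect t (fun z : 'I_n -> nat =>
    `|\sum_i dev t z i ^+ 2 - t%:R * (1 - p)|) <= 2 * rn * rv ^+ 2.
  apply: (le_trans (expect_sqdev_norm n0 t)).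
  have -> : 2 * rn * rv ^+ 2 = Num.sqrt ((2 * rn * rv ^+ 2) ^+ 2).
    by rewrite sqrtr_sqr ger0_norm // !mulr_ge0 // ?exprn_ge0 // ltW.
  apply: ler_wsqrtr; rewrite -rv2.
  rewrite (_ : (2 * rn * nu) ^+ 2 = 4 * n%:R * nu ^+ 2); last by rewrite rn2; ring.
  by rewrite ler_wpM2l ?mulr_ge0 // lerXn2r ?nnegrE ?(ltW nu0).
have b2 : be ^+ 2 <= C / (rn ^+ 2 * rv ^+ 4).
  rewrite ler_pdivlMr ?mulr_gt0 ?exprn_gt0 // mulrC.
  apply: le_trans be_bound; rewrite rn2 [in leRHS]rv2 -exprM.
  by [].
apply: (@le_trans _ _ (N%:R * ((2 * `|be| * p) * C +
    (be ^+ 2 * p) * (2 * rn * rv ^+ 2)))).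
  rewrite ler_wpM2l //.
  apply: (@le_trans _ _ (expect t (fun z =>
     (2 * `|be| * p) * `|\sum_i al i * dev t z i| +
     (be ^+ 2 * p) * `|\sum_i dev t z i ^+ 2 - t%:R * (1 - p)|))).
    apply: expect_le => z _; rewrite avg_qincr2.
    apply: (le_trans (ler_normD _ _)).
    have e1 x : `|- (2 * be * p) * x| = 2 * `|be| * p * `|x|.
      by rewrite normrM normrN !normrM (ger0_norm p0) (ger0_norm (ler0n R 2)).
    have e2 x : `|be ^+ 2 * p * x| = be ^+ 2 * p * `|x|.
      by rewrite normrM ger0_norm // mulr_ge0 ?sqr_ge0.
    by rewrite e1 e2.
  rewrite expectD !expectZ; apply: lerD; apply: ler_wpM2l => //.
    by rewrite !mulr_ge0.
  by rewrite mulr_ge0 ?sqr_ge0.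
rewrite NE /p rn2.
have -> : rn ^+ 2 * rv ^+ 2 * (2 * `|be| / rn ^+ 2 * C +
    be ^+ 2 / rn ^+ 2 * (2 * rn * rv ^+ 2)) =
    2 * C * rv ^+ 2 * `|be| + 2 * rn * rv ^+ 4 * be ^+ 2 by field; rewrite gt_eqF.
apply: (@le_trans _ _ (2 * C * rv ^+ 2 * (C / (rn * rv ^+ 2)) +
    2 * rn * rv ^+ 4 * (C / (rn ^+ 2 * rv ^+ 4)))).
  have rvk k : 0 <= rv ^+ k by rewrite exprn_ge0 // ltW.
  by rewrite lerD // ler_wpM2l // !mulr_ge0 // ltW.
have -> : 2 * C * rv ^+ 2 * (C / (rn * rv ^+ 2)) +
    2 * rn * rv ^+ 4 * (C / (rn ^+ 2 * rv ^+ 4)) = (2 * C ^+ 2 + 2 * C) / rn.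
  by field; rewrite !gt_eqF.
rewrite ler_wpM2r ?invr_ge0 ?(ltW rn0) //.
have : C <= C ^+ 2 by rewrite expr2 ler_peMl // ltW.
lra.
Qed.

Let cube_sub (x y : R) : `|x - y| ^+ 3 <= 4 * (`|x| ^+ 3 + `|y| ^+ 3).
Proof.
have h := ler_normB x y.
apply: (@le_trans _ _ ((`|x| + `|y|) ^+ 3)).
  by rewrite lerXn2r ?nnegrE ?addr_ge0.
move: (normr_ge0 x) (normr_ge0 y); set u := `|x|; set v := `|y| => u0 v0.
rewrite -subr_ge0 (_ : _ - _ = 3 * ((u + v) * (u - v) ^+ 2)); last by ring.
by rewrite mulr_ge0 // mulr_ge0 ?sqr_ge0 ?addr_ge0.
Qed.

(** The Lindeberg term: N third absolute moments together are of order nu^(-1/2). *)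
Let expect_cube t : (t <= N)%N ->
  N%:R * expect t (fun z => avg (fun i => `|qincr al be t z i| ^+ 3)) <=
  4 * C ^+ 3 * (1 + moment_bound 3) / rv.
Proof.
move=> tN; have p0 : 0 <= p by rewrite invr_ge0.
have M0 : 0 <= moment_bound 3 :> R := moment_bound_ge0 3.
apply: (@le_trans _ _ (N%:R * (4 * (p * (C / rv * (C / rv ^+ 2)) +
    (C / (rn * rv ^+ 2)) ^+ 3 * (moment_bound 3 * rv ^+ 3))))).
  rewrite ler_wpM2l //.
  apply: (@le_trans _ _ (expect t (fun z => 4 * (avg (fun i => `|al i| ^+ 3) +
     `|be| ^+ 3 * avg (fun i => `|dev t z i| ^+ 3))))).
    apply: expect_le => z _; rewrite -[X in _ <= _ * (_ + X)]avgZ -avgD -avgZ.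
    apply: avg_le => i; apply: (le_trans (cube_sub _ _)).
    by rewrite normrM exprMn.
  rewrite expectZ expectD expect_cst // expectZ ler_wpM2l // lerD //.
    rewrite /avg ler_wpM2l // (@le_trans _ _ (C / rv * \sum_i al i ^+ 2)) //.
      rewrite mulr_sumr; apply: ler_sum => i _.
      by rewrite exprS -[al i ^+ 2]real_normK ?num_real // ler_wpM2r ?exprn_ge0.
    by rewrite ler_wpM2l // divr_ge0 // ltW.
  apply: ler_pM; rewrite ?exprn_ge0 //.
  - apply: expect_ge0 => // z _; by rewrite mulr_ge0 // sumr_ge0.
  - rewrite lerXn2r ?nnegrE //.
    by rewrite divr_ge0 ?mulr_ge0 ?exprn_ge0 // ltW.
  rewrite (expect_avg n0 t (fun i z => `|dev t z i| ^+ 3)) /=.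
  rewrite -(avg_cst n0 (_ * _)); apply: avg_le => i.
  exact: expect_dev_norm3.
rewrite NE /p rn2.
have -> : rn ^+ 2 * rv ^+ 2 * (4 * ((rn ^+ 2)^-1 * (C / rv * (C / rv ^+ 2)) +
    (C / (rn * rv ^+ 2)) ^+ 3 * (moment_bound 3 * rv ^+ 3))) =
    (4 * C ^+ 2 + 4 * C ^+ 3 * moment_bound 3 / rn) / rv.
  by field; rewrite !gt_eqF.
rewrite ler_wpM2r ?invr_ge0 ?(ltW rv0) // mulrDr mulr1 lerD //.
  by rewrite ler_wpM2l // [leRHS]exprS ler_peMl ?sqr_ge0.
rewrite ler_pdivrMr // ler_peMr // !mulr_ge0 ?exprn_ge0 // ltW //.
Qed.

Let qvar_ge0 t : 0 <= qvar al be t.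
Proof.
have p1 : p <= 1 by rewrite invf_le1 ?ltr0n.
have A0 : 0 <= \sum_i al i ^+ 2 by rewrite sumr_ge0 // => i _; exact: sqr_ge0.
have p0 : 0 <= p by rewrite invr_ge0.
have tp0 : 0 <= t%:R / n%:R :> R by rewrite divr_ge0.
apply: addr_ge0; first exact: mulr_ge0.
by rewrite mulr_ge0 ?subr_ge0 // mulr_ge0 ?sqr_ge0.
Qed.

Let qvar_le t : (t <= N)%N -> qvar al be t <= 2 * C / (rn ^+ 2 * rv ^+ 2).
Proof.
move=> tN; have p0 : 0 <= p by rewrite invr_ge0.
have p1 : p <= 1 by rewrite invf_le1 ?ltr0n.
have tp0 : 0 <= t%:R / n%:R :> R by rewrite divr_ge0.
have -> : 2 * C / (rn ^+ 2 * rv ^+ 2) =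
   (rn ^+ 2)^-1 * (C / rv ^+ 2) + C / (rn ^+ 2 * rv ^+ 4) * rv ^+ 2.
  by field; rewrite !gt_eqF.
rewrite lerD // -?rn2 ?ler_wpM2l //.
apply: (@le_trans _ _ (be ^+ 2 * (t%:R / n%:R))).
  by rewrite ler_piMr ?gerBl // mulr_ge0 ?sqr_ge0.
apply: ler_pM; rewrite ?sqr_ge0 //; last by rewrite -rv2 tnu.
rewrite ler_pdivlMr ?mulr_gt0 ?exprn_gt0 // 1?mulrC ?ltr0n //.
by apply: le_trans be_bound; rewrite [in leRHS]rv2 -exprM.
Qed.

Variables (t0 s0 : R).
Hypothesis t00 : 0 < t0.

(** The clock of the telescoping: its square is t0^2 plus the variance still to come, so [T N] is t0
    and step t consumes exactly [qvar al be t]. *)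
Let T t := Num.sqrt (t0 ^+ 2 + \sum_(t <= r < N) qvar al be r).
Let t1 := Num.sqrt (t0 ^+ 2 + 2 * C).

Let S0 t : 0 <= \sum_(t <= r < N) qvar al be r.
Proof. by rewrite sumr_ge0 // => r _; exact: qvar_ge0. Qed.

Let T2 t : T t ^+ 2 = t0 ^+ 2 + \sum_(t <= r < N) qvar al be r.
Proof. by rewrite sqr_sqrtr // addr_ge0 ?sqr_ge0. Qed.

Let Tge t : t0 <= T t.
Proof. by rewrite -[leLHS]gtr0_norm // -sqrtr_sqr ler_wsqrtr // lerDl. Qed.

Let Tle t : T t <= t1.
Proof.
rewrite ler_wsqrtr // lerD2l.
have [Nt|tN] := leqP N t; first by rewrite big_geq // mulr_ge0 // ltW.
apply: (@le_trans _ _ (\sum_(t <= r < N) 2 * C / (rn ^+ 2 * rv ^+ 2))).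
  by rewrite ler_sum_nat // => r /andP[_ rN]; rewrite qvar_le // ltnW.
rewrite sumr_const_nat -[X in X <= _]mulr_natl.
have h : (N - t)%:R <= N%:R :> R by rewrite ler_nat leq_subr.
have q0 : 0 < rn ^+ 2 * rv ^+ 2 by rewrite mulr_gt0 ?exprn_gt0.
have -> : (N - t)%:R * (2 * C / (rn ^+ 2 * rv ^+ 2)) =
    2 * C * ((N - t)%:R / (rn ^+ 2 * rv ^+ 2)) by ring.
rewrite ler_piMr ?mulr_ge0 ?(ltW C0) //.
by rewrite ler_pdivrMr // mul1r -NE.
Qed.

Let TS t : (t < N)%N -> T t ^+ 2 - T t.+1 ^+ 2 = qvar al be t.
Proof. by move=> tN; rewrite !T2 (big_ltn tN); ring. Qed.

Let Tmono t : (t < N)%N -> T t.+1 <= T t.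
Proof. by move=> tN; rewrite ler_wsqrtr // lerD2l (big_ltn tN) lerDr. Qed.

Let avg_taylor (F q : 'I_n -> R) (b c d w : R) :
  avg (fun i => F i - b - q i * c - 2^-1 * (q i ^+ 2 - w) * d) =
  avg F - b - avg q * c - 2^-1 * (avg (fun i => q i ^+ 2) - w) * d.
Proof.
transitivity (avg (fun i => F i - b - c * q i - (2^-1 * d) * (q i ^+ 2 - w))).
  by apply: eq_avg => i; ring.
by rewrite 3!avgB !avgZ avgB !avg_cst //; ring.
Qed.

Lemma heat_step_sum K :
  (forall s d tau' tau, t0 <= tau' -> tau' <= tau -> tau <= t1 ->
    `|heat (s + d) tau' - heat s tau - d * heat_s s tau' -
      2^-1 * (d ^+ 2 - (tau ^+ 2 - tau' ^+ 2)) * heat_ss s tau'| <=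
    K * (`|d| ^+ 3 + (tau ^+ 2 - tau' ^+ 2) ^+ 2)) -> 0 <= K ->
  `|expect N (fun z => heat (s0 + qstat al be N z) t0) - heat s0 (T 0)| <=
  (1 / t0 + expR (t1 ^+ 2 / 2)) * (4 * C ^+ 2 / rn) +
  K * (4 * C ^+ 3 * (1 + moment_bound 3) / rv + 4 * C ^+ 2 / rv).
Proof.
move=> HK K0; pose B := 1 / t0 + expR (t1 ^+ 2 / 2).
have t01 : t0 <= t1 by exact: le_trans (Tge 0) (Tle 0).
pose f t := expect t (fun z => heat (s0 + qstat al be t z) (T t)).
have fN : expect N (fun z => heat (s0 + qstat al be N z) t0) = f N.
  by rewrite /f /T big_geq // addr0 sqrtr_sqr gtr0_norm.
have f0 : heat s0 (T 0) = f 0%N.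
  rewrite /f /= /qstat mul0r subr0 !big1 ?mulr0 ?subr0 ?addr0 // => i _.
    by rewrite /dev mul0r subrr expr0n.
  by rewrite mulr0.
rewrite fN f0.
have N0 : 0 < N%:R :> R by rewrite NE mulr_gt0 ?exprn_gt0.
pose e := B * (4 * C ^+ 2 / rn) + K * (4 * C ^+ 3 * (1 + moment_bound 3) / rv + 4 * C ^+ 2 / rv).
(* Every step costs at most e / N, which is why the preceding estimates carry a factor N. *)
have step t : (t < N)%N -> `|f t.+1 - f t| <= e / N%:R.
  move=> tN; rewrite ler_pdivlMr // mulrC.
  have tN' := ltnW tN.
  set w := qvar al be t.
  have BB s : `|heat_ss s (T t.+1)| <= B.
    by apply: (heat_ss_bound t0 t1 t00) => //; rewrite Tge Tle.
  have B0 : 0 <= B := le_trans (normr_ge0 _) (BB 0).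
  apply: (@le_trans _ _ (N%:R * expect t (fun z =>
      B * `|avg (fun i => qincr al be t z i ^+ 2) - w| +
      K * (avg (fun i => `|qincr al be t z i| ^+ 3) + w ^+ 2)))).
    rewrite ler_wpM2l // /f /= -expectB.
    apply: (le_trans (ler_norm_expect n0 _ _)); apply: expect_le => z zt.
    set s := s0 + qstat al be t z.
    pose rem i := heat (s + qincr al be t z i) (T t.+1) - heat s (T t) -
      qincr al be t z i * heat_s s (T t.+1) -
      2^-1 * (qincr al be t z i ^+ 2 - w) * heat_ss s (T t.+1).
    have -> : avg (fun i => heat (s0 + qstat al be t.+1 (place i z)) (T t.+1)) -
       heat s (T t) = avg rem + 2^-1 * (avg (fun i => qincr al be t z i ^+ 2) - w) *
         heat_ss s (T t.+1).
      (* Averaged over the bins, the linear term vanishes by the martingale property, and the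
         quadratic one leaves the conditional variance minus [w]. *)
      rewrite /rem (avg_taylor (fun i => heat (s + qincr al be t z i) (T t.+1))).
      rewrite avg_qincr //.
      rewrite (@eq_avg R n _ (fun i => heat (s + qincr al be t z i) (T t.+1))).
        by ring.
      by move=> i; rewrite qstatS // addrA.
    rewrite [leRHS]addrC; apply: (le_trans (ler_normD _ _)); apply: lerD.
      rewrite -(avg_cst n0 (w ^+ 2)) -avgD -avgZ ler_norml.
      have rb i : `|rem i| <= K * (`|qincr al be t z i| ^+ 3 + w ^+ 2).
        rewrite /rem /w -TS //; apply: HK => //; [exact: Tmono].
      apply/andP; split.
        rewrite lerNl -[leLHS]mulN1r -avgZ; apply: avg_le => i.
        by have := rb i; rewrite ler_norml => /andP[]; lra.
      apply: avg_le => i.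
      by have := rb i; rewrite ler_norml => /andP[]; lra.
    rewrite !normrM [`|2^-1|]ger0_norm ?invr_ge0 // mulrC.
    rewrite mulrA ler_wpM2r //; have := BB s; lra.
  rewrite expectD !expectZ expectD expect_cst // mulrDr /e.
  rewrite ![N%:R * (_ * _)]mulrCA mulrDr; apply: lerD.
    by rewrite ler_wpM2l // expect_norm_var.
  rewrite ler_wpM2l //; apply: lerD; first exact: expect_cube.
  have w0 : 0 <= w := qvar_ge0 t.
  apply: (@le_trans _ _ (N%:R * (2 * C / (rn ^+ 2 * rv ^+ 2)) ^+ 2)).
    by rewrite ler_wpM2l // lerXn2r ?nnegrE ?(le_trans w0) ?qvar_le.
  rewrite NE.
  have -> : rn ^+ 2 * rv ^+ 2 * (2 * C / (rn ^+ 2 * rv ^+ 2)) ^+ 2 =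
    4 * C ^+ 2 / rv * (rn ^+ 2 * rv)^-1 by field; rewrite !gt_eqF.
  have c0 : 0 <= 4 * C ^+ 2 / rv by rewrite divr_ge0 ?(ltW rv0) // mulr_ge0 ?sqr_ge0.
  have c1 : 0 < rn ^+ 2 * rv by rewrite mulr_gt0 ?exprn_gt0.
  rewrite ler_piMr // invf_le1 // -[leLHS]mulr1 ler_pM //.
  by rewrite exprn_ege1.
have -> : f N - f 0%N = \sum_(0 <= t < N) (f t.+1 - f t) by rewrite telescope_sumr.
apply: (le_trans (ler_norm_sum _ _ _)).
apply: (@le_trans _ _ (\sum_(0 <= t < N) e / N%:R)).
  by apply: ler_sum_nat => t /andP[_ tN]; exact: step.
rewrite sumr_const_nat subn0 -[leLHS]mulr_natl mulrCA divff ?mulr1 //.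
by rewrite gt_eqF.
Qed.

End CentralLimit.

(** * The mean of the log-likelihood ratio *)

Section LogSum.
Context {R : realType}.

(* An approximate antidifference of s |-> E ln (s + x), where x is a centred
   binomial variable of mean nu: the integrals of ln s and of the second-order
   term - nu / (2 s^2), and the Euler-Maclaurin correction ln s / 2.  The terms of
   order nu^-2 cancel because 5/6 - 3/4 = 1/12. *)
Definition logsum (nu s : R) : R := s * ln s - s + ln s / 2 + nu / (2 * s).

(** With q = 1/s and r = nu/s, the coefficient of q^2 is 5/6 r - 3/4 r^2 - 1/12, which vanishes at r
    = 1 and is at most 2/3 (1 - r). Moreover q^3 <= (1 - r) q^2 because s - nu >= 1. The slack 2 (s
    - nu) / nu^3 absorbs both. *)
Lemma logsum_incr (nu s : R) : 1 <= nu -> nu + 1 <= s ->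
  ln s - nu / (2 * s ^+ 2) + nu / (3 * s ^+ 3) - 3 * nu ^+ 2 / (4 * s ^+ 4) <=
  logsum nu s - logsum nu (s - 1) + 2 * (s - nu) / nu ^+ 3.
Proof.
move=> nu1 nus; have s2 : 2 <= s by lra.
have s0 : 0 < s by lra.
have nu0 : 0 < nu by lra.
have s10 : 0 < s - 1 by lra.
pose q := s^-1; pose r := nu * q.
have q0 : 0 < q by rewrite invr_gt0.
have q1 : q < 1 by rewrite invf_lt1 //; lra.
have sq : s * q = 1 by rewrite divff // gt_eqF.
have r0 : 0 < r by rewrite mulr_gt0.
have qr : q <= 1 - r.
  have -> : 1 - r = (s - nu) * q by rewrite mulrBl sq.
  by rewrite ler_peMl ?(ltW q0) //; lra.
have lns1 : ln (s - 1) = ln s + ln (1 - q).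
  rewrite -lnM ?posrE ?subr_gt0 //; congr ln; rewrite mulrBr sq; ring.
have lq := ln1D_le3 (- q) _; have {lq} : ln (1 - q) <= - q - q ^+ 2 / 2 - q ^+ 3 / 3.
  by apply: (le_trans (lq _)); [lra|rewrite le_eqVlt; apply/orP; left; apply/eqP; ring].
move=> lq.
have GE : logsum nu s - logsum nu (s - 1) = ln s - 1 - (s - 2^-1) * ln (1 - q) - r / (2 * (s - 1)).
  by rewrite /logsum lns1 /r /q; field; apply/andP; split; apply/eqP; lra.
have h1 : 1 + q ^+ 2 / 12 - q ^+ 3 / 6 <= - ((s - 2^-1) * ln (1 - q)).
  have -> : 1 + q ^+ 2 / 12 - q ^+ 3 / 6 =
     (s - 2^-1) * (q + q ^+ 2 / 2 + q ^+ 3 / 3).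
    transitivity (s * q * (1 + q / 2 + q ^+ 2 / 3) - 2^-1 * (q + q ^+ 2 / 2 + q ^+ 3 / 3)).
      by rewrite sq; field.
    by field.
  by rewrite -mulrN ler_wpM2l; lra.
have h2 : r / (2 * (s - 1)) <= r * q / 2 + r * q ^+ 2 / 2 + q ^+ 3 / 2.
  have -> : r / (2 * (s - 1)) =
      r * q / 2 + r * q ^+ 2 / 2 + q ^+ 3 / 2 * (nu / (s - 1)).
    by rewrite /r /q; field; apply/andP; split; apply/eqP; lra.
  rewrite lerD2l ler_piMr //; first by rewrite mulr_ge0 ?exprn_ge0 // ltW.
  by rewrite ler_pdivrMr // mul1r; lra.
have h3 : 4 / 3 * ((1 - r) * q ^+ 2) <= 2 * (s - nu) / nu ^+ 3.
  have -> : 4 / 3 * ((1 - r) * q ^+ 2) = 4 / 3 * (s - nu) / s ^+ 3.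
    by rewrite /r /q; field; apply/eqP; lra.
  rewrite ler_pM ?mulr_ge0 ?invr_ge0 ?exprn_ge0 ?subr_ge0 //; try lra.
  by rewrite lef_pV2 ?posrE ?exprn_gt0 // lerXn2r ?nnegrE //; lra.
have e1 : nu / (2 * s ^+ 2) = r * q / 2 by rewrite /r /q; field; apply/eqP; lra.
have e2 : nu / (3 * s ^+ 3) = r * q ^+ 2 / 3 by rewrite /r /q; field; apply/eqP; lra.
have e3 : 3 * nu ^+ 2 / (4 * s ^+ 4) = 3 / 4 * (r ^+ 2 * q ^+ 2).
  by rewrite /r /q; field; apply/eqP; lra.
rewrite GE e1 e2 e3.
have h4 : q ^+ 3 <= (1 - r) * q ^+ 2.
  by rewrite exprS ler_wpM2r ?sqr_ge0.
have h5 : 0 <= (1 - r) ^+ 2 * q ^+ 2 by rewrite mulr_ge0 ?sqr_ge0.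
have h5' : (1 - r) ^+ 2 * q ^+ 2 = q ^+ 2 - 2 * (r * q ^+ 2) + r ^+ 2 * q ^+ 2 by ring.
have h4' : (1 - r) * q ^+ 2 = q ^+ 2 - r * q ^+ 2 by ring.
rewrite h4' in h4 h3; rewrite h5' in h5.
lra.
Qed.

End LogSum.

Section LogRatio.
Context {R : realType} {n : nat}.
Hypothesis n0 : (0 < n)%N.
Variables (a : 'I_n -> nat) (N : nat).
Let nu : R := N%:R / n%:R.
Hypothesis nu1 : 1 <= nu.
Let nu0 : 0 < nu. Proof. exact: lt_le_trans nu1. Qed.
Let p : R := n%:R^-1.
Let nz : n%:R != 0 :> R. Proof. by rewrite pnatr_eq0 -lt0n. Qed.

Lemma ln_prod (I : finType) (P : pred I) (F : I -> R) : (forall i, 0 < F i) ->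
  ln (\prod_(i | P i) F i) = \sum_(i | P i) ln (F i).
Proof.
move=> F0; apply: (@proj2 (0 < \prod_(i | P i) F i)).
apply: (big_rec2 (fun x y => 0 < x /\ ln x = y)).
  by rewrite ltr01 ln1.
move=> i y x _ [x0 <-]; split; first by rewrite mulr_gt0.
by rewrite lnM ?posrE.
Qed.

Definition log_ratio (y : 'I_n -> nat) : R :=
  \sum_i \sum_(j < a i) ln (y i + j.+1)%:R -
  \sum_(t < balls a) ln ((N + t.+1)%:R / n%:R).

Lemma log_ratioE y : log_ratio y = - ln (inv_ratio a N y).
Proof.
rewrite /inv_ratio /log_ratio ln_div ?posrE.
- rewrite ln_prod => [|t]; last by rewrite divr_gt0 ?ltr0n ?addnS.
  rewrite ln_prod => [|i].
    rewrite opprB; congr (_ - _); apply: eq_bigr => i _; rewrite ln_prod // => j.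
  by apply: prodr_gt0 => j _; rewrite ltr0n addnS.
- by apply: prodr_gt0 => t _; rewrite divr_gt0 ?ltr0n ?addnS.
- by apply: prodr_gt0 => i _; apply: prodr_gt0 => j _; rewrite ltr0n addnS.
Qed.

Lemma expect_ln_shift i (s : R) : nu <= s ->
  (forall y : 'I_n -> nat, 0 < s + dev N y i) ->
  expect N (fun y => ln (s + dev N y i)) <=
  ln s - nu / (2 * s ^+ 2) + nu / (3 * s ^+ 3) - 3 * nu ^+ 2 / (4 * s ^+ 4) +
  (3 * p / nu + moment_bound 5 / (nu ^+ 2 * Num.sqrt nu)).
Proof.
move=> nus spos; have s0 : 0 < s by exact: lt_le_trans nus.
have p0 : 0 <= p by rewrite invr_ge0.
have p1 : p <= 1 by rewrite invf_le1 ?ltr0n // ler1n.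
have Np : N%:R * p = nu by [].
have nup : nu * p <= nu ^+ 2.
  by rewrite expr2 ler_wpM2l ?(ltW nu0) // (le_trans p1).
have m2 := expect_dev2 n0 N i; have m3 := expect_dev3 n0 N i.
have m4 := expect_dev4 n0 N i.
rewrite -/p in m2 m3 m4.
(* The cubic term enters with a plus sign and needs an upper bound, the quartic with a minus sign
   and needs a lower one. *)
have m3le : expect N (fun y => dev N y i ^+ 3) <= nu.
  rewrite m3; have -> : N%:R * (p * (1 - p) * (1 - 2 * p)) =
    nu * ((1 - p) * (1 - 2 * p)) by rewrite -Np; ring.
  by rewrite ler_piMr ?(ltW nu0) //; nra.
have m4ge : 3 * nu ^+ 2 - 9 * p * nu ^+ 2 <= expect N (fun y => dev N y i ^+ 4).
  rewrite m4.
  have -> : 3 * (N%:R * (N%:R - 1)) * (p * (1 - p)) ^+ 2 +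
     N%:R * (p * (1 - p) * (1 - 3 * p + 3 * p ^+ 2)) =
     3 * (nu ^+ 2 - nu * p) * (1 - p) ^+ 2 + nu * ((1 - p) * (1 - 3 * p + 3 * p ^+ 2)).
    by rewrite -Np; ring.
  have h1 : 0 <= nu * ((1 - p) * (1 - 3 * p + 3 * p ^+ 2)).
    by rewrite mulr_ge0 ?(ltW nu0) // mulr_ge0 ?subr_ge0 //; have := sqr_ge0 (2 * p - 1); nra.
  have h2 : (nu ^+ 2 - nu * p) * (1 - 2 * p) <= (nu ^+ 2 - nu * p) * (1 - p) ^+ 2.
    by rewrite ler_wpM2l ?subr_ge0 //; nra.
  have h3 : nu * p <= p * nu ^+ 2.
    by rewrite mulrC expr2 ler_wpM2l // ler_peMl // ltW.
  have h4 : 0 <= nu * p * p by rewrite !mulr_ge0 // ltW.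
  nra.
have rv0 : 0 < Num.sqrt nu by rewrite sqrtr_gt0.
have m5le : expect N (fun y => dev N y i ^+ 5) <= moment_bound 5 * Num.sqrt nu ^+ 5.
  have h := expect_dev_bound n0 nu N i 5 nu1 (lexx _).
  rewrite mulrC -ler_pdivrMl ?exprn_gt0 //; apply: le_trans h.
  rewrite -expectZ; apply: expect_le => y _.
  apply: (@le_trans _ _ ((`|dev N y i| / Num.sqrt nu) ^+ 5)).
    rewrite -exprVn mulrC exprMn ler_wpM2r ?exprn_ge0 ?invr_ge0 ?(ltW rv0) //.
    by rewrite -normrX ler_norm.
  have d0 : 0 <= `|dev N y i| / Num.sqrt nu by rewrite divr_ge0 // ltW.
  by rewrite lerXn2r ?nnegrE ?addr_ge0 // lerDr.
apply: (@le_trans _ _ (expect N (fun y => ln s + (s^-1 * dev N y i -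
   ((2 * s ^+ 2)^-1 * dev N y i ^+ 2 - ((3 * s ^+ 3)^-1 * dev N y i ^+ 3 -
   ((4 * s ^+ 4)^-1 * dev N y i ^+ 4 - (5 * s ^+ 5)^-1 * dev N y i ^+ 5))))))).
  apply: expect_le => y _; set x := dev N y i.
  have e : s + x = s * (1 + x / s) by field; rewrite gt_eqF.
  have x1 : 0 < 1 + x / s by rewrite -(pmulr_rgt0 _ s0) -e; exact: spos.
  rewrite e lnM ?posrE // lerD2l; apply: (le_trans (ln1D_le5 (x / s) _)).
    by lra.
  by rewrite le_eqVlt; apply/orP; left; apply/eqP; field; rewrite gt_eqF.
rewrite expectD expect_cst // 4!expectB !expectZ (expect_dev n0) m2.
have s2 k : nu ^+ k <= s ^+ k by rewrite lerXn2r ?nnegrE ?(ltW nu0) ?(ltW s0).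
have sk k : 0 < s ^+ k by rewrite exprn_gt0.
have nk k : 0 < nu ^+ k by rewrite exprn_gt0.
have i2 : p * nu / (2 * s ^+ 2) <= p / nu / 2.
  have -> : p * nu / (2 * s ^+ 2) = p * nu / 2 / s ^+ 2 by field; rewrite gt_eqF.
  have -> : p / nu / 2 = p * nu / 2 / nu ^+ 2 by field; rewrite gt_eqF.
  rewrite ler_wpM2l ?mulr_ge0 ?(ltW nu0) // lef_pV2 ?posrE //.
have i4 : 9 * p * nu ^+ 2 / (4 * s ^+ 4) <= 9 / 4 * (p / nu).
  have -> : 9 * p * nu ^+ 2 / (4 * s ^+ 4) = 9 / 4 * p * nu ^+ 2 / s ^+ 4.
    by field; rewrite gt_eqF.
  have -> : 9 / 4 * (p / nu) = 9 / 4 * p * nu ^+ 2 / nu ^+ 3 by field; rewrite gt_eqF.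
  rewrite ler_wpM2l ?mulr_ge0 ?(ltW (nk 2)) // ?divr_ge0 // lef_pV2 ?posrE //.
  apply: le_trans (s2 4); rewrite [leRHS]exprS ler_peMl // ltW //.
have M0 : 0 <= moment_bound 5 :> R := moment_bound_ge0 5.
have i5 : (5 * s ^+ 5)^-1 * expect N (fun y => dev N y i ^+ 5) <=
    moment_bound 5 / (nu ^+ 2 * Num.sqrt nu).
  apply: (@le_trans _ _ ((5 * s ^+ 5)^-1 * (moment_bound 5 * Num.sqrt nu ^+ 5))).
    by rewrite ler_wpM2l // invr_ge0 mulr_ge0 // ltW.
  apply: (@le_trans _ _ ((nu ^+ 5)^-1 * (moment_bound 5 * Num.sqrt nu ^+ 5))).
    rewrite ler_wpM2r ?mulr_ge0 ?exprn_ge0 ?(ltW rv0) //.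
    have s5 : 0 < 5 * s ^+ 5 by rewrite mulr_gt0.
    by rewrite lef_pV2 ?posrE //; have := s2 5; have := sk 5; lra.
  rewrite le_eqVlt; apply/orP; left; apply/eqP.
  rewrite -[in LHS](sqr_sqrtr (ltW nu0)) -[in nu ^+ 2](sqr_sqrtr (ltW nu0)).
  set r := Num.sqrt nu in rv0 *.
  by rewrite sqrtr_sqr ger0_norm ?(ltW rv0) //; field; rewrite gt_eqF.
have i3 : (3 * s ^+ 3)^-1 * expect N (fun y => dev N y i ^+ 3) <= nu / (3 * s ^+ 3).
  by rewrite mulrC ler_wpM2r // invr_ge0 mulr_ge0 // ltW.
have i4' : (3 * nu ^+ 2 - 9 * p * nu ^+ 2) / (4 * s ^+ 4) <=
    (4 * s ^+ 4)^-1 * expect N (fun y => dev N y i ^+ 4).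
  by rewrite mulrC ler_wpM2l // invr_ge0 mulr_ge0 // ltW.
have e2 : (2 * s ^+ 2)^-1 * (N%:R * (p * (1 - p))) =
    nu / (2 * s ^+ 2) - p * nu / (2 * s ^+ 2) by rewrite -Np; ring.
rewrite e2 mulr0.
rewrite mulrBl in i4'.
have pn : 0 <= p / nu by rewrite divr_ge0 // ltW.
lra.
Qed.

End LogRatio.

Section MeanLogRatio.
Context {R : realType} {n : nat}.
Hypothesis n0 : (0 < n)%N.
Variables (a : 'I_n -> nat) (N : nat) (C : R).
Let nu : R := N%:R / n%:R.
Let ab : R := (balls a)%:R / n%:R.

Definition excess (i : 'I_n) : R := (a i)%:R - (balls a)%:R / n%:R.

Let D2 : R := \sum_i excess i ^+ 2.
Hypotheses (C1 : 1 <= C) (nu1 : 1 <= nu).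
Hypothesis excess_bound : D2 <= C * nu.
Hypothesis mean_bound : n%:R * ab ^+ 2 <= C * nu ^+ 2.
Hypothesis balls_bound : (balls a)%:R <= C * nu ^+ 2.

Let rn : R := Num.sqrt n%:R.
Let rv : R := Num.sqrt nu.
Let mu : R := nu + ab.
Let nr1 : 1 <= n%:R :> R. Proof. by rewrite ler1n. Qed.
Let rn1 : 1 <= rn. Proof. by rewrite -sqrtr1 ler_wsqrtr. Qed.
Let rv1 : 1 <= rv. Proof. by rewrite -sqrtr1 ler_wsqrtr. Qed.
Let rn0 : 0 < rn. Proof. exact: lt_le_trans rn1. Qed.
Let rv0 : 0 < rv. Proof. exact: lt_le_trans rv1. Qed.
Let nu0 : 0 < nu. Proof. exact: lt_le_trans nu1. Qed.
Let C0 : 0 < C. Proof. exact: lt_le_trans C1. Qed.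
Let rn2 : n%:R = rn ^+ 2. Proof. by rewrite sqr_sqrtr. Qed.
Let rv2 : nu = rv ^+ 2. Proof. by rewrite sqr_sqrtr // ltW. Qed.
Let nz : n%:R != 0 :> R. Proof. by rewrite pnatr_eq0 -lt0n. Qed.
Let ab0 : 0 <= ab. Proof. by rewrite divr_ge0. Qed.
Let mu0 : 0 < mu. Proof. by rewrite ltr_pwDl. Qed.
Let nmu : nu <= mu. Proof. by rewrite lerDl. Qed.

Lemma sum_excess : \sum_i excess i = 0.
Proof.
rewrite sumrB sumr_const card_ord -[X in _ - X]mulr_natl.
by rewrite mulrCA mulfV // mulr1 -natr_sum subrr.
Qed.

Lemma sum_sqr : \sum_i (a i)%:R ^+ 2 = D2 + n%:R * ab ^+ 2.
Proof.
transitivity (\sum_i (excess i ^+ 2 + (2 * ab) * excess i + ab ^+ 2)).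
  by apply: eq_bigr => i _; rewrite /excess -/ab; ring.
rewrite !big_split /= -mulr_sumr sum_excess mulr0 addr0 sumr_const card_ord.
by rewrite [in RHS]mulr_natl.
Qed.

Lemma mean_ratio_le : ab / nu <= C / rn.
Proof.
rewrite ler_pdivrMr // mulrAC ler_pdivlMr //.
rewrite -(ler_pXn2r (isT : (0 < 2)%N)) ?nnegrE ?mulr_ge0 ?(ltW C0) ?(ltW nu0) ?(ltW rn0) //.
rewrite [(ab * rn) ^+ 2]exprMn [(C * nu) ^+ 2]exprMn -rn2 [leLHS]mulrC; apply: (le_trans mean_bound).
by rewrite ler_wpM2r ?sqr_ge0 // expr2 ler_peMl // ltW.
Qed.

Let H (s : R) : R := s * ln s - s.

Let H_incr (s s' : R) : 0 < s' -> s' <= s -> H s - H s' <= (s - s') * ln s.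
Proof.
move=> s'0 ss; have s0 : 0 < s by exact: lt_le_trans ss.
have h : -1 < s / s' - 1 by have : 0 < s / s' by [rewrite divr_gt0]; lra.
have := le_ln1Dx h; rewrite addrCA subrr addr0 ln_div ?posrE // => l.
have : s' * (ln s - ln s') <= s' * (s / s' - 1) by rewrite ler_wpM2l // ltW.
have -> : s' * (s / s' - 1) = s - s' by field; rewrite gt_eqF.
rewrite /H; lra.
Qed.

(** The right side is n times the Riemann sum of ln over [nu, mu] with mesh 1/n and right endpoints;
    as ln increases, the sum is at least the integral. *)
Let sum_ln_ge : n%:R * (H mu - H nu) <=
  \sum_(t < balls a) ln ((N + t.+1)%:R / n%:R).
Proof.
pose s t : R := nu + t%:R / n%:R.
have -> : H mu - H nu = \sum_(0 <= t < balls a) (H (s t.+1) - H (s t)).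
  by rewrite telescope_sumr // /s mul0r addr0.
rewrite big_mkord mulr_sumr; apply: ler_sum => t _.
have st : 0 < s t by rewrite ltr_pwDl // divr_ge0.
have e : s t.+1 - s t = n%:R^-1 by rewrite /s -natr1; field.
have ss : s t <= s t.+1 by rewrite -subr_ge0 e invr_ge0.
have -> : (N + t.+1)%:R / n%:R = s t.+1 by rewrite /s /nu natrD mulrDl.
rewrite -ler_pdivlMl ?ltr0n // mulrC -[X in _ <= _ * X]e mulrC.
by apply: H_incr.
Qed.

Let excess_le i : `|excess i| <= C * rv.
Proof.
rewrite -(ler_pXn2r (isT : (0 < 2)%N)) ?nnegrE ?mulr_ge0 ?(ltW C0) ?(ltW rv0) //.
rewrite exprMn -rv2 real_normK ?num_real //.
apply: (@le_trans _ _ (C * nu)).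
  apply: le_trans excess_bound.
  by rewrite /D2 (bigD1 i) //= lerDl sumr_ge0 // => j _; rewrite sqr_ge0.
by rewrite ler_wpM2r ?(ltW nu0) // expr2 ler_peMl // ltW.
Qed.

Let aE i : nu + (a i)%:R = mu + excess i.
Proof. by rewrite /mu /excess /ab; ring. Qed.

(** Taylor expansion at mu in v = excess / mu, where |v| <= C / sqrt(nu): (1 + v) ln(1 + v) - v is
    v^2 / 2 up to a cubic error. The term linear in the excess vanishes when summed over the
    bins. *)
Let H_excess i : H (mu + excess i) <= H mu + excess i * ln mu +
  excess i ^+ 2 / (2 * nu) + excess i ^+ 2 / nu * (C ^+ 2 / rv).
Proof.
have p0 : 0 < mu + excess i by rewrite -aE ltr_pwDl.
set d := excess i in p0 *; pose v := d / mu.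
have e : mu + d = mu * (1 + v) by rewrite /v; field; rewrite gt_eqF.
have v1 : 0 < 1 + v by rewrite -(pmulr_rgt0 _ mu0) -e.
have -> : H (mu + d) = H mu + d * ln mu + mu * ((1 + v) * ln (1 + v) - v).
  rewrite /H [in ln (mu + d)]e lnM ?posrE // e.
  have -> : d = mu * v by rewrite /v; field; rewrite gt_eqF.
  by ring.
rewrite -!addrA !lerD2l.
have av : `|v| <= C / rv.
  rewrite normrM [`|mu^-1|]ger0_norm ?invr_ge0 ?(ltW mu0) //.
  apply: (@le_trans _ _ (C * rv / nu)).
    rewrite ler_pM ?invr_ge0 ?(ltW mu0) //; first exact: excess_le.
    by rewrite lef_pV2 ?posrE.
  by rewrite rv2 le_eqVlt; apply/orP; left; apply/eqP; field; rewrite gt_eqF.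
have vv : v <= C by apply: (le_trans (ler_norm _)); apply: (le_trans av);
   rewrite ler_pdivrMr // ler_peMr // ltW.
have key : (1 + v) * ln (1 + v) - v <= v ^+ 2 / 2 + v ^+ 2 * (C ^+ 2 / rv).
  have h : (1 + v) * ln (1 + v) <= (1 + v) * (v - v ^+ 2 / 2 + v ^+ 3 / 3).
    by rewrite ler_wpM2l ?(ltW v1) // ln1D_le3 //; lra.
  have h2 : - v ^+ 3 / 6 + v ^+ 4 / 3 <= v ^+ 2 * (C ^+ 2 / rv).
    have -> : - v ^+ 3 / 6 + v ^+ 4 / 3 = v ^+ 2 * (- v / 6 + v * v / 3) by field.
    rewrite ler_wpM2l ?sqr_ge0 //.
    have n1 : - v <= C / rv by apply: le_trans av; rewrite -normrN ler_norm.
    have n2 : v * v <= C * (C / rv).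
      apply: (le_trans (ler_norm _)); rewrite normrM ler_pM //.
      by apply: (le_trans av); rewrite ler_pdivrMr // ler_peMr // ltW.
    have cr : 0 <= C / rv by rewrite divr_ge0 // ltW.
    have n3 : C / rv <= C * (C / rv) by rewrite ler_peMl.
    have -> : C ^+ 2 / rv = C * (C / rv) by rewrite expr2 mulrA.
    lra.
  have e2 : (1 + v) * (v - v ^+ 2 / 2 + v ^+ 3 / 3) =
     v + v ^+ 2 / 2 + (- v ^+ 3 / 6 + v ^+ 4 / 3) by field.
  lra.
apply: (@le_trans _ _ (mu * (v ^+ 2 / 2 + v ^+ 2 * (C ^+ 2 / rv)))).
  by rewrite ler_wpM2l // ltW.
have -> : mu * (v ^+ 2 / 2 + v ^+ 2 * (C ^+ 2 / rv)) =
    d ^+ 2 / 2 / mu + d ^+ 2 * (C ^+ 2 / rv) / mu by rewrite /v; field; rewrite !gt_eqF.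
have -> : d ^+ 2 / (2 * nu) + d ^+ 2 / nu * (C ^+ 2 / rv) =
    d ^+ 2 / 2 / nu + d ^+ 2 * (C ^+ 2 / rv) / nu by field; rewrite !gt_eqF.
have im : mu^-1 <= nu^-1 by rewrite lef_pV2 ?posrE.
have d2 := sqr_ge0 d.
have cr : 0 <= C ^+ 2 / rv by rewrite divr_ge0 ?sqr_ge0 // ltW.
by apply: lerD; rewrite ler_wpM2l // mulr_ge0.
Qed.

(** The corrections ln s / 2 and nu / (2s) in [logsum] have opposite slopes at s = nu, so together
    they contribute only a quadratic term. It yields the part of the mean due to k / n. *)
Let logsum_diff i : logsum nu (nu + (a i)%:R) - logsum nu nu <=
  H (nu + (a i)%:R) - H nu + (a i)%:R ^+ 2 / (4 * nu ^+ 2).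
Proof.
set x := (a i)%:R; have x0 : 0 <= x by rewrite /x.
have e0 : 0 <= x / nu by rewrite divr_ge0 // ltW.
have h := ln1D_sub_le _ e0.
have e : nu + x = nu * (1 + x / nu) by field; rewrite gt_eqF.
have l : ln (nu + x) = ln nu + ln (1 + x / nu) by rewrite e lnM ?posrE // ltr_pwDl.
have e1 : nu / (2 * (nu + x)) = 2^-1 - (x / nu) / (1 + x / nu) / 2.
  by field; rewrite !gt_eqF // ltr_pwDl.
have e2 : nu / (2 * nu) = 2^-1 by field; rewrite gt_eqF.
have e3 : x ^+ 2 / (4 * nu ^+ 2) = (x / nu) ^+ 2 / 4 by field; rewrite gt_eqF.
rewrite /logsum /H e1 e2 e3.
have : ln (nu + x) / 2 = ln nu / 2 + ln (1 + x / nu) / 2 by rewrite l mulrDl.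
lra.
Qed.

Let err : R := 3 * n%:R^-1 / nu + moment_bound 5 / (nu ^+ 2 * rv).

Let bin_bound i : expect N (fun y : 'I_n -> nat => \sum_(j < a i) ln (y i + j.+1)%:R) <=
  logsum nu (nu + (a i)%:R) - logsum nu nu + 2 * (a i)%:R ^+ 2 / nu ^+ 3 +
  (a i)%:R * err.
Proof.
rewrite expect_sum //.
apply: (@le_trans _ _ (\sum_(0 <= j < a i) ((logsum nu (nu + j.+1%:R) -
    logsum nu (nu + j%:R)) + (2 * (a i)%:R / nu ^+ 3 + err)))); last first.
  rewrite big_split /= telescope_sumr // addr0 sumr_const_nat subn0.
  rewrite -[X in _ + X <= _]mulr_natl -[leRHS]addrA lerD2l mulrDr lerD2r.
  by rewrite le_eqVlt; apply/orP; left; apply/eqP; field; rewrite gt_eqF.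
rewrite big_mkord; apply: ler_sum => j _.
pose s := nu + j.+1%:R.
have sj : s - 1 = nu + j%:R by rewrite /s -natr1; ring.
have j1 : 1 <= j.+1%:R :> R by rewrite ler1n.
have yE (y : 'I_n -> nat) : (y i + j.+1)%:R = s + dev N y i.
  by rewrite /s /dev -/nu natrD; ring.
have nus : nu <= s by rewrite /s; lra.
rewrite (@eq_expect R n N _ (fun y => ln (s + dev N y i))); last first.
  by move=> y _; rewrite yE.
have spos (y : 'I_n -> nat) : 0 < s + dev N y i by rewrite -yE ltr0n addnS.
have h1 := expect_ln_shift n0 N nu1 i s nus spos.
have nus1 : nu + 1 <= s by rewrite /s; lra.
have h2 := logsum_incr nu s nu1 nus1.
rewrite sj in h2.
have h3 : 2 * (s - nu) / nu ^+ 3 <= 2 * (a i)%:R / nu ^+ 3.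
  rewrite ler_wpM2r ?invr_ge0 ?exprn_ge0 ?(ltW nu0) // ler_wpM2l //.
  have -> : s - nu = j.+1%:R by rewrite /s; ring.
  by rewrite ler_nat.
rewrite -/(s) /err.
move: h1 h2 h3; rewrite -/rv -/nu; lra.
Qed.

(** The bulk n (H mu - H nu) of the bins cancels against the normalising product through
    [sum_ln_ge]. The sum of a_i^2 is D2 + n (k/n)^2, and divided by 4 nu^2 only its second part
    survives. The two main terms amount to half the limiting variance. *)
Lemma expect_log_ratio : expect N (log_ratio a N) <=
  D2 / (2 * nu) + n%:R * ab ^+ 2 / (4 * nu ^+ 2) +
  16 * C ^+ 3 * (1 + moment_bound 5) * (rn^-1 + rv^-1).
Proof.
have M0 : 0 <= moment_bound 5 :> R := moment_bound_ge0 5.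
rewrite expectB expect_cst // expect_sum //.
apply: (@le_trans _ _ (\sum_i (H mu - H nu + ln mu * excess i +
   (2^-1 / nu + nu^-1 * (C ^+ 2 / rv)) * excess i ^+ 2 +
   (1 / (4 * nu ^+ 2) + 2 / nu ^+ 3) * (a i)%:R ^+ 2 + err * (a i)%:R) -
   n%:R * (H mu - H nu))).
  apply: lerB => //; apply: ler_sum => i _.
  have h1 := bin_bound i; have h2 := logsum_diff i; have h3 := H_excess i.
  rewrite aE in h1 h2.
  have -> : (1 / (4 * nu ^+ 2) + 2 / nu ^+ 3) * (a i)%:R ^+ 2 =
    (a i)%:R ^+ 2 / (4 * nu ^+ 2) + 2 * (a i)%:R ^+ 2 / nu ^+ 3 by ring.
  have -> : (2^-1 / nu + nu^-1 * (C ^+ 2 / rv)) * excess i ^+ 2 =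
     excess i ^+ 2 / (2 * nu) + excess i ^+ 2 / nu * (C ^+ 2 / rv).
    by field; rewrite !gt_eqF.
  lra.
move: (H mu - H nu) => hh.
rewrite !big_split /= sumr_const card_ord -[X in X + _ + _ + _ + _]mulr_natl.
rewrite -!mulr_sumr sum_excess sum_sqr -/D2 -natr_sum -[(\sum_i _)%N]/(balls a).
rewrite mulr0 addr0.
have i1 : 0 < nu^-1 by rewrite invr_gt0.
have iv : 0 < rv^-1 by rewrite invr_gt0.
have inn : 0 < rn^-1 by rewrite invr_gt0.
have b1 : D2 * nu^-1 <= C by rewrite ler_pdivrMr.
have D20 : 0 <= D2 by rewrite sumr_ge0 // => i _; exact: sqr_ge0.
have iv1 : rv^-1 <= 1 by rewrite invf_le1.
have ivv : nu^-1 = rv^-1 * rv^-1 by rewrite rv2 expr2 invfM.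
have ivle : nu^-1 <= rv^-1 by rewrite ivv ler_piMr // ltW.
have t1 : D2 * nu^-1 * (C ^+ 2 / rv) <= C ^+ 3 * rv^-1.
  have -> : C ^+ 3 * rv^-1 = C * (C ^+ 2 / rv) by ring.
  by rewrite ler_wpM2r // divr_ge0 ?sqr_ge0 // ltW.
have t2 : D2 / (4 * nu ^+ 2) <= C * rv^-1.
  have -> : D2 / (4 * nu ^+ 2) = (D2 * nu^-1) * (nu^-1 / 4) by field; rewrite gt_eqF.
  rewrite ler_pM ?mulr_ge0 ?(ltW i1) //; lra.
have t3 : 2 / nu ^+ 3 * (D2 + n%:R * ab ^+ 2) <= 4 * C * rv^-1.
  have -> : 2 / nu ^+ 3 * (D2 + n%:R * ab ^+ 2) = 2 * nu^-1 * (D2 * nu^-1 * nu^-1 +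
     n%:R * ab ^+ 2 / nu ^+ 2) by field; rewrite gt_eqF.
  have -> : 4 * C * rv^-1 = 2 * rv^-1 * (C + C) by ring.
  have q0 : 0 <= 2 * nu^-1 by rewrite mulr_ge0 ?(ltW i1).
  have q1 : 0 <= D2 * nu^-1 * nu^-1 by rewrite !mulr_ge0 ?(ltW i1).
  have q2 : 0 <= n%:R * ab ^+ 2 / nu ^+ 2 by rewrite divr_ge0 ?sqr_ge0 ?mulr_ge0 ?sqr_ge0.
  apply: ler_pM => //; [exact: addr_ge0|by rewrite ler_wpM2l|].
  rewrite lerD //; last by rewrite ler_pdivrMr ?exprn_gt0.
  apply: le_trans b1; rewrite ler_piMr ?mulr_ge0 ?(ltW i1) //; lra.
have t4 : err * (balls a)%:R <= 3 * C * rn^-1 + moment_bound 5 * C * rv^-1.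
  have -> : err * (balls a)%:R = 3 * (ab / nu) +
    moment_bound 5 * ((balls a)%:R / nu ^+ 2) / rv.
    by rewrite /err /ab; field; rewrite nz !gt_eqF.
  rewrite lerD //; first by have := mean_ratio_le; lra.
  by rewrite ler_wpM2r ?(ltW iv) // ler_wpM2l // ler_pdivrMr ?exprn_gt0.
have C3 : C <= C ^+ 3 by rewrite exprS ler_peMr ?(ltW C0) // exprn_ege1.
have cc1 : C * rv^-1 <= C ^+ 3 * rv^-1 by rewrite ler_wpM2r // ltW.
have cc2 : C * rn^-1 <= C ^+ 3 * rn^-1 by rewrite ler_wpM2r // ltW.
have cc3 : moment_bound 5 * C * rv^-1 <= moment_bound 5 * C ^+ 3 * rv^-1.
  by rewrite ler_wpM2r ?(ltW iv) // ler_wpM2l.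
have pos1 : 0 <= C ^+ 3 * rv^-1 by rewrite mulr_ge0 ?exprn_ge0 // ltW.
have pos2 : 0 <= C ^+ 3 * rn^-1 by rewrite mulr_ge0 ?exprn_ge0 // ltW.
have pos3 : 0 <= moment_bound 5 * C ^+ 3 * rv^-1 by rewrite !mulr_ge0 ?exprn_ge0 // ltW.
have pos4 : 0 <= moment_bound 5 * C ^+ 3 * rn^-1 by rewrite !mulr_ge0 ?exprn_ge0 // ltW.
have -> : 16 * C ^+ 3 * (1 + moment_bound 5) * (rn^-1 + rv^-1) =
  16 * (C ^+ 3 * rv^-1) + 16 * (C ^+ 3 * rn^-1) + 16 * (moment_bound 5 * C ^+ 3 * rv^-1)
  + 16 * (moment_bound 5 * C ^+ 3 * rn^-1) by ring.
have -> : (2^-1 / nu + nu^-1 * (C ^+ 2 / rv)) * D2 =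
   D2 / (2 * nu) + D2 * nu^-1 * (C ^+ 2 / rv) by field; rewrite !gt_eqF.
have -> : (1 / (4 * nu ^+ 2) + 2 / nu ^+ 3) * (D2 + n%:R * ab ^+ 2) =
  D2 / (4 * nu ^+ 2) + n%:R * ab ^+ 2 / (4 * nu ^+ 2) +
  2 / nu ^+ 3 * (D2 + n%:R * ab ^+ 2) by ring.
lra.
Qed.

End MeanLogRatio.

(** * The fluctuations of the log-likelihood ratio *)

Section QuadraticApproximation.
Context {R : realType} {n : nat}.
Hypothesis n0 : (0 < n)%N.
Variables (a : 'I_n -> nat) (N : nat) (C : R).
Let nu : R := N%:R / n%:R.
Let ab : R := (balls a)%:R / n%:R.
Let D2 : R := \sum_i excess a i ^+ 2.
Hypotheses (C1 : 1 <= C :> R) (nu1 : 1 <= nu :> R).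
Hypothesis excess_bound : D2 <= C * nu.
Hypothesis mean_bound : n%:R * ab ^+ 2 <= C * nu ^+ 2.

Definition lin_coef (i : 'I_n) : R := excess a i / (N%:R / n%:R).

Definition quad_coef : R := (balls a)%:R / n%:R / (N%:R / n%:R) ^+ 2.

Let rn : R := Num.sqrt n%:R.
Let rv : R := Num.sqrt nu.
Let mu : R := nu + ab.
Let p : R := n%:R^-1.
Let nr1 : 1 <= n%:R :> R. Proof. by rewrite ler1n. Qed.
Let rn1 : 1 <= rn. Proof. by rewrite -sqrtr1 ler_wsqrtr. Qed.
Let rv1 : 1 <= rv. Proof. by rewrite -sqrtr1 ler_wsqrtr. Qed.
Let rn0 : 0 < rn. Proof. exact: lt_le_trans rn1. Qed.
Let rv0 : 0 < rv. Proof. exact: lt_le_trans rv1. Qed.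
Let nu0 : 0 < nu. Proof. exact: lt_le_trans nu1. Qed.
Let C0 : 0 < C. Proof. exact: lt_le_trans C1. Qed.
Let rn2 : n%:R = rn ^+ 2. Proof. by rewrite sqr_sqrtr. Qed.
Let rv2 : nu = rv ^+ 2. Proof. by rewrite sqr_sqrtr // ltW. Qed.
Let nz : n%:R != 0 :> R. Proof. by rewrite pnatr_eq0 -lt0n. Qed.
Let ab0 : 0 <= ab. Proof. by rewrite divr_ge0. Qed.
Let mu0 : 0 < mu. Proof. by rewrite ltr_pwDl. Qed.
Let nmu : nu <= mu. Proof. by rewrite lerDl. Qed.
Let eps : R := ab / nu.
Let eps0 : 0 <= eps. Proof. by rewrite divr_ge0 // ltW. Qed.
Let epsC : eps <= C / rn. Proof. exact: mean_ratio_le. Qed.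
Let epsC1 : eps <= C.
Proof. by apply: (le_trans epsC); rewrite ler_pdivrMr // ler_peMr // ltW. Qed.

Lemma sum_lin_coef : \sum_i lin_coef i = 0.
Proof. by rewrite -mulr_suml (sum_excess n0) mul0r. Qed.

Lemma log_ratio_place i z : log_ratio a N (place i z) - log_ratio a N z =
  ln ((z i).+1 + a i)%:R - ln (z i).+1%:R :> R.
Proof.
rewrite /log_ratio opprB addrA subrK -sumrB.
rewrite (bigD1 i) //= [X in _ + X]big1 => [|j ji]; last first.
  by rewrite /place (negbTE ji) addn0 subrr.
rewrite addr0 /place eqxx addn1 -sumrB.
have -> : ln ((z i).+1 + a i)%:R - ln (z i).+1%:R =
  \sum_(0 <= j < a i) (ln ((z i).+1 + j.+1)%:R - ln ((z i).+1 + j)%:R) :> R.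
  by rewrite telescope_sumr // addn0.
by rewrite big_mkord; apply: eq_bigr => j _; rewrite -[(z i + j.+1)%N]addSnnS.
Qed.

Let excess_le i : `|excess a i| <= C * rv.
Proof.
rewrite -(ler_pXn2r (isT : (0 < 2)%N)) ?nnegrE ?mulr_ge0 ?(ltW C0) ?(ltW rv0) //.
rewrite [(C * rv) ^+ 2]exprMn -rv2 real_normK ?num_real //.
apply: (@le_trans _ _ (C * nu)).
  apply: le_trans excess_bound.
  by rewrite /D2 (bigD1 i) //= lerDl sumr_ge0 // => j _; rewrite sqr_ge0.
by rewrite ler_wpM2r ?(ltW nu0) // expr2 ler_peMl // ltW.
Qed.

Let eta : R := rv^-1 + rn^-1.

(** The part of the increment of M common to all bins; Efron-Stein discards it. *)
Let kappa : R := ln mu - ln nu - quad_coef * (1 - p).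

Let N0 : (0 < N)%N.
Proof.
rewrite lt0n; apply/eqP => N0; move: nu1; rewrite /nu N0 mul0r.
by rewrite ler10.
Qed.

(** With Z = nu (1 + X) and Z + a_i = mu (1 + Y), the increment is ln(1 + Y) - ln(1 + X) up to a
    constant, hence close to Y - X, which is the linear increment up to products of small
    quantities. Of the four powers of [xi], one comes from Y - X, one from |X| + |Y| and two from
    the denominators 1 + X and 1 + Y. *)
Let incr_bound (z : 'I_n -> nat) i :
  `|ln ((z i).+1 + a i)%:R - ln (z i).+1%:R - qincr lin_coef quad_coef N.-1 z i
    - kappa| <=
  36 * C ^+ 3 * (1 + `|dev N.-1 z i| / rv) ^+ 4 *
    ((`|excess a i| / rv + eps) * (eta / rv)).
Proof.
set x := dev N.-1 z i; set xi := 1 + `|x| / rv; set d := excess a i.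
pose Z : R := (z i).+1%:R; pose x' := x + 1 - p.
have Z1 : 1 <= Z by rewrite /Z ler1n.
have Z0 : 0 < Z by exact: lt_le_trans Z1.
have A0 : 0 <= (a i)%:R :> R by [].
have NE : N%:R = N.-1%:R + 1 :> R by rewrite natr1 prednK.
have ZE : Z = nu + x'.
  by rewrite /Z /x' /x /dev /nu NE /p -natr1; ring.
have ZaE : Z + (a i)%:R = mu + x' + d by rewrite ZE /mu /d /excess -/ab; ring.
pose X := x' / nu; pose Y := (x' + d) / mu.
have XE : 1 + X = Z / nu by rewrite ZE /X; field; rewrite gt_eqF.
have YE : 1 + Y = (Z + (a i)%:R) / mu by rewrite ZaE /Y; field; rewrite gt_eqF.
have Za0 : 0 < Z + (a i)%:R by rewrite ltr_pwDl.
have X1 : 0 < 1 + X by rewrite XE divr_gt0.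
have Y1 : 0 < 1 + Y by rewrite YE divr_gt0.
have YX : Y - X = d / mu - x' * ab / (mu * nu).
  by rewrite /Y /X /mu; field; rewrite -/mu !gt_eqF.
have -> : ln ((z i).+1 + a i)%:R - ln (z i).+1%:R -
    qincr lin_coef quad_coef N.-1 z i - kappa =
    (ln (1 + Y) - ln (1 + X) - (Y - X)) +
    (x' * ab ^+ 2 / (mu * nu ^+ 2) - d * ab / (mu * nu)).
  have LX : ln (1 + X) = ln Z - ln nu by rewrite XE ln_div ?posrE.
  have LY : ln (1 + Y) = ln (Z + (a i)%:R) - ln mu by rewrite YE ln_div ?posrE.
  rewrite natrD -/Z LX LY YX /qincr -/x /kappa /lin_coef /quad_coef.
  rewrite -/d -/ab -/nu (_ : x = x' - 1 + p); last by rewrite /x'; ring.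
  by rewrite /mu; field; rewrite -/mu !gt_eqF.
have C2 : 1 <= 2 * C.
  by apply: (le_trans C1); rewrite ler_peMl ?(ltW C0) // ler1n.
have xi1 : 1 <= xi by rewrite lerDl divr_ge0 // ltW.
have xi0 : 0 < xi by exact: lt_le_trans xi1.
have xi6 : 0 <= 6 * xi ^+ 2 by rewrite mulr_ge0 // exprn_ge0 // ltW.
have p0 : 0 <= p by rewrite invr_ge0.
have p1 : p <= 1 by rewrite invf_le1 ?ltr0n.
have x'le : `|x'| <= rv * xi.
  have -> : rv * xi = `|x| + rv by rewrite /xi; field; rewrite gt_eqF.
  rewrite /x' -addrA; apply: (le_trans (ler_normD _ _)); rewrite lerD2l.
  by rewrite ger0_norm ?subr_ge0 // (le_trans _ rv1) // gerBl.
pose del := `|d| / rv.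
have del0 : 0 <= del by rewrite divr_ge0 // ltW.
have dE : `|d| = rv * del by rewrite /del; field; rewrite gt_eqF.
have delC : del <= C by rewrite ler_pdivrMr // excess_le.
have im : mu^-1 <= nu^-1 by rewrite lef_pV2 ?posrE.
have im0 : 0 < mu^-1 by rewrite invr_gt0.
have in0 : 0 < nu^-1 by rewrite invr_gt0.
have inE : nu^-1 = rv^-1 * rv^-1 by rewrite rv2 expr2 invfM.
have iv0 : 0 < rv^-1 by rewrite invr_gt0.
have b1 : `|Y - X| <= xi * (del + eps) / rv.
  rewrite YX; apply: (le_trans (ler_normB _ _)).
  have amn : 0 <= ab / (mu * nu) by rewrite divr_ge0 // mulr_ge0 // ltW.
  rewrite [`|d / mu|]normrM (gtr0_norm im0) -[x' * ab / _]mulrA [`|x' * _|]normrM.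
  rewrite (ger0_norm amn) mulrA.
  have -> : xi * (del + eps) / rv = xi * del / rv + xi * eps / rv by ring.
  apply: lerD.
    apply: (@le_trans _ _ (rv * del * nu^-1)).
      by rewrite dE ler_wpM2l ?mulr_ge0 // ltW.
    have -> : rv * del * nu^-1 = del / rv by rewrite inE; field; rewrite gt_eqF.
    by rewrite ler_wpM2r ?(ltW iv0) // ler_peMl.
  apply: (@le_trans _ _ (rv * xi * eps * nu^-1)).
    have -> : `|x'| * ab / (mu * nu) = `|x'| * eps * mu^-1.
      by rewrite /eps; field; rewrite !gt_eqF.
    apply: ler_pM => //; [by rewrite mulr_ge0|exact: ltW|].
    by rewrite ler_wpM2r.
  rewrite inE le_eqVlt; apply/orP; left; apply/eqP; field; rewrite gt_eqF //.
have b2 : `|X| <= xi / rv.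
  rewrite /X normrM (gtr0_norm in0).
  apply: (@le_trans _ _ (rv * xi * nu^-1)); first by rewrite ler_wpM2r // ltW.
  by rewrite inE le_eqVlt; apply/orP; left; apply/eqP; field; rewrite gt_eqF.
have b3 : `|Y| <= 2 * C * xi / rv.
  rewrite /Y normrM (gtr0_norm im0).
  apply: (@le_trans _ _ ((rv * xi + rv * del) * nu^-1)).
    apply: ler_pM => //; first exact: ltW.
    by apply: (le_trans (ler_normD _ _)); rewrite lerD ?dE.
  have -> : (rv * xi + rv * del) * nu^-1 = (xi + del) / rv.
    by rewrite inE; field; rewrite gt_eqF.
  rewrite ler_wpM2r ?(ltW iv0) //.
  have c1 : xi <= C * xi by rewrite ler_peMl // ltW.
  have c2 : del <= C * xi by apply: (le_trans delC); rewrite ler_peMr // ltW.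
  lra.
(* A sparse bin is the danger. If Z < nu / 2 then |X| >= 1/2, so nu is at most 4 xi^2, and Z >= 1
   suffices. *)
have b4 : nu / Z <= 6 * xi ^+ 2.
  have X2 : 4 * nu * X ^+ 2 <= 4 * xi ^+ 2.
    rewrite -mulrA ler_wpM2l // -[X ^+ 2]real_normK ?num_real //.
    apply: (@le_trans _ _ (nu * (xi / rv) ^+ 2)).
      rewrite ler_wpM2l ?(ltW nu0) // lerXn2r ?nnegrE // divr_ge0 // ltW //.
    by rewrite rv2 le_eqVlt; apply/orP; left; apply/eqP; field; rewrite gt_eqF.
  have xi2 : 1 <= xi ^+ 2 by rewrite exprn_ege1.
  have [h|h] := leP nu (2 * Z).
    by rewrite ler_pdivrMr //; nra.
  have hX : X <= - 2^-1.
    have : Z / nu < 2^-1.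
      by rewrite ltr_pdivrMr //; move: h; move: nu => v h; lra.
    by rewrite -XE; lra.
  have X4 : 1 <= 4 * X ^+ 2 by nra.
  apply: (@le_trans _ _ nu); first by rewrite ler_pdivrMr // ler_peMr // ltW.
  apply: (@le_trans _ _ (4 * nu * X ^+ 2)); last by lra.
  by rewrite -mulrA mulrCA ler_peMr // ltW.
have b5 : `|X| / (1 + X) + `|Y| / (1 + Y) <= 3 * C * xi / rv * (2 * C * (6 * xi ^+ 2)).
  have q1 : 0 <= (1 + X)^-1 by rewrite invr_ge0 ltW.
  have q2 : 0 <= (1 + Y)^-1 by rewrite invr_ge0 ltW.
  have q3 : (1 + X)^-1 <= 2 * C * (6 * xi ^+ 2).
    rewrite XE invf_div; apply: (le_trans b4).
    by rewrite ler_peMl.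
  have q4 : (1 + Y)^-1 <= 2 * C * (6 * xi ^+ 2).
    rewrite YE invf_div; apply: (@le_trans _ _ (2 * C * (nu / Z))).
      rewrite mulrA; apply: ler_pM; rewrite ?invr_ge0 ?(ltW mu0) ?(ltW Za0) //.
        have -> : mu = (1 + eps) * nu by rewrite /mu /eps; field; rewrite gt_eqF.
        by rewrite ler_wpM2r ?(ltW nu0) // mulr_natl mulr2n lerD.
      by rewrite lef_pV2 ?posrE // lerDl.
    by rewrite ler_wpM2l // mulr_ge0 // ltW.
  have -> : 3 * C * xi / rv * (2 * C * (6 * xi ^+ 2)) =
    C * xi / rv * (2 * C * (6 * xi ^+ 2)) + 2 * C * xi / rv * (2 * C * (6 * xi ^+ 2)) by ring.
  apply: lerD; apply: ler_pM => //.
  apply: (le_trans b2); rewrite -mulrA ler_peMl // divr_ge0 // ltW //.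
have b6 := ln1D_diff X Y _ _.
have e0 : 0 <= eta by rewrite addr_ge0 // ltW // invr_gt0.
have s1 : `|ln (1 + Y) - ln (1 + X) - (Y - X)| <=
    36 * C ^+ 2 * xi ^+ 4 * ((del + eps) * (rv^-1 / rv)).
  apply: (le_trans (b6 _ _)); [lra|lra|].
  apply: (@le_trans _ _ (xi * (del + eps) / rv * (3 * C * xi / rv * (2 * C * (6 * xi ^+ 2))))).
    by apply: ler_pM => //; rewrite addr_ge0 // divr_ge0 // ltW.
  by rewrite le_eqVlt; apply/orP; left; apply/eqP; ring.
have s2 : `|x' * ab ^+ 2 / (mu * nu ^+ 2) - d * ab / (mu * nu)| <=
    xi * (eps * ((del + eps) / rv)).
  have -> : x' * ab ^+ 2 / (mu * nu ^+ 2) - d * ab / (mu * nu) =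
      eps * (x' * eps - d) * mu^-1 by rewrite /eps; field; rewrite !gt_eqF.
  rewrite normrM (gtr0_norm im0) [`|eps * _|]normrM (ger0_norm eps0).
  apply: (@le_trans _ _ (eps * (rv * xi * eps + rv * del) * nu^-1)).
    apply: ler_pM => //; [exact: mulr_ge0|exact: ltW|].
    rewrite ler_wpM2l //; apply: (le_trans (ler_normB _ _)); rewrite dE.
    by rewrite lerD2r [`|x' * _|]normrM (ger0_norm eps0) ler_wpM2r.
  have -> : eps * (rv * xi * eps + rv * del) * nu^-1 = eps * ((xi * eps + del) / rv).
    by rewrite inE; field; rewrite gt_eqF.
  rewrite [leRHS]mulrCA ler_wpM2l // [leRHS]mulrA ler_wpM2r ?(ltW iv0) //.
  have : del <= xi * del by rewrite ler_peMl.
  lra.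
apply: (le_trans (ler_normD _ _)); apply: (le_trans (lerD s1 s2)).
have de0 : 0 <= (del + eps) / rv by rewrite divr_ge0 ?addr_ge0 // ltW.
have c3 : C ^+ 2 <= C ^+ 3 by rewrite [leRHS]exprS ler_peMl ?sqr_ge0.
have xi4 : xi <= xi ^+ 4 by rewrite exprS ler_peMr ?exprn_ege1 // ltW.
have -> : 36 * C ^+ 3 * xi ^+ 4 * ((del + eps) * (eta / rv)) =
  36 * C ^+ 3 * xi ^+ 4 * ((del + eps) * (rv^-1 / rv)) +
  (36 * C ^+ 3 * xi ^+ 4) * (rn^-1 * ((del + eps) / rv)) by rewrite /eta; ring.
apply: lerD.
  rewrite ler_wpM2r ?mulr_ge0 ?addr_ge0 ?(ltW iv0) //.
  by rewrite ler_wpM2r ?exprn_ge0 ?(ltW xi0) // ler_wpM2l.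
apply: (@le_trans _ _ (xi ^+ 4 * ((C / rn) * ((del + eps) / rv)))).
  by apply: ler_pM => //; [exact: ltW|exact: mulr_ge0|rewrite ler_wpM2r].
have -> : xi ^+ 4 * (C / rn * ((del + eps) / rv)) =
  (C * xi ^+ 4) * (rn^-1 * ((del + eps) / rv)) by ring.
rewrite ler_wpM2r ?mulr_ge0 ?invr_ge0 ?(ltW rn0) ?addr_ge0 ?(ltW rv0) //.
rewrite ler_wpM2r ?exprn_ge0 ?(ltW xi0) //.
have : C <= C ^+ 3 by rewrite exprS ler_peMr ?(ltW C0) // exprn_ege1.
lra.
Qed.

Lemma expect_qstat : expect N (qstat lin_coef quad_coef N) = 0.
Proof.
rewrite /qstat expectB expectZ expectB expect_cst // !expect_sum //.
have -> : \sum_i expect N (fun z : 'I_n -> nat => lin_coef i * (z i)%:R) = 0.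
  transitivity (\sum_i lin_coef i * nu).
    apply: eq_bigr => i _; rewrite expectZ; congr (_ * _).
    apply/eqP; rewrite -subr_eq0 -[X in _ - X](expect_cst n0 N) -expectB.
    by apply/eqP; exact: (expect_dev n0 N i).
  by rewrite -mulr_suml sum_lin_coef mul0r.
rewrite (eq_bigr _ (fun i _ => expect_dev2 n0 N i)) sumr_const card_ord.
rewrite -[X in _ * (X - _)]mulr_natl; set q := n%:R^-1.
have -> : n%:R * (N%:R * (q * (1 - q))) = N%:R * (1 - q).
  by rewrite /q; field.
by rewrite subrr mulr0 subr0.
Qed.

Lemma expect_log_ratio_qstat :
  expect N (fun z => `|log_ratio a N z - qstat lin_coef quad_coef N z -
    expect N (log_ratio a N)|) <=
  72 * C ^+ 4 * (1 + moment_bound 8) * (rv^-1 + rn^-1).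
Proof.
pose g z := log_ratio a N z - qstat lin_coef quad_coef N z.
have Eg : expect N g = expect N (log_ratio a N).
  by rewrite /g expectB expect_qstat subr0.
have M0 : 0 <= moment_bound 8 :> R := moment_bound_ge0 8.
have e0 : 0 <= eta by rewrite addr_ge0 // ltW // invr_gt0.
rewrite -Eg; apply: (le_trans (expect_norm_le n0 _ _)).
have -> : 72 * C ^+ 4 * (1 + moment_bound 8) * (rv^-1 + rn^-1) =
    Num.sqrt ((72 * C ^+ 4 * (1 + moment_bound 8) * eta) ^+ 2).
  rewrite sqrtr_sqr ger0_norm // mulr_ge0 // mulr_ge0 ?addr_ge0 //.
  by rewrite mulr_ge0 ?exprn_ge0 ?(ltW C0).
apply: ler_wsqrtr; rewrite expect_var //.
(* Besides [kappa], the centre removes the change of [qstat] due to the recentring from N - 1 to N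
   balls, so that the martingale increment appears. *)
pose c z := kappa - (qstat lin_coef quad_coef N.-1 z - qstat lin_coef quad_coef N z).
apply: (le_trans (efron_stein n0 N g c)).
pose B i : R := (36 * C ^+ 3 * ((`|excess a i| / rv + eps) * (eta / rv))) ^+ 2.
apply: (@le_trans _ _ (N%:R * avg (fun i => B i * moment_bound 8))).
  rewrite ler_wpM2l //.
  apply: (@le_trans _ _ (expect N.-1 (fun z => avg (fun i =>
      B i * (1 + `|dev N.-1 z i| / rv) ^+ 8)))).
    apply: expect_le => z zN; apply: avg_le => i.
    have -> : g (place i z) - g z - c z =
      ln ((z i).+1 + a i)%:R - ln (z i).+1%:R -
      qincr lin_coef quad_coef N.-1 z i - kappa.
      rewrite -log_ratio_place /g /c.
      have := qstatS n0 lin_coef quad_coef N.-1 z i zN; rewrite prednK // => ->.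
      by ring.
    rewrite -[leLHS]real_normK ?num_real //.
    apply: (@le_trans _ _ ((36 * C ^+ 3 * (1 + `|dev N.-1 z i| / rv) ^+ 4 *
      ((`|excess a i| / rv + eps) * (eta / rv))) ^+ 2)).
      have h := incr_bound z i.
      by rewrite lerXn2r ?nnegrE // (le_trans _ h).
    by rewrite /B le_eqVlt; apply/orP; left; apply/eqP; ring.
  rewrite (expect_avg n0 _ (fun i z => B i * (1 + `|dev N.-1 z i| / rv) ^+ 8)).
  apply: avg_le => i; rewrite expectZ ler_wpM2l ?sqr_ge0 //.
  apply: expect_dev_bound => //.
  by rewrite ler_wpM2r ?invr_ge0 // ler_nat leq_pred.
have sumB : \sum_i B i <= 36 ^+ 2 * (4 * C ^+ 7) * eta ^+ 2 / nu.
  apply: (@le_trans _ _ (\sum_i (36 ^+ 2 * (2 * C ^+ 6) * eta ^+ 2 / nu) *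
     (excess a i ^+ 2 / nu + eps ^+ 2))).
    apply: ler_sum => i _; rewrite /B.
    have -> : (36 * C ^+ 3 * ((`|excess a i| / rv + eps) * (eta / rv))) ^+ 2 =
      (36 ^+ 2 * (2 * C ^+ 6) * eta ^+ 2 / nu) * ((`|excess a i| / rv + eps) ^+ 2 / 2).
      by rewrite rv2; field; rewrite gt_eqF.
    rewrite ler_wpM2l ?mulr_ge0 ?exprn_ge0 ?invr_ge0 ?(ltW C0) ?(ltW nu0) //.
    have -> : excess a i ^+ 2 / nu = (`|excess a i| / rv) ^+ 2.
      by rewrite -[excess a i ^+ 2]real_normK ?num_real // rv2; field; rewrite gt_eqF.
    by have := sqr_ge0 (`|excess a i| / rv - eps); nra.
  rewrite -mulr_sumr big_split /= -mulr_suml sumr_const card_ord.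
  rewrite -[X in _ * (_ + X)]mulr_natl -/D2.
  have h1 : D2 / nu <= C by rewrite ler_pdivrMr.
  have h2 : n%:R * eps ^+ 2 <= C.
    by rewrite /eps expr_div_n mulrA ler_pdivrMr ?exprn_gt0.
  have -> : 36 ^+ 2 * (4 * C ^+ 7) * eta ^+ 2 / nu =
     (36 ^+ 2 * (2 * C ^+ 6) * eta ^+ 2 / nu) * (C + C) by ring.
  rewrite ler_wpM2l ?mulr_ge0 ?exprn_ge0 ?invr_ge0 ?(ltW C0) ?(ltW nu0) //.
  exact: lerD.
rewrite /avg -mulr_suml mulrA.
have -> : N%:R * n%:R^-1 = nu by [].
rewrite mulrA.
apply: (@le_trans _ _ (36 ^+ 2 * (4 * C ^+ 7) * eta ^+ 2 * moment_bound 8)).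
  rewrite ler_wpM2r //; rewrite mulrC -ler_pdivlMr //.
have -> : (72 * C ^+ 4 * (1 + moment_bound 8) * eta) ^+ 2 =
  36 ^+ 2 * (4 * C ^+ 8) * eta ^+ 2 * (1 + moment_bound 8) ^+ 2 by ring.
apply: ler_pM; rewrite ?mulr_ge0 ?exprn_ge0 ?(ltW C0) //.
  rewrite ler_wpM2r ?sqr_ge0 // ler_wpM2l ?exprn_ge0 // ler_wpM2l //.
  by rewrite [leRHS]exprS ler_peMl ?exprn_ge0 // ltW.
nra.
Qed.

End QuadraticApproximation.

(** * The limit of the total variation distance *)

Section Sandwich.
Context {R : realType}.

Lemma gap_lipschitz (x y : R) : x <= y -> gap x <= gap y <= gap x + (y - x).
Proof.
move=> xy; rewrite /gap.
have e1 : expR (- y) <= expR (- x) by rewrite ler_expR lerN2.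
have e2 := expR_ge1Dx (- y); have e3 := expR_gt0 (- x).
have e4 : expR (- y) = expR (- x) * expR (- (y - x)).
  by rewrite -expRD; congr expR; ring.
have e5 := expR_ge1Dx (- (y - x)).
have [x0|x0] := leP 0 x.
  have e6 : expR (- x) <= 1 by rewrite -[leRHS]expR0 ler_expR oppr_le0.
  have e7 : expR (- x) * (y - x) <= y - x by rewrite ler_piMl // subr_ge0.
  rewrite !maxEle !subr_ge0 e6 (le_trans e1 e6); apply/andP; split; first by lra.
  have : expR (- x) * (1 - (y - x)) <= expR (- y) by rewrite e4 ler_wpM2l // ltW.
  lra.
have -> : Num.max 0 (1 - expR (- x)) = 0 :> R.
  by apply/max_idPl; rewrite subr_le0 -[leLHS]expR0 ler_expR oppr_ge0 ltW.
by rewrite le_max lexx /= add0r ge_max subr_ge0 xy /=; lra.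
Qed.

(** With u = exp(-x) >= v = exp(-y) and K = exp k, the claim reads min(K, v) - min(1, v) <= u -
    min(1, u), which follows from max(0, v - 1) <= max(0, u - 1). *)
Lemma gap_truncation (k x y : R) : 0 <= k -> x <= y ->
  gap y - expR (- x) + expR k * (1 - gap (y + k)) <= gap x.
Proof.
move=> k0 xy; have exy : expR (- y) <= expR (- x) by rewrite ler_expR lerN2.
have ey := expR_gt0 (- y).
have ek : 1 <= expR k by rewrite -[leLHS]expR0 ler_expR.
have e : expR k * expR (- (y + k)) = expR (- y).
  by rewrite -expRD; congr expR; ring.
have ek0 : 0 < expR k := expR_gt0 k.
rewrite /gap !maxEle !subr_ge0; set u := expR (- x) in exy *.
set v := expR (- y) in e exy ey *; set K := expR k in e ek ek0 *.
set w := expR (- (y + k)) in e *.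
have [w1|w1] := leP w 1; have [v1|v1] := leP v 1; have [u1|u1] := leP u 1; nra.
Qed.

Context {n : nat}.
Hypothesis n0 : (0 < n)%N.
Variables (a : 'I_n -> nat) (N : nat).

Lemma expR_log_ratio y : expR (- log_ratio a N y) = inv_ratio a N y :> R.
Proof. by rewrite (log_ratioE n0) opprK lnK // posrE (inv_ratio_gt0 n0). Qed.

Lemma TV_gap : TV R a (N + balls a) = expect N (fun y => gap (log_ratio a N y)).
Proof.
by rewrite TV_expect //; apply: eq_expect => y _; rewrite /gap expR_log_ratio.
Qed.

Variables (S : ('I_n -> nat) -> R) (b er : R).
Hypothesis er_bound :
  expect N (fun y => `|log_ratio a N y - S y - expect N (log_ratio a N)|) +
  Num.max 0 (expect N (log_ratio a N) - b) <= er.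

(** Only the excess of M over b + S is controlled, since only an upper bound on the mean of M is
    available. *)
Let over y : R := Num.max 0 (log_ratio a N y - (b + S y)).

Let expect_over : expect N over <= er.
Proof.
apply: le_trans er_bound; set c := expect N (log_ratio a N).
rewrite -[X in _ + X](expect_cst n0 N) -expectD; apply: expect_le => y _.
rewrite /over ge_max addr_ge0 ?le_max ?lexx //=.
have h1 := ler_norm (log_ratio a N y - S y - c).
have h2 : c - b <= Num.max 0 (c - b) by rewrite le_max lexx orbT.
lra.
Qed.

Lemma TV_upper : TV R a (N + balls a) <= expect N (fun y => gap (b + S y)) + er.
Proof.
rewrite TV_gap; apply: (@le_trans _ _ (expect N (fun y => gap (b + S y) + over y))).
  apply: expect_le => y _.
  have h0 : log_ratio a N y <= b + S y + over y.
    by rewrite -lerBlDl /over le_max lexx orbT.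
  have /andP[h1 _] := gap_lipschitz _ _ h0.
  have o0 : 0 <= over y by rewrite /over le_max lexx.
  have /andP[_ h2] : gap (b + S y) <= gap (b + S y + over y) <=
     gap (b + S y) + (b + S y + over y - (b + S y)).
    by apply: gap_lipschitz; rewrite lerDl.
  lra.
by rewrite expectD lerD2l expect_over.
Qed.

(* Since the likelihood ratio has expectation at most one, no mass can be hidden
   in an overestimate b + S of its logarithm that itself carries full mass. *)
Lemma TV_lower k : 0 <= k ->
  expect N (fun y => gap (b + S y)) - 1 +
  expR k * (1 - expect N (fun y => gap (b + k + S y)) - er) <= TV R a (N + balls a).
Proof.
move=> k0; rewrite TV_gap.
have ek0 : 0 < expR k := expR_gt0 k.
have E1 : expect N (fun y => expR (- log_ratio a N y)) <= 1 :> R.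
  apply: le_trans (expect_inv_ratio n0 a N).
  by apply: expect_le => y _; rewrite expR_log_ratio.
apply: (@le_trans _ _ (expect N (fun y => gap (b + S y) -
  expR (- log_ratio a N y) + expR k * (1 - gap (b + k + S y) - over y)))).
  rewrite expectD expectB expectZ !expectB expect_cst // lerD ?lerB //.
  by rewrite ler_wpM2l ?(ltW ek0) // lerB.
apply: expect_le => y _.
have o0 : 0 <= over y by rewrite /over le_max lexx.
have h0 : log_ratio a N y <= b + S y + over y.
  by rewrite -lerBlDl /over le_max lexx orbT.
have h1 := gap_truncation k _ _ k0 h0.
have /andP[h2 _] : gap (b + S y) <= gap (b + S y + over y) <=
   gap (b + S y) + (b + S y + over y - (b + S y)).
  by apply: gap_lipschitz; rewrite lerDl.
have /andP[_ h3] : gap (b + k + S y) <= gap (b + S y + over y + k) <=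
   gap (b + k + S y) + (b + S y + over y + k - (b + k + S y)).
  by apply: gap_lipschitz; lra.
have h4 : expR k * (1 - gap (b + k + S y) - over y) <=
   expR k * (1 - gap (b + S y + over y + k)).
  by rewrite ler_wpM2l ?(ltW ek0) //; lra.
lra.
Qed.

End Sandwich.

(** The order of quantifiers matters: [K] depends on C and t0 alone, so n can tend to infinity
    before t0 tends to 0. The term 3 t0 is the cost of replacing [gap] by [heat] at t0; the rest
    comes from the telescoping. *)
Lemma qstat_clt {R : realType} (C t0 : R) : 1 <= C -> 0 < t0 -> t0 <= 1 ->
  exists2 K : R, 0 <= K &
  forall (n : nat) (al : 'I_n -> R) (be : R) (N : nat) (s0 : R), (0 < n)%N ->
    \sum_i al i = 0 -> 1 <= N%:R / n%:R :> R ->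
    N%:R / n%:R * \sum_i al i ^+ 2 <= C ->
    n%:R * (N%:R / n%:R) ^+ 2 * be ^+ 2 <= C ->
    `|expect N (fun z => gap (s0 + qstat al be N z)) -
      heat s0 (Num.sqrt (t0 ^+ 2 + \sum_(0 <= r < N) qvar al be r))| <=
    3 * t0 + K * ((Num.sqrt (N%:R / n%:R))^-1 + (Num.sqrt n%:R)^-1).
Proof.
move=> C1 t00 t01; pose t1 := Num.sqrt (t0 ^+ 2 + 2 * C).
have t0t1 : t0 <= t1.
  rewrite -[leLHS]gtr0_norm // -sqrtr_sqr ler_wsqrtr // lerDl.
  by rewrite mulr_ge0 // (le_trans _ C1).
have [K0 K00 HK] := heat_step t0 t1 t00 t0t1.
have M0 : 0 <= moment_bound 3 :> R := moment_bound_ge0 3.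
have C0 : 0 <= C by lra.
pose K := (1 / t0 + expR (t1 ^+ 2 / 2)) * (4 * C ^+ 2) +
  K0 * (4 * C ^+ 3 * (1 + moment_bound 3) + 4 * C ^+ 2).
have p1 : 0 <= (1 / t0 + expR (t1 ^+ 2 / 2)) * (4 * C ^+ 2).
  by rewrite mulr_ge0 ?addr_ge0 ?expR_ge0 ?mulr_ge0 ?exprn_ge0 ?invr_ge0 ?(ltW t00).
have p2 : 0 <= K0 * (4 * C ^+ 3 * (1 + moment_bound 3) + 4 * C ^+ 2).
  apply: mulr_ge0 => //; apply: addr_ge0; last by rewrite mulr_ge0 ?exprn_ge0.
  by apply: mulr_ge0; rewrite ?addr_ge0 // mulr_ge0 ?exprn_ge0.
exists K; first exact: addr_ge0.
move=> n al be N s0 n0 al0 nu1 hal hbe.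
have h := heat_step_sum n0 al be C N al0 C1 nu1 hal hbe t0 s0 t00 K0 HK K00.
set rv := Num.sqrt (N%:R / n%:R) in h *; set rn := Num.sqrt n%:R in h *.
set T := Num.sqrt (_ + \sum_(0 <= r < N) _) in h *.
have iv : 0 <= rv^-1 by rewrite invr_ge0 sqrtr_ge0.
have inn : 0 <= rn^-1 by rewrite invr_ge0 sqrtr_ge0.
have g : `|expect N (fun z => gap (s0 + qstat al be N z)) -
    expect N (fun z => heat (s0 + qstat al be N z) t0)| <= 3 * t0.
  rewrite -expectB -[leRHS](expect_cst n0 N).
  apply: (le_trans (ler_norm_expect n0 _ _)); apply: expect_le => z _.
  by rewrite distrC; exact: heat_gap.
apply: (le_trans (ler_distD (expect N (fun z => heat (s0 + qstat al be N z) t0)) _ _)).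
apply: lerD => //; apply: (le_trans h).
have -> : (1 / t0 + expR (t1 ^+ 2 / 2)) * (4 * C ^+ 2 / rn) =
  (1 / t0 + expR (t1 ^+ 2 / 2)) * (4 * C ^+ 2) * rn^-1 by rewrite mulrA.
have -> : K0 * (4 * C ^+ 3 * (1 + moment_bound 3) / rv + 4 * C ^+ 2 / rv) =
  K0 * (4 * C ^+ 3 * (1 + moment_bound 3) + 4 * C ^+ 2) * rv^-1 by ring.
rewrite /K; move: p1 p2; set P1 := _ * (4 * C ^+ 2); set P2 := K0 * _ => p1 p2.
have : 0 <= P1 * rv^-1 by exact: mulr_ge0.
have : 0 <= P2 * rn^-1 by exact: mulr_ge0.
lra.
Qed.

Lemma sum_qvar {R : realType} {n : nat} (n0 : (0 < n)%N) (a : 'I_n -> nat) (N : nat) :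
  (0 < N)%N ->
  \sum_(0 <= t < N) qvar (lin_coef a N) (quad_coef a N : R) t =
  (\sum_i excess a i ^+ 2) / (N%:R / n%:R) +
  2^-1 * (1 - n%:R^-1) * (1 - N%:R^-1) *
    (n%:R * ((balls a)%:R / n%:R) ^+ 2 / (N%:R / n%:R) ^+ 2).
Proof.
move=> N0; have nz : n%:R != 0 :> R by rewrite pnatr_eq0 -lt0n.
have Nz : N%:R != 0 :> R by rewrite pnatr_eq0 -lt0n.
have sN : \sum_(0 <= t < N) t%:R = 2^-1 * N%:R * (N%:R - 1) :> R.
  elim: (N) => [|M IH]; first by rewrite big_geq //; ring.
  by rewrite big_nat_recr //= IH -natr1; field.
rewrite /qvar big_split /= sumr_const_nat subn0 -[X in X + _]mulr_natl.
under [X in _ + X]eq_bigr do rewrite mulrAC mulrA.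
rewrite -mulr_suml -mulr_sumr sN /quad_coef.
have -> : \sum_i lin_coef a N i ^+ 2 =
    (\sum_i excess a i ^+ 2) / (N%:R / n%:R) ^+ 2 :> R.
  by rewrite mulr_suml; apply: eq_bigr => i _; rewrite /lin_coef expr_div_n.
by field; rewrite nz Nz.
Qed.

Lemma sum_excess_sqr {R : realType} {n : nat} (n0 : (0 < n)%N) (a : 'I_n -> nat) :
  \sum_i excess a i ^+ 2 = n%:R * V R a.
Proof.
have nz : n%:R != 0 :> R by rewrite pnatr_eq0 -lt0n.
apply/eqP; rewrite -(inj_eq (addIr (n%:R * ((balls a)%:R / n%:R) ^+ 2))).
by rewrite -sum_sqr // /V; apply/eqP; field.
Qed.

(** * Passage to the limit for general [sL] and [r] *)

Section Asymptotics.
Context {R : realType}.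
Variables (m : nat -> nat) (A : forall n : nat, 'I_n -> nat) (sL r : R).
Let k n : R := (balls (A n))%:R.
Hypothesis k_large : (fun n => k n / Num.sqrt n%:R) @ \oo --> +oo.
Hypothesis m_pos : \forall n \near \oo, (0 < m n)%N.
Hypothesis cvg_lin : (fun n => n%:R ^+ 2 * V R (A n) / (m n)%:R) @ \oo --> sL.
Hypothesis cvg_quad : (fun n => k n * Num.sqrt n%:R / (m n)%:R) @ \oo --> r.
Hypothesis var_pos : 0 < sL + r ^+ 2 / 2.

Let N n : nat := (m n - balls (A n))%N.
Let nu n : R := (N n)%:R / n%:R.
Let x n : R := (\sum_i excess (A n) i ^+ 2) / nu n.
Let y n : R := n%:R * (k n / n%:R) ^+ 2 / nu n ^+ 2.

Let n_pos : \forall n \near \oo, (0 < n)%N.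
Proof. by exists 1%N. Qed.

Let sqrt_y : (fun n : nat => Num.sqrt n%:R : R) @ \oo --> +oo.
Proof.
apply/cvgryPge => B; near=> n.
have h : B ^+ 2 <= n%:R by near: n; exact: nbhs_infty_ger.
apply: (le_trans (ler_norm B)); rewrite -sqrtr_sqr; exact: ler_wsqrtr.
Unshelve. all: by end_near. Qed.

Let inv_sqrt : (fun n : nat => (Num.sqrt n%:R)^-1 : R) @ \oo --> (0 : R).
Proof.
apply/cvgrPdist_lt => e e0; near=> n.
have h : e^-1 + 1 <= Num.sqrt n%:R by near: n; move/cvgryPge : sqrt_y; exact.
have e1 : 0 < e^-1 by rewrite invr_gt0.
have h2 : 0 < Num.sqrt (n%:R : R) by lra.
rewrite sub0r normrN gtr0_norm ?invr_gt0 // -[ltRHS]invrK ltf_pV2 ?posrE //.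
lra.
Unshelve. all: by end_near. Qed.

Let cvg_km : (fun n => k n / (m n)%:R) @ \oo --> (0 : R).
Proof.
have h : (fun n => k n * Num.sqrt n%:R / (m n)%:R * (Num.sqrt n%:R)^-1) @ \oo --> r * 0.
  exact: cvgM.
rewrite mulr0 in h; apply: cvg_trans h; apply: near_eq_cvg; near=> n.
have n0 : (0 < n)%N by near: n.
have q0 : Num.sqrt (n%:R : R) != 0 by rewrite gt_eqF // sqrtr_gt0 ltr0n.
by rewrite mulrAC; congr (_ / _); rewrite mulfK.
Unshelve. all: by end_near. Qed.

Let km_half : \forall n \near \oo, k n / (m n)%:R <= 2^-1.
Proof.
by move/cvgrPdist_le : cvg_km => /(_ 2^-1) h; have h0 : (0 : R) < 2^-1 by [];
 near=> n; have : `|0 - k n / (m n)%:R| <= 2^-1 by [near: n; exact: h];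
 rewrite sub0r normrN ger0_norm ?divr_ge0.
Unshelve. all: by end_near. Qed.

Let mE : \forall n \near \oo, m n = (N n + balls (A n))%N.
Proof.
near=> n; rewrite /N subnK //.
have m0 : (0 < m n)%N by near: n; exact: m_pos.
have h : k n / (m n)%:R <= 2^-1 by near: n; exact: km_half.
rewrite -(ler_nat R) -/(k n); move: h; rewrite ler_pdivrMr ?ltr0n // => h.
by have : 0 <= (m n)%:R :> R by []; lra.
Unshelve. all: by end_near. Qed.

Let NE : \forall n \near \oo, (N n)%:R = (m n)%:R * (1 - k n / (m n)%:R) :> R.
Proof.
near=> n.
have m0 : (0 < m n)%N by near: n; exact: m_pos.
have e : m n = (N n + balls (A n))%N by near: n; exact: mE.
have -> : (m n)%:R * (1 - k n / (m n)%:R) = (m n)%:R - k n.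
  by field; rewrite pnatr_eq0 -lt0n.
by rewrite e natrD /k addrK.
Unshelve. all: by end_near. Qed.

Let cvg_one : (fun n => (1 - k n / (m n)%:R)^-1) @ \oo --> (1 : R).
Proof.
rewrite -[X in _ --> X]invr1; apply: cvgV; first exact: oner_neq0.
by rewrite -[X in _ --> X]subr0; apply: cvgB cvg_km; exact: cvg_cst.
Qed.

(** The growth of k / sqrt(n) enters here: m is eventually at least k sqrt(n) / (|r| + 1), so m / n
    is at least k / sqrt(n) up to a constant, and N is at least m / 2. *)
Let nu_y : nu @ \oo --> +oo.
Proof.
apply/cvgryPge => B; near=> n.
have m0 : (0 < m n)%N by near: n; exact: m_pos.
have n0 : (0 < n)%N by near: n.
have h1 : k n / (m n)%:R <= 2^-1 by near: n; exact: km_half.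
have h2 : (N n)%:R = (m n)%:R * (1 - k n / (m n)%:R) :> R by near: n; exact: NE.
have h3 : `|r - k n * Num.sqrt n%:R / (m n)%:R| <= 1.
  by near: n; move/cvgrPdist_le : cvg_quad; apply.
have h4 : 2 * (`|r| + 1) * `|B| <= k n / Num.sqrt n%:R.
  by near: n; move/cvgryPge : k_large; exact.
have mr : 0 < (m n)%:R :> R by rewrite ltr0n.
have nr : 0 < n%:R :> R by rewrite ltr0n.
have q0 : 0 < Num.sqrt (n%:R : R) by rewrite sqrtr_gt0.
have r1 : 0 < `|r| + 1 by rewrite ltr_wpDl.
apply: (le_trans (ler_norm B)).
rewrite /nu h2 ler_pdivlMr //.
have h5 : k n * Num.sqrt n%:R / (m n)%:R <= `|r| + 1.
  by move: h3; rewrite ler_norml => /andP[h3 _]; have := ler_norm r; lra.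
have h6 : k n * Num.sqrt n%:R <= (`|r| + 1) * (m n)%:R by rewrite -ler_pdivrMr.
have h7 : 2 * (`|r| + 1) * `|B| * n%:R <= k n * Num.sqrt n%:R.
  have -> : k n * Num.sqrt n%:R = k n / Num.sqrt n%:R * n%:R.
    transitivity (k n / Num.sqrt n%:R * Num.sqrt n%:R ^+ 2).
      by field; rewrite gt_eqF.
    by rewrite sqr_sqrtr // ltW.
  by rewrite ler_wpM2r // ltW.
have h8 : `|B| * n%:R * 2 <= (m n)%:R.
  rewrite -(ler_pM2l r1); apply: le_trans h6; apply: le_trans h7.
  by rewrite le_eqVlt; apply/orP; left; apply/eqP; ring.
have h9 : (m n)%:R * 2^-1 <= (m n)%:R * (1 - k n / (m n)%:R).
  by rewrite ler_wpM2l ?(ltW mr) //; lra.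
lra.
Unshelve. all: by end_near. Qed.

Let x_cvg : x @ \oo --> sL.
Proof.
have h : (fun n => n%:R ^+ 2 * V R (A n) / (m n)%:R * (1 - k n / (m n)%:R)^-1) @ \oo
   --> sL * 1 by exact: cvgM.
rewrite mulr1 in h; apply: cvg_trans h; apply: near_eq_cvg; near=> n.
have m0 : (0 < m n)%N by near: n; exact: m_pos.
have n0 : (0 < n)%N by near: n.
have h1 : k n / (m n)%:R <= 2^-1 by near: n; exact: km_half.
have h2 : (N n)%:R = (m n)%:R * (1 - k n / (m n)%:R) :> R by near: n; exact: NE.
have u0 : 1 - k n / (m n)%:R != 0 by apply/eqP; lra.
have mz : (m n)%:R != 0 :> R by rewrite pnatr_eq0 -lt0n.
have nz : n%:R != 0 :> R by rewrite pnatr_eq0 -lt0n.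
rewrite /x /nu sum_excess_sqr // h2; move: u0; set u := 1 - _ => u0.
by field; rewrite u0 mz nz.
Unshelve. all: by end_near. Qed.

Let y_cvg : y @ \oo --> r ^+ 2.
Proof.
have h : (fun n => k n * Num.sqrt n%:R / (m n)%:R * (1 - k n / (m n)%:R)^-1 *
   (k n * Num.sqrt n%:R / (m n)%:R * (1 - k n / (m n)%:R)^-1)) @ \oo
   --> (r * 1) * (r * 1) by apply: cvgM; exact: cvgM.
rewrite mulr1 -expr2 in h; apply: cvg_trans h; apply: near_eq_cvg; near=> n.
have m0 : (0 < m n)%N by near: n; exact: m_pos.
have n0 : (0 < n)%N by near: n.
have h1 : k n / (m n)%:R <= 2^-1 by near: n; exact: km_half.
have h2 : (N n)%:R = (m n)%:R * (1 - k n / (m n)%:R) :> R by near: n; exact: NE.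
have u0 : 1 - k n / (m n)%:R != 0 by apply/eqP; lra.
have mz : (m n)%:R != 0 :> R by rewrite pnatr_eq0 -lt0n.
have nz : n%:R != 0 :> R by rewrite pnatr_eq0 -lt0n.
rewrite /y /nu h2; move: u0; set u := 1 - _ => u0.
rewrite -expr2 3!exprMn sqr_sqrtr //.
by field; rewrite u0 mz nz.
Unshelve. all: by end_near. Qed.

(** The factor 2 serves the bound on k in [good]: k is at most twice the sum of squared excesses, or
    at most 2 k^2 / n. The two units inside are the slack allowed to [x] and [y]. *)
Let C : R := 1 + 2 * (`|sL| + r ^+ 2 + 2).

Let C1 : 1 <= C.
Proof. by rewrite /C; have := normr_ge0 sL; have := sqr_ge0 r; lra. Qed.

Let regular n : Prop := [/\ (0 < n)%N, (0 < N n)%N, 1 <= nu n,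
  \sum_i excess (A n) i ^+ 2 <= C * nu n &
  n%:R * (k n / n%:R) ^+ 2 <= C * nu n ^+ 2 /\ k n <= C * nu n ^+ 2].

(* Either k <= n / 2, and then V >= k / (2n) since the a i are integers; or
   k > n / 2, and then k ^ 2 / n is of order at least k. *)
Let good : \forall n \near \oo, regular n.
Proof.
near=> n.
have n0 : (0 < n)%N by near: n.
have nu1 : 1 <= nu n by near: n; move/cvgryPge : nu_y; exact.
have hx : `|sL - x n| <= 1 by near: n; move/cvgrPdist_le : x_cvg; apply.
have hy : `|r ^+ 2 - y n| <= 1 by near: n; move/cvgrPdist_le : y_cvg; apply.
have nu0 : 0 < nu n by lra.
have nr : 0 < n%:R :> R by rewrite ltr0n.
have s0 := sqr_ge0 r; have s1 := ler_norm sL; have s2 := normr_ge0 sL.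
have xC : x n <= `|sL| + 1 by move: hx; rewrite ler_norml => /andP[]; lra.
have yC : y n <= r ^+ 2 + 1 by move: hy; rewrite ler_norml => /andP[]; lra.
have xle : \sum_i excess (A n) i ^+ 2 <= (`|sL| + 1) * nu n by rewrite -ler_pdivrMr.
have yle : n%:R * (k n / n%:R) ^+ 2 <= (r ^+ 2 + 1) * nu n ^+ 2.
  by rewrite -ler_pdivrMr ?exprn_gt0.
have nu2 : nu n <= nu n ^+ 2 by rewrite expr2 ler_peMl // ltW.
have nu20 : 0 <= nu n ^+ 2 := sqr_ge0 _.
have N0 : (0 < N n)%N.
  rewrite lt0n; apply/eqP => N0; move: nu0; rewrite /nu N0 mul0r.
  by rewrite ltxx.
have c1 : (`|sL| + 1) * nu n <= (`|sL| + 1) * nu n ^+ 2 by rewrite ler_wpM2l // addr_ge0.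
have c2 : 0 <= `|sL| * nu n by rewrite mulr_ge0 // ltW.
have c3 : 0 <= r ^+ 2 * nu n by rewrite mulr_ge0 // ltW.
have c4 : 0 <= `|sL| * nu n ^+ 2 by rewrite mulr_ge0.
have c5 : 0 <= r ^+ 2 * nu n ^+ 2 by rewrite mulr_ge0.
have k0 : 0 <= k n by rewrite /k.
split => //.
- by apply: (le_trans xle); rewrite /C; lra.
split; first by apply: (le_trans yle); rewrite /C; lra.
have kE : n%:R * (k n / n%:R) ^+ 2 = k n * (k n / n%:R) by field; rewrite gt_eqF.
have [hk|hk] := leP (k n) (n%:R / 2).
  have ks : k n <= \sum_i (A n i)%:R ^+ 2.
    rewrite /k /balls natr_sum; apply: ler_sum => i _.
    by rewrite -natrX ler_nat; case: (A n i) => // j; rewrite expnS expn1 leq_pmull.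
  rewrite sum_sqr // -/(k n) kE in ks.
  have : k n * (k n / n%:R) <= k n * 2^-1.
    by rewrite ler_wpM2l // ler_pdivrMr //; lra.
  rewrite /C; lra.
have : k n * 2^-1 <= k n * (k n / n%:R).
  by rewrite ler_wpM2l // ler_pdivlMr //; lra.
rewrite -kE /C; lra.
Unshelve. all: by end_near. Qed.

Let eta n : R := (Num.sqrt (nu n))^-1 + (Num.sqrt n%:R)^-1.

Let eta_cvg : eta @ \oo --> (0 : R).
Proof.
rewrite -[X in _ --> X]addr0; apply: cvgD inv_sqrt.
apply/cvgrPdist_lt => e e0; near=> n.
have e1 : 0 < e^-1 by rewrite invr_gt0.
have h : (e^-1 + 1) ^+ 2 <= nu n by near: n; move/cvgryPge : nu_y; exact.
have h2 : e^-1 + 1 <= Num.sqrt (nu n).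
  rewrite -[leLHS]gtr0_norm ?addr_gt0 // -sqrtr_sqr; exact: ler_wsqrtr.
have h3 : 0 < Num.sqrt (nu n) by lra.
rewrite sub0r normrN gtr0_norm ?invr_gt0 // -[ltRHS]invrK ltf_pV2 ?posrE //.
lra.
Unshelve. all: by end_near. Qed.

Let sg : R := Num.sqrt (sL + r ^+ 2 / 2).
Let sg0 : 0 < sg. Proof. by rewrite sqrtr_gt0. Qed.
Let sg2 : sg ^+ 2 = sL + r ^+ 2 / 2. Proof. by rewrite sqr_sqrtr // ltW. Qed.

Let S n := qstat (lin_coef (A n) (N n)) (quad_coef (A n) (N n) : R) (N n).

Let var_cvg : (fun n => \sum_(0 <= t < N n)
    qvar (lin_coef (A n) (N n)) (quad_coef (A n) (N n) : R) t) @ \oo --> sg ^+ 2.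
Proof.
have invn : (fun n : nat => n%:R^-1 : R) @ \oo --> (0 : R).
  have h : (fun n : nat => (Num.sqrt n%:R)^-1 * (Num.sqrt n%:R)^-1 : R) @ \oo -->
    (0 * 0 : R) by exact: cvgM.
  rewrite mulr0 in h.
  apply: cvg_trans h; apply: near_eq_cvg; near=> n.
  by rewrite -[in RHS](sqr_sqrtr (ler0n R n)) expr2 invfM.
have invN : (fun n => (N n)%:R^-1 : R) @ \oo --> (0 : R).
  apply/cvgrPdist_lt => e e0.
  move/cvgrPdist_lt : invn => /(_ e e0) invn; near=> n.
  have [n0 N0 nu1 _ _] : regular n.
    by near: n; exact: good.
  have h : `|0 - n%:R^-1| < e by near: n; exact: invn.
  apply: le_lt_trans h; rewrite !sub0r !normrN !ger0_norm ?invr_ge0 //.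
  rewrite lef_pV2 ?posrE ?ltr0n //.
  by move: nu1; rewrite /nu ler_pdivlMr ?ltr0n // mul1r.
have h : (fun n => x n + 2^-1 * (1 - n%:R^-1) * (1 - (N n)%:R^-1) * y n) @ \oo -->
   sL + 2^-1 * (1 - 0) * (1 - 0) * r ^+ 2.
  apply: cvgD => //; apply: cvgM => //; apply: cvgM.
    by apply: cvgM; [exact: cvg_cst|apply: cvgB => //; exact: cvg_cst].
  by apply: cvgB => //; exact: cvg_cst.
have -> : sg ^+ 2 = sL + 2^-1 * (1 - 0) * (1 - 0) * r ^+ 2 by rewrite sg2; field.
apply: cvg_trans h; apply: near_eq_cvg; near=> n.
have [n0 N0 _ _ _] : regular n.
  by near: n; exact: good.
by rewrite sum_qvar.
Unshelve. all: by end_near. Qed.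

Let heat_cont (s0 tau : R) : 0 < tau -> {for tau, continuous (heat s0)}.
Proof. by move=> t0; apply: deriv_cont (heat_derive_tau s0 tau _); rewrite gt_eqF. Qed.

Let clt (s0 : R) : (fun n => expect (N n) (fun z => gap (s0 + S n z))) @ \oo --> heat s0 sg.
Proof.
apply/cvgrPdist_lt => e e0.
have hsq : (fun t => heat s0 (Num.sqrt (t ^+ 2 + sg ^+ 2))) t @[t --> (0 : R)] --> heat s0 sg.
  have -> : heat s0 sg = heat s0 (Num.sqrt (0 ^+ 2 + sg ^+ 2)).
    by rewrite expr0n /= add0r sqrtr_sqr gtr0_norm.
  apply: (@continuous_cvg _ _ _ _ _ _ (heat s0)).
    by apply: heat_cont; rewrite expr0n /= add0r sqrtr_sqr gtr0_norm.
  apply: (@continuous_cvg _ _ _ _ _ _ Num.sqrt); first exact: sqrt_continuous.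
  by apply: cvgD; [exact: exprn_continuous|exact: cvg_cst].
have [d /= d0 hd] : \forall t \near (0 : R),
    `|heat s0 sg - heat s0 (Num.sqrt (t ^+ 2 + sg ^+ 2))| < e / 4.
  by move/cvgrPdist_lt : hsq; apply; rewrite divr_gt0.
(* Smoothing costs 3 t0 <= e / 4, and t0 < d makes the added variance t0^2 move [heat] by less than
   e / 4. The other two quarters are spent as n grows. *)
pose t0 := Num.min (d / 2) (Num.min 1 (e / 12)).
have t00 : 0 < t0 by rewrite !lt_min ltr01 !divr_gt0.
have t01 : t0 <= 1 by rewrite !ge_min lexx orbT.
have t0e : t0 <= e / 12 by rewrite !ge_min lexx !orbT.
have t0d : t0 < d.
  by rewrite !gt_min; apply/orP; left; lra.
have h1 : `|heat s0 sg - heat s0 (Num.sqrt (t0 ^+ 2 + sg ^+ 2))| < e / 4.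
  by apply: hd; rewrite /= sub0r normrN gtr0_norm.
have [K K0 HK] := qstat_clt C t0 C1 t00 t01.
have tau0 : 0 < Num.sqrt (t0 ^+ 2 + sg ^+ 2).
  by rewrite sqrtr_gt0 addr_gt0 // exprn_gt0.
have h2 : (fun n => heat s0 (Num.sqrt (t0 ^+ 2 + \sum_(0 <= t < N n)
    qvar (lin_coef (A n) (N n)) (quad_coef (A n) (N n) : R) t))) @ \oo -->
    heat s0 (Num.sqrt (t0 ^+ 2 + sg ^+ 2)).
  apply: (@continuous_cvg _ _ _ _ _ _ (heat s0)); first exact: heat_cont.
  apply: (@continuous_cvg _ _ _ _ _ _ Num.sqrt); first exact: sqrt_continuous.
  by apply: cvgD var_cvg; exact: cvg_cst.
have h3 : (fun n => K * eta n) @ \oo --> K * 0.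
  by apply: cvgM eta_cvg; exact: cvg_cst.
rewrite mulr0 in h3.
have e4 : 0 < e / 4 by rewrite divr_gt0.
move/cvgrPdist_lt : h2 => /(_ _ e4) h2.
move/cvgrPdist_lt : h3 => /(_ _ e4) h3.
near=> n.
have [n0 N0 nu1 b1 [b2 _]] : regular n.
  by near: n; exact: good.
have nu0 : 0 < nu n by lra.
have q1 : nu n * \sum_i lin_coef (A n) (N n) i ^+ 2 <= C.
  have -> : \sum_i lin_coef (A n) (N n) i ^+ 2 =
    (\sum_i excess (A n) i ^+ 2) / nu n ^+ 2 :> R.
    by rewrite mulr_suml; apply: eq_bigr => i _; rewrite /lin_coef expr_div_n.
  have -> : nu n * ((\sum_i excess (A n) i ^+ 2) / nu n ^+ 2) =
     (\sum_i excess (A n) i ^+ 2) / nu n by field; rewrite gt_eqF.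
  by rewrite ler_pdivrMr.
have q2 : n%:R * nu n ^+ 2 * quad_coef (A n) (N n) ^+ 2 <= C.
  have -> : n%:R * nu n ^+ 2 * quad_coef (A n) (N n) ^+ 2 =
     n%:R * (k n / n%:R) ^+ 2 / nu n ^+ 2.
    by rewrite /quad_coef -/(k n) -/(nu n); field; rewrite gt_eqF // gt_eqF // ltr0n.
  by rewrite ler_pdivrMr ?exprn_gt0.
have h4 := HK n _ _ (N n) s0 n0 (sum_lin_coef n0 (A n) (N n)) nu1 q1 q2.
have h5 : `|heat s0 (Num.sqrt (t0 ^+ 2 + sg ^+ 2)) -
   heat s0 (Num.sqrt (t0 ^+ 2 + \sum_(0 <= t < N n)
    qvar (lin_coef (A n) (N n)) (quad_coef (A n) (N n) : R) t))| < e / 4.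
  by near: n; exact: h2.
have h6 : `|0 - K * eta n| < e / 4 by near: n; exact: h3.
rewrite sub0r normrN in h6; have h7 := ler_norm (K * eta n).
rewrite distrC in h4; move: h4; rewrite -/(nu n) -/(eta n) -/(S n) => h4.
apply: (le_lt_trans (ler_distD (heat s0 (Num.sqrt (t0 ^+ 2 + sg ^+ 2))) _ _)).
set T := Num.sqrt (_ + \sum_(_ <= _ < _) _) in h4 h5.
have h8 := ler_distD (heat s0 T) (heat s0 (Num.sqrt (t0 ^+ 2 + sg ^+ 2)))
   (expect (N n) (fun z => gap (s0 + S n z))).
lra.
Unshelve. all: by end_near. Qed.

Let b : R := sg ^+ 2 / 2.

(** The L^1 distance of M - S from its mean, then the excess of that mean over b. The maximum tends
    to 0 because b = sL / 2 + r^2 / 4. *)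
Let er n : R := 72 * C ^+ 4 * (1 + moment_bound 8) * eta n +
  (Num.max 0 (2^-1 * x n + 4^-1 * y n - b) +
   16 * C ^+ 3 * (1 + moment_bound 5) * eta n).

Let er_cvg : er @ \oo --> (0 : R).
Proof.
have h1 c : (fun n => c * eta n) @ \oo --> (0 : R).
  by rewrite -(mulr0 c); apply: cvgM eta_cvg; exact: cvg_cst.
rewrite -[X in _ --> X]addr0; apply: cvgD => //.
rewrite -[X in _ --> X]addr0; apply: cvgD => //.
have h : (fun n => 2^-1 * x n + 4^-1 * y n - b) @ \oo --> 2^-1 * sL + 4^-1 * r ^+ 2 - b.
  apply: cvgB; last exact: cvg_cst.
  by apply: cvgD; apply: cvgM => //; exact: cvg_cst.
have e : 2^-1 * sL + 4^-1 * r ^+ 2 - b = 0 by rewrite /b sg2; field.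
rewrite e in h; apply/cvgrPdist_lt => d d0; near=> n.
have : `|0 - (2^-1 * x n + 4^-1 * y n - b)| < d.
  by near: n; move/cvgrPdist_lt : h; apply.
rewrite !sub0r !normrN; apply: le_lt_trans.
rewrite [leLHS]ger0_norm ?le_max ?lexx // ge_max normr_ge0 ler_norm //.
Unshelve. all: by end_near. Qed.

Let sandwich : \forall n \near \oo,
  TV R (A n) (m n) <= expect (N n) (fun z => gap (b + S n z)) + er n /\
  forall kap, 0 <= kap ->
  expect (N n) (fun z => gap (b + S n z)) - 1 +
    expR kap * (1 - expect (N n) (fun z => gap (b + kap + S n z)) - er n) <=
  TV R (A n) (m n).
Proof.
near=> n.
have [n0 N0 nu1 b1 [b2 b3]] : regular n.
  by near: n; exact: good.
have e : m n = (N n + balls (A n))%N by near: n; exact: mE.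
have g1 := expect_log_ratio_qstat n0 (A n) (N n) C C1 nu1 b1 b2.
have g2 := expect_log_ratio n0 (A n) (N n) C C1 nu1 b1 b2 b3.
have nu0 : 0 < nu n by lra.
have M5 : 0 <= moment_bound 5 :> R := moment_bound_ge0 5.
have C0 : 0 <= C by have := C1; lra.
have eta0 : 0 <= eta n by rewrite addr_ge0 // invr_ge0 sqrtr_ge0.
have g3 : expect (N n) (fun z => `|log_ratio (A n) (N n) z - S n z -
     expect (N n) (log_ratio (A n) (N n))|) +
   Num.max 0 (expect (N n) (log_ratio (A n) (N n)) - b) <= er n.
  apply: lerD; first exact: g1.
  have p0 : 0 <= 16 * C ^+ 3 * (1 + moment_bound 5) * eta n.
    by rewrite mulr_ge0 // mulr_ge0 ?addr_ge0 // mulr_ge0 ?exprn_ge0.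
  rewrite ge_max addr_ge0 ?le_max ?lexx //=.
  have : 2^-1 * x n + 4^-1 * y n - b <= Num.max 0 (2^-1 * x n + 4^-1 * y n - b).
    by rewrite le_max lexx orbT.
  move: g2; rewrite -/(nu n) -/(k n).
  have -> : (\sum_i excess (A n) i ^+ 2) / (2 * nu n) = 2^-1 * x n.
    by rewrite /x; field; rewrite gt_eqF.
  have -> : n%:R * (k n / n%:R) ^+ 2 / (4 * nu n ^+ 2) = 4^-1 * y n.
    by rewrite /y; field; rewrite !gt_eqF // ltr0n.
  rewrite [(Num.sqrt n%:R)^-1 + _]addrC -/(eta n).
  lra.
rewrite e; split; first exact: TV_upper.
by move=> kap kap0; exact: TV_lower.
Unshelve. all: by end_near. Qed.

Lemma TV_cvg : (fun n => TV R (A n) (m n)) @ \oo --> 2 * Phi (sg / 2) - 1.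
Proof.
rewrite -heat_half // -/b; apply/cvgrPdist_lt => e e0.
have hPhi : (fun kap : R => Phi (kap / sg - sg / 2)) kap @[kap --> +oo] --> (1 : R).
  apply: cvg_comp (@Phi_cvgy R); apply/cvgryPge => B; near=> kap.
  have h : (B + sg / 2) * sg <= kap.
    by near: kap; apply: nbhs_pinfty_ge; exact: num_real.
  by rewrite lerBrDr ler_pdivlMr.
have e4 : 0 < e / 4 by rewrite divr_gt0.
(* The truncation level is fixed before n, so large that the truncated lognormal limit keeps mass at
   least 1 - e / 4. *)
have [kap [kap0 hkap]] : exists kap : R, 0 <= kap /\ 1 - e / 4 <= Phi (kap / sg - sg / 2).
  near (pinfty_nbhs R) => kap; exists kap; split.
    by near: kap; apply: nbhs_pinfty_ge; exact: num_real.
  have : `|1 - Phi (kap / sg - sg / 2)| < e / 4.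
    by near: kap; move/cvgrPdist_lt : hPhi; exact.
  by rewrite ltr_norml => /andP[]; lra.
have mass := heat_mass sg kap sg0; rewrite -/b in mass.
have low : (fun n => expect (N n) (fun z => gap (b + S n z)) - 1 +
    expR kap * (1 - expect (N n) (fun z => gap (b + kap + S n z)) - er n)) @ \oo -->
    heat b sg - 1 + expR kap * (1 - heat (b + kap) sg - 0).
  apply: cvgD; first by apply: cvgB; [exact: clt|exact: cvg_cst].
  apply: cvgM; first exact: cvg_cst.
  by apply: cvgB er_cvg; apply: cvgB (clt _); exact: cvg_cst.
have up : (fun n => expect (N n) (fun z => gap (b + S n z)) + er n) @ \oo -->
    heat b sg + 0 by apply: cvgD er_cvg; exact: clt.
rewrite addr0 in up; rewrite subr0 in low.
move/cvgrPdist_lt : low => /(_ _ e4) low.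
move/cvgrPdist_lt : up => /(_ _ e4) up.
near=> n.
have [s1 /(_ kap kap0) s2] : TV R (A n) (m n) <= expect (N n) (fun z => gap (b + S n z)) + er n /\
  forall kap, 0 <= kap ->
  expect (N n) (fun z => gap (b + S n z)) - 1 +
    expR kap * (1 - expect (N n) (fun z => gap (b + kap + S n z)) - er n) <=
  TV R (A n) (m n) by near: n; exact: sandwich.
have l1 : `|heat b sg - 1 + expR kap * (1 - heat (b + kap) sg) -
  (expect (N n) (fun z => gap (b + S n z)) - 1 +
    expR kap * (1 - expect (N n) (fun z => gap (b + kap + S n z)) - er n))| < e / 4.
  by near: n; exact: low.
have l2 : `|heat b sg - (expect (N n) (fun z => gap (b + S n z)) + er n)| < e / 4.
  by near: n; exact: up.
move: l1 l2; rewrite !ltr_norml => /andP[_ l1] /andP[l2 _].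
apply/andP; split; lra.
Unshelve. all: by end_near. Qed.

End Asymptotics.

(** * The three regimes *)

Section Regimes.
Context {R : realType}.
Implicit Types f g : nat -> R.

Lemma equiv_cvg_ratio f g : (\forall n \near \oo, g n != 0) -> f ~_\oo g ->
  (fun n => f n / g n) @ \oo --> (1 : R).
Proof.
move=> g0 /eqaddoP fg; apply/cvgrPdist_le => e e0; have := fg e e0 => fge.
near=> n; have gn : g n != 0 by near: n.
have : `|f n - g n| <= e * `|g n| by near: n.
rewrite -ler_pdivrMr ?normr_gt0 // => h.
have -> : 1 - f n / g n = - ((f n - g n) / g n) by field.
by rewrite normrN normrM normfV.
Unshelve. all: by end_near. Qed.

Lemma littleo_cvg_ratio f g : (\forall n \near \oo, g n != 0) -> f =o_\oo g ->
  (fun n => f n / g n) @ \oo --> (0 : R).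
Proof.
move=> g0 /eqoP fg; apply/cvgrPdist_le => e e0; have := fg e e0 => fge.
near=> n; have gn : g n != 0 by near: n.
have : `|f n| <= e * `|g n| by near: n.
rewrite -ler_pdivrMr ?normr_gt0 // => h.
by rewrite sub0r normrN normrM normfV.
Unshelve. all: by end_near. Qed.

Lemma cvg_inv_infty f : f @ \oo --> +oo -> (fun n => (f n)^-1) @ \oo --> (0 : R).
Proof.
move=> fy; apply/cvgrPdist_lt => e e0; near=> n.
have e1 : 0 < e^-1 by rewrite invr_gt0.
have h : e^-1 + 1 <= f n by near: n; move/cvgryPge : fy; exact.
have h2 : 0 < f n by lra.
rewrite sub0r normrN gtr0_norm ?invr_gt0 // -[ltRHS]invrK ltf_pV2 ?posrE //.
lra.
Unshelve. all: by end_near. Qed.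

Lemma powR_3half (n : nat) : n%:R `^ (3 / 2) = n%:R * Num.sqrt n%:R :> R.
Proof.
have [->|n0] := posnP n.
  by rewrite mul0r powR0 // mulf_neq0 // invr_neq0.
have -> : 3 / 2 = 1 + 2^-1 :> R by field.
rewrite powRD; last by rewrite pnatr_eq0 -lt0n n0 implybT.
by rewrite powRr1 // powR12_sqrt.
Qed.

Variables (m : nat -> nat) (A : forall n : nat, 'I_n -> nat) (c : R).
Let k n : R := (balls (A n))%:R.
Hypothesis k_large : (fun n => k n / Num.sqrt n%:R) @ \oo --> +oo.
Hypothesis c0 : 0 < c.

Let pos : \forall n \near \oo, [/\ 0 < k n, 0 < n%:R :> R & 0 < Num.sqrt n%:R :> R].
Proof.
near=> n.
have n0 : (0 < n)%N by near: n; exists 1%N.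
have q0 : 0 < Num.sqrt (n%:R : R) by rewrite sqrtr_gt0 ltr0n.
have h : 1 <= k n / Num.sqrt n%:R by near: n; move/cvgryPge : k_large; exact.
split => //; last by rewrite ltr0n.
by rewrite -(pmulr_lgt0 _ (x := (Num.sqrt n%:R)^-1)) ?invr_gt0 //; lra.
Unshelve. all: by end_near. Qed.

Let m_pos (g : nat -> R) : (\forall n \near \oo, g n != 0) ->
  (fun n => (m n)%:R) ~_\oo g -> \forall n \near \oo, (0 < m n)%N.
Proof.
move=> g0 mg; have h := equiv_cvg_ratio _ _ g0 mg; near=> n.
have : `|1 - (m n)%:R / g n| < 1 by near: n; move/cvgrPdist_lt : h; apply.
by rewrite lt0n; apply: contraTN => /eqP ->; rewrite mul0r subr0 normr1 ltxx.
Unshelve. all: by end_near. Qed.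

Let scale n : R := k n / n%:R `^ (3 / 2).

(** Covers the flat regime, with l = 0, and the intermediate one, with l = lambda. *)
Lemma TV_cvg_linear (l : R) : 0 <= l ->
  (fun n => V R (A n) / scale n) @ \oo --> l ->
  (fun n => (m n)%:R : R) ~_\oo (fun n => c * k n * Num.sqrt n%:R) ->
  (fun n => TV R (A n) (m n)) @ \oo -->
    2 * Phi (Num.sqrt (l / c + c^-1 ^+ 2 / 2) / 2) - 1.
Proof.
move=> l0 hV hm.
have g0 : \forall n \near \oo, c * k n * Num.sqrt n%:R != 0.
  near=> n; have [k0 n0 q0] : [/\ 0 < k n, 0 < n%:R :> R & 0 < Num.sqrt n%:R :> R].
    by near: n; exact: pos.
  by rewrite gt_eqF // !mulr_gt0.
have mp := m_pos _ g0 hm.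
have quad : (fun n => k n * Num.sqrt n%:R / (m n)%:R) @ \oo --> c^-1.
  have h : (fun n => ((m n)%:R / (c * k n * Num.sqrt n%:R))^-1 * c^-1) @ \oo -->
     1^-1 * c^-1.
    apply: cvgM; last exact: cvg_cst.
    by apply: cvgV; [exact: oner_neq0|exact: equiv_cvg_ratio].
  rewrite invr1 mul1r in h; apply: cvg_trans h; apply: near_eq_cvg; near=> n.
  have [k0 n0 q0] : [/\ 0 < k n, 0 < n%:R :> R & 0 < Num.sqrt n%:R :> R].
    by near: n; exact: pos.
  have m0 : (0 < m n)%N by near: n.
  field; rewrite !gt_eqF //; by rewrite ltr0n.
have lin : (fun n => n%:R ^+ 2 * V R (A n) / (m n)%:R) @ \oo --> l / c.
  have h : (fun n => V R (A n) / scale n * (k n * Num.sqrt n%:R / (m n)%:R)) @ \oo -->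
     l * c^-1 by exact: cvgM.
  apply: cvg_trans h; apply: near_eq_cvg; near=> n.
  have [k0 n0 q0] : [/\ 0 < k n, 0 < n%:R :> R & 0 < Num.sqrt n%:R :> R].
    by near: n; exact: pos.
  have m0 : (0 < m n)%N by near: n.
  rewrite /scale powR_3half -[in n%:R ^+ 2](sqr_sqrtr (ltW n0)).
  rewrite -[in X in k n / (X * _)](sqr_sqrtr (ltW n0)).
  have sq : Num.sqrt (Num.sqrt n%:R ^+ 2) = Num.sqrt (n%:R : R).
    by rewrite sqr_sqrtr // ltW.
  rewrite ?sq; field; rewrite !gt_eqF //; by rewrite ltr0n.
apply: TV_cvg => //.
rewrite ltr_wpDl ?divr_ge0 ?(ltW c0) // divr_gt0 // exprn_gt0 // invr_gt0 //.
Unshelve. all: by end_near. Qed.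

Lemma TV_cvg_hilly :
  (fun n => V R (A n) / scale n) @ \oo --> +oo ->
  (fun n => (m n)%:R : R) ~_\oo (fun n => c * V R (A n) * n%:R ^+ 2) ->
  (fun n => TV R (A n) (m n)) @ \oo --> 2 * Phi (Num.sqrt c^-1 / 2) - 1.
Proof.
move=> hV hm.
have Vpos : \forall n \near \oo, 0 < V R (A n).
  near=> n; have [k0 n0 q0] : [/\ 0 < k n, 0 < n%:R :> R & 0 < Num.sqrt n%:R :> R].
    by near: n; exact: pos.
  have h : 1 <= V R (A n) / scale n by near: n; move/cvgryPge : hV; exact.
  have s0 : 0 < (scale n)^-1 by rewrite invr_gt0 divr_gt0 // powR_gt0.
  by rewrite -(pmulr_lgt0 _ s0); lra.
have g0 : \forall n \near \oo, c * V R (A n) * n%:R ^+ 2 != 0.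
  near=> n; have [k0 n0 q0] : [/\ 0 < k n, 0 < n%:R :> R & 0 < Num.sqrt n%:R :> R].
    by near: n; exact: pos.
  by rewrite gt_eqF // !mulr_gt0 //; near: n.
have mp := m_pos _ g0 hm.
have lin : (fun n => n%:R ^+ 2 * V R (A n) / (m n)%:R) @ \oo --> c^-1.
  have h : (fun n => ((m n)%:R / (c * V R (A n) * n%:R ^+ 2))^-1 * c^-1) @ \oo -->
     1^-1 * c^-1.
    apply: cvgM; last exact: cvg_cst.
    by apply: cvgV; [exact: oner_neq0|exact: equiv_cvg_ratio].
  rewrite invr1 mul1r in h; apply: cvg_trans h; apply: near_eq_cvg; near=> n.
  have [k0 n0 q0] : [/\ 0 < k n, 0 < n%:R :> R & 0 < Num.sqrt n%:R :> R].
    by near: n; exact: pos.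
  have m0 : 0 < (m n)%:R :> R by rewrite ltr0n; near: n.
  have V0 : 0 < V R (A n) by near: n.
  by field; rewrite !gt_eqF.
(* The ratio k sqrt(n) / m is n^2 V / m divided by V / scale, which tends to infinity: the quadratic
   term disappears. *)
have quad : (fun n => k n * Num.sqrt n%:R / (m n)%:R) @ \oo --> (0 : R).
  have h : (fun n => n%:R ^+ 2 * V R (A n) / (m n)%:R * (V R (A n) / scale n)^-1) @ \oo
     --> c^-1 * 0 by apply: cvgM => //; exact: cvg_inv_infty.
  rewrite mulr0 in h; apply: cvg_trans h; apply: near_eq_cvg; near=> n.
  have [k0 n0 q0] : [/\ 0 < k n, 0 < n%:R :> R & 0 < Num.sqrt n%:R :> R].
    by near: n; exact: pos.
  have m0 : 0 < (m n)%:R :> R by rewrite ltr0n; near: n.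
  have V0 : 0 < V R (A n) by near: n.
  rewrite /scale powR_3half; set q := Num.sqrt n%:R in q0 *.
  have e : n%:R = q ^+ 2 by rewrite sqr_sqrtr // ltW.
  by rewrite e; field; rewrite !gt_eqF.
have -> : c^-1 = c^-1 + 0 ^+ 2 / 2 by rewrite expr0n mul0r addr0.
apply: TV_cvg => //.
by rewrite expr0n /= mul0r addr0 invr_gt0.
Unshelve. all: by end_near. Qed.

End Regimes.

Theorem theorem1 (R : realType) (k m : nat -> nat)
    (A : forall n : nat, 'I_n -> nat) (c : R)
    (hk : forall n : nat, balls (A n) = k n)
    (hkn : (fun n => (k n)%:R / Num.sqrt n%:R : R) @ \oo --> +oo)
    (hc : 0 < c) :
  [/\ (* flat regime *)
      (fun n => V R (A n)) =o_\oo (fun n => (k n)%:R / n%:R `^ (3 / 2)) ->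
      (fun n => (m n)%:R : R) ~_\oo (fun n => c * (k n)%:R * Num.sqrt n%:R) ->
      (fun n => TV R (A n) (m n)) @ \oo -->
        2 * Phi (1 / (2 * Num.sqrt 2 * c)) - 1,
      (* hilly regime *)
      (fun n => V R (A n) / ((k n)%:R / n%:R `^ (3 / 2))) @ \oo --> +oo ->
      (fun n => (m n)%:R : R) ~_\oo (fun n => c * V R (A n) * n%:R ^+ 2) ->
      (fun n => TV R (A n) (m n)) @ \oo -->
        2 * Phi (1 / (2 * Num.sqrt c)) - 1
    & (* intermediate regime *)
      forall lambda : R, 0 < lambda ->
      (fun n => V R (A n)) ~_\oo
        (fun n => lambda * ((k n)%:R / n%:R `^ (3 / 2))) ->
      (fun n => (m n)%:R : R) ~_\oo (fun n => c * (k n)%:R * Num.sqrt n%:R) ->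
      (fun n => TV R (A n) (m n)) @ \oo -->
        2 * Phi (2^-1 * Num.sqrt (lambda / c + 1 / (2 * c ^+ 2))) - 1].
Proof.
have kE : k = fun n => balls (A n) by apply/funext => n; rewrite hk.
subst k; clear hk.
have scale0 : \forall n \near \oo,
    (balls (A n))%:R / n%:R `^ (3 / 2) != 0 :> R.
  near=> n.
  have n0 : (0 < n)%N by near: n; exists 1%N.
  have h : 1 <= (balls (A n))%:R / Num.sqrt n%:R :> R.
    by near: n; move/cvgryPge : hkn; exact.
  rewrite mulf_neq0 // ?invr_neq0 ?gt_eqF ?powR_gt0 ?ltr0n //.
  by rewrite lt0n; apply/eqP => b0; move: h; rewrite b0 mul0r ler10.
split => [hV hm|hV hm|l l0 hV hm].
(* For l = 0 the limiting standard deviation is 1 / (sqrt(2) c), and the argument of Phi is half of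
   it. *)
- have -> : 1 / (2 * Num.sqrt 2 * c) = Num.sqrt (0 / c + c^-1 ^+ 2 / 2) / 2.
    rewrite mul0r add0r sqrtrM ?sqr_ge0 // sqrtr_sqr gtr0_norm ?invr_gt0 // sqrtrV //.
    by field; rewrite !gt_eqF // sqrtr_gt0.
  by apply: TV_cvg_linear => //; exact: littleo_cvg_ratio.
- have -> : 1 / (2 * Num.sqrt c) = Num.sqrt c^-1 / 2.
    by rewrite sqrtrV ?(ltW hc) //; field; rewrite gt_eqF // sqrtr_gt0.
  exact: TV_cvg_hilly.
have -> : 2^-1 * Num.sqrt (l / c + 1 / (2 * c ^+ 2)) =
    Num.sqrt (l / c + c^-1 ^+ 2 / 2) / 2.
  by rewrite mulrC; congr (Num.sqrt (_ + _) / _); field; rewrite gt_eqF.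
apply: TV_cvg_linear => //; first exact: ltW.
have g0 : \forall n \near \oo, l * ((balls (A n))%:R / n%:R `^ (3 / 2)) != 0.
  by near=> n; apply: mulf_neq0; [rewrite gt_eqF|near: n].
have h : (fun n => l * (V R (A n) / (l * ((balls (A n))%:R / n%:R `^ (3 / 2))))) @ \oo
    --> l * 1 by apply: cvgM; [exact: cvg_cst|exact: equiv_cvg_ratio].
rewrite mulr1 in h; apply: cvg_trans h; apply: near_eq_cvg; near=> n.
have s0 : (balls (A n))%:R / n%:R `^ (3 / 2) != 0 :> R by near: n.
move: s0; set s := _ / _ => s0.
by field; rewrite s0 gt_eqF.
Unshelve. all: by end_near. Qed.
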